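(* Let $d=2$, let $f$ be a probability density function on $\mathbb{R}^2$ and let $x\in\mathbb{R}^2$ be a Lebesgue point of $f$ such that $f(x)>0$. For each $n\ge1$ let $A_n(x)$ be the Voronoi cell with nucleus $x$ in the Voronoi diagram generated by $\{x,X_1,\dots,X_n\}$, where $X_1,\dots,X_n$ are i.i.d. with density $f$. Then $$\sup_{n\ge1}\mathbb{E}\left[\left(\text{the number of edges of }A_n(x)\right)^2\right]<\infty.$$ Moreover, $$\lim_{n\to\infty}\mathbb{E}\left[\text{the number of edges of }A_n(x)\right]=6.$$
   Context: $\|\cdot\|$ is the Euclidean norm, $\lambda$ is Lebesgue measure on $\mathbb{R}^2$, and $B_{z,r}$ is the open ball with center $z$ and radius $r$. A point $x\in\mathbb{R}^2$ is a Lebesgue point of $f$ if $\lim_{r\to0}\frac{1}{\lambda(B_{x,r})}\int_{B_{x,r}}|f(u)-f(x)|\,du=0$. The Voronoi cell with nucleus $x$ in the Voronoi diagram generated by $\{x,X_1,\dots,X_n\}$ is $A_n(x)=\{p\in\mathbb{R}^2:\ \|p-x\|\le\|p-X_i\|\ \text{for all } i=1,\dots,n\}$; it is an intersection of half-planes, possibly unbounded, and its edges are its one-dimensional faces. *)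

(* Defs.v *)
From HB Require Import structures.
From mathcomp Require Import all_boot all_order all_algebra finmap.
From mathcomp Require Import all_classical all_reals all_analysis.

Set Implicit Arguments.
Unset Strict Implicit.
Unset Printing Implicit Defensive.

Import Order.TTheory GRing.Theory Num.Theory.
Import numFieldNormedType.Exports.

Local Open Scope classical_set_scope.
Local Open Scope ring_scope.

Section plane.
Context {R : realType}.
Implicit Types (p q r : R * R) (A F : set (R * R)).

Definition dot p q : R := p.1 * q.1 + p.2 * q.2.

(* The norm [`|p|] that the library puts on [R * R] is the sup norm. *)
Definition enorm p : R := Num.sqrt (p.1 ^+ 2 + p.2 ^+ 2).

Definition eball p (r : R) : set (R * R) := [set q | enorm (q - p) < r].

(* [lebesgue_measure] lives on [measurableTypeR R]; its sigma-algebra is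
   convertible to the one carried by [R], and so are the products. *)
Definition lebesgue2 :
    {measure set (measurableTypeR R * measurableTypeR R) -> \bar R} :=
  (@lebesgue_measure R \x @lebesgue_measure R)%E.

(* Two-dimensional version of [lebesgue_pt] (which is stated for [R -> R]). *)
Definition lebesgue_pt2 (f : R * R -> R) p :=
  ((fine (lebesgue2 (eball p r)))^-1%:E *
    \int[lebesgue2]_(u in eball p r) `|f u - f p|%:E)%E @[r --> (0 : R)^'+]
  --> 0%E.

Definition is_pdf (f : R * R -> R) :=
  [/\ measurable_fun setT f, forall p, 0 <= f p
    & (\int[lebesgue2]_p (f p)%:E = 1)%E].

(* [y 0, ..., y n.-1] are the other nuclei. *)
Definition voronoi_cell n (y : nat -> R * R) p : set (R * R) :=
  [set q | forall i, (i < n)%N -> enorm (q - p) <= enorm (q - y i)].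

(* [u = 0] is allowed, so that [set0] and [A] itself are (improper) faces. *)
Definition is_face A F :=
  exists u c, (forall p, A p -> dot u p <= c) /\
    F = A `&` [set p | dot u p = c].

(* The affine hull of [F] is a line. *)
Definition one_dimensional F :=
  exists p q, [/\ p != q, F p, F q
    & F `<=` range (fun t : R => p + t *: (q - p))].

Definition edges A : set (set (R * R)) :=
  [set F | is_face A F /\ one_dimensional F].

Definition number_of_edges A : \bar R := counting (edges A).

End plane.

Section random_points.
Context {R : realType} {d : measure_display} {T : measurableType d}.
Variable P : probability T R.

Definition mutually_independent d' (T' : measurableType d')
    (X : nat -> {RV P >-> T'}) :=
  forall (J : {fset nat}) (B : nat -> set T'),
    (forall i, i \in J -> measurable (B i)) ->
    P (\bigcap_(i in [set` J]) (X i @^-1` B i)) =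
    (\prod_(i <- J) P (X i @^-1` B i))%E.

Definition iid_with_density (f : R * R -> R) (X : nat -> {RV P >-> (R * R)%type}) :=
  mutually_independent X /\
  forall i B, measurable B ->
    distribution P (X i) B = (\int[lebesgue2]_(p in B) (f p)%:E)%E.

End random_points.

(* Main.v *)
(* Almost surely the points are in general position, and then the vertices of
   the cell correspond to the pairs (X_i, X_j), counterclockwise around x, such
   that the circumdisc of (x, X_i, X_j) contains no other point. Every vertex
   ends one edge, so the number N of edges is at least the number of vertices
   at distance less than r from x; both numbers agree as soon as each of four
   squares near x, one per quadrant, of size of order r, contains a point.

   The value 6 comes from a symmetry, not from a computed integral. By Tonelli,
   the expected number of local vertices is n (n - 1) times the integral of
   (1 - mu (circumdisc))^(n - 2) over pairs. With r^2 = L / n, and x a Lebesgue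
   point, mu can be replaced by f x times the Lebesgue measure up to o(1). The
   resulting integral is invariant under the rotation of the triangle
   (x, y, z), up to translation, that puts y in the place of x. Since exactly
   one vertex of a triangle is in the middle for the second coordinate, the pairs
   for which this is x contribute one third. But these pairs are the leftmost
   and the rightmost vertex of the cell, whose number is exactly 2 when the cell
   is bounded: hence 3 * 2 = 6.

   For the second moment, N^2 - N counts ordered pairs of edges; the farther
   nucleus of such a pair, at distance s, forces one of the four squares of size
   of order s to contain no other point. The expected number of pairs of points
   with this property is bounded by splitting the plane into annuli. The
   same bound controls the contribution to E N of the bad event on which the
   cell is not local, as N <= eta N^2 + 1 / (4 eta). *)
Require Import Defs.
From HB Require Import structures.
From mathcomp Require Import all_boot all_order all_algebra finmap.
From mathcomp Require Import all_classical all_reals all_analysis.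
From mathcomp Require Import measurable_realfun ring lra.

Set Implicit Arguments.
Unset Strict Implicit.
Unset Printing Implicit Defensive.

Import Order.TTheory GRing.Theory Num.Theory.
Import numFieldNormedType.Exports.

Local Open Scope classical_set_scope.
Local Open Scope ring_scope.

(** * Polygons *)

(** [number_of_edges] is never shown to be measurable as a function of the sample. It agrees almost
    surely with [nb_sides], and its integrals are only squeezed between integrals of measurable
    counts of pairs; the integral of a nonnegative function as a supremum over simple functions
    makes this possible. One side of the squeeze is free: in general position, sending a vertex to
    the side that it ends is injective, while surjectivity needs a bounded cell. The four squares
    come from one remark: a disc with x on its boundary and its center at distance at least s from x
    covers, in the quadrant of its center, the square of the points whose coordinates relative to x
    are between s/4 and s/2 in absolute value. The disc around a point of the cell through x
    contains no nucleus, so the square is void. For far points of the cell this bounds the cell; for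
    a point of an edge it gives the second moment. No area of a disc is computed: it depends on the
    radius only and is between s^2/16 and 4 s^2. The Lebesgue integral that approximates the count
    of all local vertices is 3 times the one for the leftmost and rightmost vertices, and it is
    eliminated between the two. *)

Section plane_geometry.
Context {R : realType}.
Implicit Types p q u : R * R.

Definition cross p q : R := p.1 * q.2 - p.2 * q.1.

(* The intersection of the lines [dot u p = a] and [dot v p = b]; junk when they
   are parallel. *)
Definition line_meet u (a : R) v (b : R) : R * R :=
  ((a * v.2 - b * u.2) / cross u v, (u.1 * b - v.1 * a) / cross u v).

Lemma dotDr u p q : dot u (p + q) = dot u p + dot u q.
Proof. by rewrite /dot /=; ring. Qed.

Lemma dotZr u (t : R) p : dot u (t *: p) = t * dot u p.
Proof. by rewrite /dot /= /GRing.scale /=; ring. Qed.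

Lemma dotNr u p : dot u (- p) = - dot u p.
Proof. by rewrite /dot /=; ring. Qed.

Lemma dotNl u p : dot (- u) p = - dot u p.
Proof. by rewrite /dot /=; ring. Qed.

Lemma dotBr u p q : dot u (p - q) = dot u p - dot u q.
Proof. by rewrite dotDr dotNr. Qed.

Lemma dot_line_meetl u a v b : cross u v != 0 -> dot u (line_meet u a v b) = a.
Proof. by rewrite /dot /line_meet /= /cross => ?; field. Qed.

Lemma dot_line_meetr u a v b : cross u v != 0 -> dot v (line_meet u a v b) = b.
Proof. by rewrite /dot /line_meet /= /cross => ?; field. Qed.

Lemma line_meet_uniq u a v b p :
  cross u v != 0 -> dot u p = a -> dot v p = b -> p = line_meet u a v b.
Proof.
case: p => p1 p2 /[swap] <- /[swap] <-; rewrite /dot /line_meet /cross /= => ?.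
by congr pair; field.
Qed.

Lemma dotvv_eq0 p : dot p p = 0 -> p = 0.
Proof.
case: p => p1 p2; rewrite /dot /= => h.
have h1 : p1 = 0 by nra.
by rewrite h1; congr pair; nra.
Qed.

Lemma dotvv_gt0 p : p != 0 -> 0 < dot p p.
Proof.
move=> p0; rewrite lt_neqAle; apply/andP; split.
  by apply: contra_neq p0 => /esym; exact: dotvv_eq0.
by rewrite /dot addr_ge0// -expr2 sqr_ge0.
Qed.

(** In the plane the vectors orthogonal to [u] form a line: the identity [dot u u * cross p q = dot
    u p * cross u q - dot u q * cross u p] gives [cross p q = 0]. *)
Lemma ortho_collinear u p q : u != 0 -> p != 0 -> dot u p = 0 -> dot u q = 0 ->
  q = (dot q p / dot p p) *: p.
Proof.
move=> u0 p0 up uq; have p2 := dotvv_gt0 p0; have u2 := dotvv_gt0 u0.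
have c0 : cross p q = 0.
  have : dot u u * cross p q = 0.
    have -> : dot u u * cross p q = dot u p * cross u q - dot u q * cross u p.
      by rewrite /dot /cross; ring.
    by rewrite up uq !mul0r subr0.
  by move/eqP; rewrite mulf_eq0 gt_eqF//= => /eqP.
have : dot p p *: q = dot q p *: p.
  case: p q c0 {p0 up uq p2} => [p1 p2] [q1 q2]; rewrite /cross /dot /= => c0.
  congr pair; rewrite /= /GRing.scale /=; apply/eqP; rewrite -subr_eq0.
    by rewrite -(mulr0 (- p2)) -c0; apply/eqP; ring.
  by rewrite -(mulr0 p1) -c0; apply/eqP; ring.
move=> h; rewrite mulrC -scalerA -h scalerA mulVf ?scale1r//.
by rewrite gt_eqF.
Qed.

Lemma perp_neq0 p : p != 0 -> (- p.2, p.1) != 0 :> R * R.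
Proof. by apply: contra_neq => -[/eqP]; rewrite oppr_eq0 => /eqP; case: p => ? ? /= -> ->. Qed.

(** Finitely many positive slacks tolerate a common step. The minimum starts at 1 to allow an empty
    index set, and [1 + |h i|] avoids a division by zero. *)
Lemma small_step (I : finType) (P : pred I) (g h : I -> R) :
  (forall i, P i -> 0 < g i) ->
  exists2 e, 0 < e & forall i, P i -> e * h i <= g i.
Proof.
move=> g0; have h1 i : 0 < 1 + `|h i| by rewrite (lt_le_trans ltr01)// lerDl.
pose e := \big[Num.min/1]_(i | P i) (g i / (1 + `|h i|)).
have e0 : 0 < e by apply: lt_bigmin => // i Pi; exact: divr_gt0 (g0 _ Pi) (h1 i).
exists e => // i Pi.
have : e <= g i / (1 + `|h i|) by exact: bigmin_le_cond.
rewrite ler_pdivlMr//; apply: le_trans; rewrite ler_pM2l//.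
by apply: le_trans (ler_norm _) _; rewrite lerDr.
Qed.

End plane_geometry.

Section polygon.
Context {R : realType} (n : nat).
Implicit Types (a : 'I_n -> R * R) (b : 'I_n -> R) (x : R * R) (i j k : 'I_n).

Definition polygon a b : set (R * R) := [set q | forall i, dot (a i) q <= b i].

Definition side a b i : set (R * R) := polygon a b `&` [set q | dot (a i) q = b i].

Definition has_side a b i :=
  exists p q, [/\ p != q, side a b i p & side a b i q].

Definition vertex a b i j := line_meet (a i) (b i) (a j) (b j).

(* The side [i] ends at its intersection with the line [j], counterclockwise. *)
Definition is_vertex a b i j :=
  0 < cross (a i) (a j) /\ polygon a b (vertex a b i j).

Lemma polygon_step a b c u :
  (forall i, dot (a i) c < b i \/ dot (a i) c <= b i /\ dot (a i) u <= 0) ->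
  exists2 e, 0 < e & polygon a b (c + e *: u).
Proof.
move=> h.
have [e e0 he] := @small_step R _ (fun i => dot (a i) c < b i)
  (fun i => b i - dot (a i) c) (fun i => dot (a i) u)
  (fun i (h : dot (a i) c < b i) => etrans (subr_gt0 _ _) h).
exists e => // i; rewrite dotDr dotZr -lerBrDl.
have [/he//|[c1 c2]] := h i.
rewrite (@le_trans _ _ 0)//; last by rewrite subr_ge0.
by rewrite mulr_ge0_le0// ltW.
Qed.

Section interior_point.
Variables (a : 'I_n -> R * R) (b : 'I_n -> R) (x : R * R).
Hypothesis x_int : forall i, dot (a i) x < b i.

Lemma side_normal_neq0 i p : side a b i p -> a i != 0.
Proof.
move=> [_ /= hp]; apply/eqP => a0; move: (x_int i); rewrite -hp a0.
by rewrite /dot /= !mul0r ltxx.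
Qed.

Lemma side_edge i : has_side a b i -> edges (polygon a b) (side a b i).
Proof.
move=> [p [q [pq ip iq]]]; split; first by exists (a i), (b i).
exists p, q; split=> // z [zA /= zi].
exists (dot (z - p) (q - p) / dot (q - p) (q - p)) => //.
rewrite -(@ortho_collinear _ (a i)) ?subrKC//.
- exact: side_normal_neq0 ip.
- by rewrite subr_eq0 eq_sym.
- by move: ip iq => [_ /= hp] [_ /= hq]; rewrite dotBr hp hq subrr.
- by move: ip => [_ /= hp]; rewrite dotBr hp zi subrr.
Qed.

(** The midpoint of two points of a one-dimensional face lies on some line [i]: otherwise a short
    step from it along [u] stays in the polygon, so that [u] vanishes and the face is the whole
    polygon, which no line contains since [x] is interior. A constraint tight at the midpoint is
    tight at both points, and two lines through [p] and [q] agree. *)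
Lemma edge_side F : edges (polygon a b) F ->
  exists2 i, has_side a b i & F = side a b i.
Proof.
move=> [[u [c [uc ->]]] [p [q [pq [Ap /= up] [Aq /= uq] Fl]]]].
have d0 : q - p != 0 by rewrite subr_eq0 eq_sym.
pose m := 2^-1 *: (p + q).
have am v : dot v m = (dot v p + dot v q) / 2.
  by rewrite /m dotZr dotDr mulrC.
have [i ti] : exists i, dot (a i) m = b i.
  apply: contrapT => /forallNP nt.
  have Am i : dot (a i) m < b i.
    rewrite lt_neqAle; apply/andP; split; first exact/eqP/nt.
    by rewrite am; have := Ap i; have := Aq i; lra.
  have [e e0 /uc] := @polygon_step a b m u (fun i => or_introl (Am i)).
  rewrite dotDr am (dotZr u e) up uq => h.
  have u0 : u = 0.
    apply: contrapT => /eqP/dotvv_gt0 uu; nra.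
  have c0 : c = 0 by rewrite -up u0 /dot /=; lra.
  (* With [u = 0] the face contains [x] and also a point reached from [x] perpendicularly to
     [q - p]; both would lie on the line through [p] and [q]. *)
  have [f f0 Ay] := @polygon_step a b x (- (q - p).2, (q - p).1)
    (fun i => or_introl (x_int i)).
  have Ax : polygon a b x by move=> i; exact/ltW.
  have dot0 z : dot u z = c by rewrite u0 c0 /dot /=; lra.
  have [t _ xt] : range (fun t => p + t *: (q - p)) x.
    by apply: Fl; split=> //=; exact: dot0.
  have [s _ ys] : range (fun t => p + t *: (q - p))
      (x + f *: (- (q - p).2, (q - p).1)).
    by apply: Fl; split=> //=; exact: dot0.
  have : cross (q - p) (f *: (- (q - p).2, (q - p).1)) = 0.
    have -> : f *: (- (q - p).2, (q - p).1) = (s - t) *: (q - p).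
      apply: (addrI x); rewrite -ys -[in RHS]xt.
      by rewrite -addrA -scalerDl [t + _]addrC subrK.
    by rewrite /cross /= /GRing.scale /=; ring.
  have -> : cross (q - p) (f *: (- (q - p).2, (q - p).1)) = f * dot (q - p) (q - p).
    by rewrite /cross /dot /= /GRing.scale /=; ring.
  by apply/eqP; rewrite gt_eqF// mulr_gt0// dotvv_gt0.
have [ip iq] : dot (a i) p = b i /\ dot (a i) q = b i.
  by move: ti; rewrite am; have := Ap i; have := Aq i; split; lra.
have ai0 : a i != 0 by exact: (@side_normal_neq0 i p).
exists i; first by exists p, q.
apply/seteqP; split=> [z [Az /= uz]|z [Az /= iz]]; split=> //=.
  have [t _ <-] := Fl z (conj Az uz).
  by rewrite dotDr dotZr dotBr ip iq subrr mulr0 addr0.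
have zp : z - p = (dot (z - p) (q - p) / dot (q - p) (q - p)) *: (q - p).
  apply: (@ortho_collinear _ (a i)) => //.
    by rewrite dotBr ip iq subrr.
  by rewrite dotBr ip iz subrr.
by rewrite -(subrK p z) zp [LHS]dotDr dotZr [in dot u _]dotBr up uq subrr mulr0 add0r.
Qed.

Hypothesis nonpar : forall i j, i != j -> cross (a i) (a j) != 0.

Lemma side_inj i j : has_side a b i -> side a b i = side a b j -> i = j.
Proof.
move=> [p [q [pq ip iq]]] ij; apply/eqP/negPn/negP => /nonpar c0.
have : p = q; last by move/eqP; apply/negP.
move: (ip) (iq); rewrite ij => -[_ /= jp] [_ /= jq].
by rewrite (line_meet_uniq c0 ip.2 jp) (line_meet_uniq c0 iq.2 jq).
Qed.

Lemma number_of_edges_polygon :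
  number_of_edges (polygon a b) = #|[set i | `[< has_side a b i >]]%SET|%:R%:E.
Proof.
pose S := [set i | `[< has_side a b i >]]%SET.
pose fS := [fset side a b i | i in enum S]%fset.
have eE : edges (polygon a b) = [set` fS].
  apply/seteqP; split=> F /=.
    move=> /edge_side[i hi ->]; apply/imfsetP; exists i => //=.
    by rewrite mem_enum inE; exact/asboolP.
  move=> /imfsetP[i /=]; rewrite mem_enum inE => /asboolP hi ->.
  exact: side_edge.
rewrite /number_of_edges /counting eE asboolT//; congr (_%:R%:E).
rewrite set_fsetK /fS card_in_imfset /=; last first.
  move=> i j; rewrite mem_enum inE => /asboolP hi _; exact: side_inj.
by rewrite undup_id ?enum_uniq// cardE.
Qed.

Hypothesis simple : forall i j k,
  i != j -> k != i -> k != j -> dot (a k) (vertex a b i j) != b k.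

Lemma is_vertex_neq i j : is_vertex a b i j -> i != j.
Proof.
move=> [+ _]; apply: contraTneq => ->; rewrite /cross -leNgt.
by rewrite (mulrC (a j).1) subrr.
Qed.

Lemma vertex_tight i j k :
  i != j -> dot (a k) (vertex a b i j) = b k -> k = i \/ k = j.
Proof.
move=> ij hk; have [->|ki] := eqVneq k i; first by left.
have [->|kj] := eqVneq k j; first by right.
by have := simple ij ki kj; rewrite hk eqxx.
Qed.

(** Walking back from the vertex along line [i] relaxes the constraint [j]; all others are slack
    there, because no third line passes through the vertex. *)
Lemma is_vertex_has_side i j : is_vertex a b i j -> has_side a b i.
Proof.
move=> vij; have ij := is_vertex_neq vij; have c0 := nonpar ij.
move: vij => [cij Ac]; set c := vertex a b i j in Ac.
have ic : dot (a i) c = b i by exact: dot_line_meetl.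
have jc : dot (a j) c = b j by exact: dot_line_meetr.
pose u : R * R := ((a i).2, - (a i).1).
have iu : dot (a i) u = 0 by rewrite /dot /=; ring.
have ju : dot (a j) u = - cross (a i) (a j) by rewrite /dot /cross /=; ring.
have [k|e e0 Ae] := @polygon_step a b c u.
  have [->|kj] := eqVneq k j; first by right; rewrite jc ju; split=> //; lra.
  have [->|ki] := eqVneq k i; first by right; rewrite ic iu; split.
  by left; rewrite lt_neqAle Ac andbT simple.
exists (c + e *: u), c; split=> //.
- rewrite eq_sym -subr_eq0 opprD addNKr oppr_eq0 scaler_eq0 gt_eqF//=.
  apply/eqP => u0; move: ju; rewrite u0 /dot /=; nra.
- by split=> //=; rewrite dotDr dotZr iu mulr0 addr0.
Qed.

(* Moving along the line [i] in the direction [(- (a i).2, (a i).1)], a point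
   of the side meets first the constraint [j]. *)
Lemma is_vertex_inj i j k : is_vertex a b i j -> is_vertex a b i k -> j = k.
Proof.
move=> vij vik; have ij := is_vertex_neq vij; have ik := is_vertex_neq vik.
have cj0 := nonpar ij; have ck0 := nonpar ik.
move: vij vik => [cij Ac] [cik Ad].
set c := vertex a b i j in Ac; set d := vertex a b i k in Ad.
have ic : dot (a i) c = b i by exact: dot_line_meetl.
have jc : dot (a j) c = b j by exact: dot_line_meetr.
have id : dot (a i) d = b i by exact: dot_line_meetl.
have kd : dot (a k) d = b k by exact: dot_line_meetr.
have ai0 : a i != 0.
  by apply: contraNneq cj0 => ->; rewrite /cross /= !mul0r subrr.
have aa := dotvv_gt0 ai0.
pose e : R * R := (- (a i).2, (a i).1).
have e0 : e != 0 := perp_neq0 ai0.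
have /(ortho_collinear ai0 e0) : dot (a i) e = 0 by rewrite /dot /=; ring.
move=> /(_ (d - c)); rewrite dotBr ic id subrr => /(_ erefl).
set t := _ / _ => dc.
have je : dot (a j) e = cross (a i) (a j) by rewrite /dot /cross /=; ring.
have ke : dot (a k) e = cross (a i) (a k) by rewrite /dot /cross /=; ring.
have : dot (a j) (d - c) <= 0 by rewrite dotBr jc; have := Ad j; lra.
rewrite dc dotZr je => t0.
have : 0 <= dot (a k) (d - c) by rewrite dotBr kd; have := Ac k; lra.
rewrite dc dotZr ke => t1.
have tE : t = 0 by nra.
have dcE : d = c by apply/eqP; rewrite -subr_eq0 dc tE scale0r.
have := @vertex_tight i k j ik; rewrite -/d dcE => /(_ jc) [ji|//].
by rewrite ji eqxx in ij.
Qed.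

Lemma card_vertex_le :
  (#|[set v : 'I_n * 'I_n | `[< is_vertex a b v.1 v.2 >]]%SET| <=
   #|[set i | `[< has_side a b i >]]%SET|)%N.
Proof.
rewrite -(card_in_imset (f := fst)).
  apply/subset_leq_card/fintype.subsetP => i /imsetP[[i' j]]; rewrite inE => /asboolP /=.
  by move=> h ->; rewrite inE; apply/asboolP/(is_vertex_has_side h).
move=> [i j] [i' k]; rewrite !inE /= => h + ii'.
by rewrite -ii' => /(is_vertex_inj h) ->.
Qed.

Hypothesis bnd : exists r : R, forall q, polygon a b q ->
  `|q.1 - x.1| <= r /\ `|q.2 - x.2| <= r.

(** Follow line [i] counterclockwise from a point of the side. As the polygon is bounded, some
    constraint stops this ray, and the one that stops it first gives the vertex. *)
Lemma has_side_vertex i : has_side a b i -> exists j, is_vertex a b i j.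
Proof.
move=> [p [_ [_ ip _]]]; have ai0 := side_normal_neq0 ip.
move: ip => [Ap /= ip].
pose e : R * R := (- (a i).2, (a i).1).
have e0 : e != 0 := perp_neq0 ai0.
have ie : dot (a i) e = 0 by rewrite /dot /=; ring.
have je j : dot (a j) e = cross (a i) (a j) by rewrite /dot /cross /=; ring.
have [j0 j0P] : exists j, 0 < cross (a i) (a j).
  apply: contrapT => /forallNP nP.
  have Ae t : 0 <= t -> polygon a b (p + t *: e).
    move=> t0 k; rewrite dotDr dotZr je.
    have := nP k; move/negP; rewrite -leNgt => ck.
    by have := Ap k; nra.
  have [r hr] := bnd.
  have e2 := dotvv_gt0 e0.
  (* Long enough to leave the box: two points of the polygon differ by at most [2 * r] in each
     coordinate, which would force [t * dot e e <= 2 * r * (|e.1| + |e.2|)]. *)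
  pose t := (2 * r + 1) * (`|e.1| + `|e.2|) / dot e e.
  have r0 : 0 <= r by have [h _] := hr _ Ap; apply: le_trans h.
  have t0 : 0 <= t by rewrite divr_ge0 ?(ltW e2)// mulr_ge0//; lra.
  have [h1 h2] := hr _ (Ae _ t0); have [h3 h4] := hr _ Ap.
  have k1 : `|t * e.1| <= 2 * r.
    have -> : t * e.1 = ((p + t *: e).1 - x.1) - (p.1 - x.1).
      by rewrite /= /GRing.scale /=; ring.
    by apply: le_trans (ler_normB _ _) _; lra.
  have k2 : `|t * e.2| <= 2 * r.
    have -> : t * e.2 = ((p + t *: e).2 - x.2) - (p.2 - x.2).
      by rewrite /= /GRing.scale /=; ring.
    by apply: le_trans (ler_normB _ _) _; lra.
  have k3 : t * dot e e <= 2 * r * (`|e.1| + `|e.2|).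
    have -> : t * dot e e = (t * e.1) * e.1 + (t * e.2) * e.2 by rewrite /dot; ring.
    rewrite mulrDr lerD//.
      by apply: le_trans (ler_norm _) _; rewrite normrM ler_wpM2r.
    by apply: le_trans (ler_norm _) _; rewrite normrM ler_wpM2r.
  have : 0 < `|e.1| + `|e.2|.
    rewrite lt_neqAle addr_ge0// andbT eq_sym paddr_eq0// !normr_eq0.
    by apply: contra e0; case: (e) => ? ? /= /andP[/eqP -> /eqP ->].
  move: k3; rewrite /t divfK ?gt_eqF//; nra.
(* The time at which the walk from [p] with velocity [e] reaches line [j]. *)
pose f j := (b j - dot (a j) p) / cross (a i) (a j).
have [j cj jmin] := @arg_minP _ _ _ j0 (fun j => 0 < cross (a i) (a j)) f j0P.
have ij : i != j.
  apply: contraTneq cj => <-; rewrite /cross -leNgt.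
  by rewrite (mulrC (a i).1) subrr.
exists j; split=> //.
have <- : p + f j *: e = vertex a b i j.
  apply: line_meet_uniq; first exact: nonpar.
    by rewrite dotDr dotZr ie mulr0 addr0.
  by rewrite dotDr dotZr je /f divfK ?nonpar//; ring.
have fj0 : 0 <= f j by rewrite divr_ge0 ?(ltW cj)// subr_ge0 Ap.
move=> k; rewrite dotDr dotZr je -lerBrDl.
have [ck|ck] := ltP 0 (cross (a i) (a k)).
  by rewrite -ler_pdivlMr//; exact: jmin.
by have := Ap k; nra.
Qed.

Lemma card_vertex :
  #|[set v : 'I_n * 'I_n | `[< is_vertex a b v.1 v.2 >]]%SET| =
  #|[set i | `[< has_side a b i >]]%SET|.
Proof.
apply/eqP; rewrite eqn_leq card_vertex_le/=.
apply: leq_trans (leq_imset_card fst _).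
apply/subset_leq_card/fintype.subsetP => i; rewrite inE => /asboolP/has_side_vertex[j ij].
by apply/imsetP; exists (i, j) => //; rewrite inE; exact/asboolP.
Qed.

End interior_point.
End polygon.

(** * The leftmost and the rightmost vertex *)

Section extreme_vertices.
Context {R : realType} (n : nat).
Implicit Types (a : 'I_n -> R * R) (b : 'I_n -> R) (x p q : R * R) (i j k : 'I_n).

(* The side [i] bounds the polygon from below, the side [j] from above. *)
Definition rightmost a b i j :=
  [/\ (a i).2 < 0, 0 < (a j).2 & is_vertex a b i j].

(** Fourier-Motzkin elimination of the second coordinate: on the vertical line at [s] the
    constraints are lower and upper bounds, and pairwise compatibility is enough. *)
Lemma exists_ordinate a b (s : R) :
  (forall i, (a i).2 != 0) ->
  (forall i j, (a i).2 < 0 -> 0 < (a j).2 ->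
    (b i - (a i).1 * s) / (a i).2 <= (b j - (a j).1 * s) / (a j).2) ->
  exists t, polygon a b (s, t).
Proof.
move=> a0 h; pose f i := (b i - (a i).1 * s) / (a i).2.
have up i t : 0 < (a i).2 -> t <= f i -> dot (a i) (s, t) <= b i.
  by move=> ai; rewrite /f ler_pdivlMr// /dot /=; lra.
have lo i t : (a i).2 < 0 -> f i <= t -> dot (a i) (s, t) <= b i.
  by move=> ai; rewrite /f ler_ndivrMr// /dot /=; lra.
have [j0 j0P|nup] := pickP (fun j => 0 < (a j).2).
  have [j ja jmin] := @arg_minP _ _ _ j0 (fun j => 0 < (a j).2) f j0P.
  exists (f j) => i; have := a0 i; rewrite neq_lt => /orP[ai|ai].
    exact: lo (h i j ai ja).
  exact: up (jmin i ai).
have ai i : (a i).2 < 0.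
  by have := a0 i; rewrite neq_lt => /orP[//|]; have /= -> := nup i.
have [i0 _|n0] := pickP (predT : pred 'I_n).
  have [j _ jmax] := @arg_maxP _ _ _ i0 predT f isT.
  by exists (f j) => i; exact: lo (jmax i isT).
by exists 0 => i; have := n0 i.
Qed.

(** The direction [(1, 0)] is a positive combination of the two normals: constraint [i] times
    [(a j).2] plus constraint [j] times [- (a i).2] bounds [cross (a i) (a j) * q.1]. *)
Lemma rightmost_uniq_point a b i j q :
  rightmost a b i j -> polygon a b q -> q.1 <= (vertex a b i j).1.
Proof.
move=> [ai aj [cij Ac]] Aq; have c0 : cross (a i) (a j) != 0 by rewrite gt_eqF.
have := Aq i; have := Aq j.
rewrite -[X in _ <= X -> _](dot_line_meetr (b i) (b j) c0).
rewrite -[X in _ -> _ <= X -> _](dot_line_meetl (b i) (b j) c0).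
rewrite -/(vertex a b i j); set c := vertex a b i j.
move: cij; rewrite /dot /cross => cij h1 h2.
rewrite -(ler_pM2l cij).
have : (a j).2 * ((a i).1 * q.1 + (a i).2 * q.2) <=
       (a j).2 * ((a i).1 * c.1 + (a i).2 * c.2) by rewrite ler_pM2l.
have : (a i).2 * ((a j).1 * c.1 + (a j).2 * c.2) <=
       (a i).2 * ((a j).1 * q.1 + (a j).2 * q.2) by rewrite ler_nM2l.
lra.
Qed.

Section simple_polygon.
Variables (a : 'I_n -> R * R) (b : 'I_n -> R) (x : R * R).
Hypothesis x_int : forall i, dot (a i) x < b i.
Hypothesis simple : forall i j k,
  i != j -> k != i -> k != j -> dot (a k) (vertex a b i j) != b k.
Hypothesis a2_neq0 : forall i, (a i).2 != 0.

Lemma rightmost_inj i j i' j' :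
  rightmost a b i j -> rightmost a b i' j' -> (i, j) = (i', j').
Proof.
move=> r r'; have [ai aj v] := r; have [ai' aj' v'] := r'.
have c0 : cross (a i) (a j) != 0 by case: v => h _; rewrite gt_eqF.
have c0' : cross (a i') (a j') != 0 by case: v' => h _; rewrite gt_eqF.
have e1 : (vertex a b i j).1 = (vertex a b i' j').1.
  apply/eqP; rewrite eq_le; apply/andP; split.
    by apply: rightmost_uniq_point r' _; case: v.
  by apply: rightmost_uniq_point r _; case: v'.
have e2 : (vertex a b i j).2 = (vertex a b i' j').2.
  have [_ Ac] := v; have [_ Ad] := v'.
  have := Ad i; rewrite -[X in _ <= X](dot_line_meetl (b i) (b j) c0).
  have := Ad j; rewrite -[X in _ <= X](dot_line_meetr (b i) (b j) c0).
  rewrite -/(vertex a b i j) /dot e1 !lerD2l.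
  rewrite ler_pM2l// ler_nM2l// => h1 h2.
  by apply/eqP; rewrite eq_le h1 h2.
have e : vertex a b i j = vertex a b i' j'.
  by case: (vertex a b i j) (vertex a b i' j') e1 e2 => ? ? [? ?] /= -> ->.
have ij := is_vertex_neq v.
have [i'E|i'E] : i' = i \/ i' = j.
- by apply: (vertex_tight simple ij); rewrite e; exact: dot_line_meetl.
- have [j'E|j'E] : j' = i \/ j' = j.
  + by apply: (vertex_tight simple ij); rewrite e; exact: dot_line_meetr.
  + by exfalso; move: aj'; rewrite j'E; lra.
  + by rewrite i'E j'E.
- by exfalso; move: ai'; rewrite i'E; lra.
Qed.

(** Among the meeting points of a lower and an upper line that converge to the right, the one of
    least abscissa is in the polygon, since at this abscissa all lower and upper bounds are still
    compatible. If no two lines converged, the polygon would extend to the right without bound. *)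
Lemma rightmost_exists : (exists r : R, forall q, polygon a b q -> `|q.1 - x.1| <= r) ->
  exists i j, rightmost a b i j.
Proof.
move=> [r hr].
pose Q (v : 'I_n * 'I_n) := [&& (a v.1).2 < 0, 0 < (a v.2).2 & 0 < cross (a v.1) (a v.2)].
pose f (v : 'I_n * 'I_n) := (vertex a b v.1 v.2).1.
have hx i j : (a i).2 < 0 -> 0 < (a j).2 ->
    x.1 * cross (a i) (a j) <= b i * (a j).2 - b j * (a i).2.
  move=> ai aj.
  have : dot (a i) x * (a j).2 <= b i * (a j).2 by rewrite ler_pM2r// ltW.
  have : b j * (a i).2 <= dot (a j) x * (a i).2 by rewrite ler_nM2r// ltW.
  by rewrite /dot /cross; lra.
(* The gap between upper bound [j] and lower bound [i] is affine in the abscissa, nonnegative at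
   [x.1], and its slope has the sign of [- cross (a i) (a j)]. *)
have x_le i j s : (a i).2 < 0 -> 0 < (a j).2 -> x.1 <= s ->
    (0 < cross (a i) (a j) -> s <= f (i, j)) ->
    (b i - (a i).1 * s) / (a i).2 <= (b j - (a j).1 * s) / (a j).2.
  move=> ai aj xs h.
  rewrite ler_pdivlMr// mulrAC ler_ndivrMr// -subr_ge0.
  have -> : (b i - (a i).1 * s) * (a j).2 - (b j - (a j).1 * s) * (a i).2 =
    (b i * (a j).2 - b j * (a i).2) - s * cross (a i) (a j) by rewrite /cross; ring.
  have [c0|c0] := ltP 0 (cross (a i) (a j)).
    by have := h c0; rewrite /f /vertex /line_meet /= ler_pdivlMr// subr_ge0.
  by rewrite subr_ge0; apply: le_trans (hx _ _ ai aj); rewrite ler_wnM2r.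
have [[i0 j0] Q0|nQ] := pickP Q; last first.
  have [t ht] : exists t, polygon a b (x.1 + (`|r| + 1), t).
    apply: exists_ordinate => // i j ai aj; apply: x_le => //.
      by rewrite lerDl addr_ge0.
    by move=> c; have := nQ (i, j); rewrite /Q ai aj c.
  have := hr _ ht; rewrite /= addrC addKr.
  rewrite ger0_norm ?addr_ge0// => h; have := ler_norm r; lra.
have [[i j] /and3P[/= ai aj cij] vmin] := @arg_minP _ _ _ _ Q f Q0.
have c0 : cross (a i) (a j) != 0 by rewrite gt_eqF.
have xf : x.1 <= f (i, j).
  by rewrite /f /= ler_pdivlMr// hx.
have [t ht] : exists t, polygon a b (f (i, j), t).
  apply: exists_ordinate => // i' j' ai' aj'; apply: x_le => // c.
  by apply: vmin; apply/and3P.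
exists i, j; split=> //; split=> //.
suff <- : (f (i, j), t) = vertex a b i j by [].
have e : f (i, j) = (vertex a b i j).1 by [].
have := ht i; rewrite -[X in _ <= X](dot_line_meetl (b i) (b j) c0).
have := ht j; rewrite -[X in _ <= X](dot_line_meetr (b i) (b j) c0).
rewrite -/(vertex a b i j); move: (vertex a b i j) e => c e.
rewrite /dot /= -e !lerD2l ler_pM2l// ler_nM2l// => h1 h2.
by apply: injective_projections => //=; apply/eqP; rewrite eq_le h1 h2.
Qed.

End simple_polygon.
End extreme_vertices.

Section mixed_vertices.
Context {R : realType} (n : nat).
Variables (a : 'I_n -> R * R) (b : 'I_n -> R) (x : R * R).
Hypothesis x_int : forall i, dot (a i) x < b i.
Hypothesis simple : forall i j k,
  i != j -> k != i -> k != j -> dot (a k) (vertex a b i j) != b k.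
Hypothesis a2_neq0 : forall i, (a i).2 != 0.

(** Half-turn of the polygon: it keeps the orientation, hence the pairs that are vertices, and turns
    the leftmost vertex into the rightmost one. *)
Let a' i := - a i.

Let crossNN u v : cross (- u) (- v) = cross u v :> R.
Proof. by rewrite /cross /=; ring. Qed.

Let vertexN i j : vertex a' b i j = - vertex a b i j.
Proof.
rewrite /vertex /line_meet crossNN; congr pair; rewrite /= -[RHS]mulNr; congr (_ * _); ring.
Qed.

Let is_vertexN i j : is_vertex a' b i j <-> is_vertex a b i j.
Proof.
rewrite /is_vertex crossNN vertexN; split=> -[? h]; split=> // k.
  by have := h k; rewrite dotNl dotNr opprK.
by rewrite dotNl dotNr opprK.
Qed.

Let simple' i j k :
  i != j -> k != i -> k != j -> dot (a' k) (vertex a' b i j) != b k.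
Proof. by move=> *; rewrite vertexN dotNl dotNr opprK simple. Qed.

Definition mixed_vertices := [set v : 'I_n * 'I_n |
  `[< is_vertex a b v.1 v.2 >] && ((a v.1).2 * (a v.2).2 < 0)]%SET.

Lemma mixedE v : v \in mixed_vertices <->
  rightmost a b v.1 v.2 \/ rightmost a' b v.1 v.2.
Proof.
rewrite inE; split=> [/andP[/asboolP h]|[[h1 h2 h3]|[/=]]].
- have := a2_neq0 v.1; rewrite neq_lt => /orP[v1|v1].
    by rewrite nmulr_rlt0// => v2; left; split.
  by rewrite pmulr_rlt0// => v2; right; split=> /=; rewrite ?oppr_lt0 ?oppr_gt0 ?is_vertexN.
- by apply/andP; split; [exact/asboolP|rewrite nmulr_rlt0].
- rewrite oppr_lt0 oppr_gt0 is_vertexN => h1 h2 h3.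
  by apply/andP; split; [exact/asboolP|rewrite pmulr_rlt0].
Qed.

Lemma card_mixed_le2 : (#|mixed_vertices| <= 2)%N.
Proof.
pose A := [set v : 'I_n * 'I_n | `[< rightmost a b v.1 v.2 >]]%SET.
pose B := [set v : 'I_n * 'I_n | `[< rightmost a' b v.1 v.2 >]]%SET.
have le1 a0 : (forall i j k, i != j -> k != i -> k != j ->
      dot (a0 k) (vertex a0 b i j) != b k) ->
    (#|[set v : 'I_n * 'I_n | `[< rightmost a0 b v.1 v.2 >]]%SET| <= 1)%N.
  move=> s; apply/card_le1_eqP => -[i j] [i' j'].
  by rewrite !inE /= => h h'; exact: (rightmost_inj s).
apply: (@leq_trans #|A :|: B|).
  apply/subset_leq_card/fintype.subsetP => v /mixedE h; rewrite !inE.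
  by case: h => /asboolP ->; rewrite ?orbT.
by rewrite (leq_trans (leq_card_setU _ _))// (@leq_add _ _ 1 1)// le1.
Qed.

Lemma card_mixed_eq2 : (exists r : R, forall q, polygon a b q -> `|q.1 - x.1| <= r) ->
  #|mixed_vertices| = 2%N.
Proof.
move=> bd; apply/eqP; rewrite eqn_leq card_mixed_le2/=.
have [i [j rij]] := rightmost_exists x_int a2_neq0 bd.
have [i' [j' rij']] : exists i j, rightmost a' b i j.
  apply: (@rightmost_exists _ _ _ _ (- x)).
  - by move=> k; rewrite dotNl dotNr opprK.
  - by move=> k /=; rewrite oppr_eq0.
  move: bd => [r hr]; exists r => q Aq.
  have := hr (- q); rewrite /= opprK -opprD normrN; apply.
  by move=> k; have := Aq k; rewrite dotNl dotNr.
have ne : (i, j) != (i', j').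
  apply/eqP => -[ii' jj'].
  by move: rij rij' => [h _ _] [/=]; rewrite -ii'; lra.
apply: leq_trans (_ : #|[set (i, j); (i', j')]%SET| <= _)%N.
  by rewrite cards2 ne.
apply/subset_leq_card/fintype.subsetP => v; rewrite in_set2 => /orP[]/eqP ->.
  by apply/mixedE; left.
by apply/mixedE; right.
Qed.

End mixed_vertices.

(** * Edges and vertices of Voronoi cells *)

Section euclidean_norm.
Context {R : realType}.
Implicit Types p q x c : R * R.

Lemma enormE p : enorm p = Num.sqrt (dot p p).
Proof. by rewrite /enorm /dot !expr2. Qed.

Lemma dotvv_ge0 p : 0 <= dot p p.
Proof. by rewrite /dot -!expr2 addr_ge0// sqr_ge0. Qed.

Lemma enorm_ge0 p : 0 <= enorm p.
Proof. by rewrite enormE sqrtr_ge0. Qed.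

Lemma sqr_enorm p : enorm p ^+ 2 = dot p p.
Proof. by rewrite enormE sqr_sqrtr// dotvv_ge0. Qed.

Lemma le_enorm p q : (enorm p <= enorm q) = (dot p p <= dot q q).
Proof. by rewrite !enormE ler_sqrt// dotvv_ge0. Qed.

Lemma lt_enorm p q : (enorm p < enorm q) = (dot p p < dot q q).
Proof. by rewrite !ltNge le_enorm. Qed.

Lemma eq_enorm p q : (enorm p == enorm q) = (dot p p == dot q q).
Proof. by rewrite !eq_le !le_enorm. Qed.

Lemma enorm_lt p (r : R) : 0 <= r -> (enorm p < r) = (dot p p < r ^+ 2).
Proof. by move=> r0; rewrite -sqr_enorm ltr_pXn2r// nnegrE// enorm_ge0. Qed.

Lemma enorm_le p (r : R) : 0 <= r -> (enorm p <= r) = (dot p p <= r ^+ 2).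
Proof. by move=> r0; rewrite -sqr_enorm ler_pXn2r// nnegrE// enorm_ge0. Qed.

Lemma enormN p : enorm (- p) = enorm p.
Proof. by rewrite /enorm /= !sqrrN. Qed.

Lemma enormB p q : enorm (p - q) = enorm (q - p).
Proof. by rewrite -enormN opprB. Qed.

Lemma norm_le_enorm p : `|p.1| <= enorm p /\ `|p.2| <= enorm p.
Proof.
rewrite enormE -!sqrtr_sqr !ler_sqrt ?dotvv_ge0// /dot -!expr2.
by rewrite lerDl lerDr !sqr_ge0.
Qed.

Lemma dot_gt0_neq0 p : p.2 != 0 -> 0 < dot p p.
Proof. by move=> p2; apply: dotvv_gt0; apply: contra_neq p2 => ->. Qed.

(** Triangle inequality, read off the parallelogram law. It confines a circumdisc of radius less
    than [r] to the ball of radius [2 * r] around [x]. *)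
Lemma eball_double x c q (r : R) :
  enorm (c - x) < r -> enorm (q - c) <= enorm (c - x) -> enorm (q - x) < 2 * r.
Proof.
move=> cr; rewrite le_enorm => qc.
have r0 : 0 < r by apply: le_lt_trans cr; exact: enorm_ge0.
move: cr; rewrite !enorm_lt ?mulr_ge0 ?(ltW r0)// => cr.
have -> : dot (q - x) (q - x) = 2 * dot (q - c) (q - c) + 2 * dot (c - x) (c - x)
    - dot (q - c - (c - x)) (q - c - (c - x)) by rewrite /dot /=; ring.
have := dotvv_ge0 (q - c - (c - x)); rewrite exprMn; lra.
Qed.

End euclidean_norm.

Section voronoi.
Context {R : realType}.
Implicit Types (x p q c : R * R) (y : nat -> R * R).

Definition bisector_level x p : R := (dot p p - dot x x) / 2.

Definition circumcenter x p q : R * R :=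
  line_meet (p - x) (bisector_level x p) (q - x) (bisector_level x q).

Definition circumradius x p q : R := enorm (circumcenter x p q - x).

Definition circumdisc x (v : (R * R) * (R * R)) : set (R * R) :=
  eball (circumcenter x v.1 v.2) (circumradius x v.1 v.2).

Lemma le_bisector x p c :
  (enorm (c - x) <= enorm (c - p)) = (dot (p - x) c <= bisector_level x p).
Proof.
rewrite le_enorm /bisector_level ler_pdivlMr// -subr_ge0 -[RHS]subr_ge0.
by congr (0 <= _); rewrite /dot /=; ring.
Qed.

Lemma eq_bisector x p c :
  (enorm (c - x) == enorm (c - p)) = (dot (p - x) c == bisector_level x p).
Proof.
by rewrite eq_enorm /bisector_level /dot /=; apply/eqP/eqP => h; lra.
Qed.

Lemma voronoi_cell_polygon n y x : voronoi_cell n y x =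
  polygon (fun i : 'I_n => y i - x) (fun i => bisector_level x (y i)).
Proof.
apply/seteqP; split=> q /= h.
  by move=> i; rewrite -le_bisector h.
by move=> i ni; rewrite le_bisector (h (Ordinal ni)).
Qed.

Definition quarter (e : bool * bool) x (s : R) : set (R * R) :=
  [set p | s / 4 <= (-1) ^+ e.1 * (p.1 - x.1) < s / 2 /\
           s / 4 <= (-1) ^+ e.2 * (p.2 - x.2) < s / 2].

(** Take for [e] the quadrant of [c - x]. Up to signs, the coordinates [u1, u2] of [c - x] are
    nonnegative with [u1 + u2 >= s], and those of [p - x] are in [[s / 4, s / 2)], so [2 * (t1 * u1
    + t2 * u2) >= s ^ 2 / 2 > t1 ^ 2 + t2 ^ 2]. This is where both bounds of the square come from.
    The choice of [e] depends on [c] only, not on the size [s]. *)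
Lemma quarter_eball x c : exists e, forall s p,
  s <= enorm (c - x) -> quarter e x s p -> enorm (p - c) < enorm (c - x).
Proof.
have sg (t : R) : exists e : bool, 0 <= (-1) ^+ e * t.
  have [t0|t0] := leP 0 t; first by exists false; rewrite expr0 mul1r.
  by exists true; rewrite expr1; nra.
have [e1 h1] := sg (c - x).1; have [e2 h2] := sg (c - x).2.
exists (e1, e2) => s p sc [/= /andP[p1 p1'] /andP[p2 p2']].
have s0 : 0 <= s by lra.
have sc2 : s ^+ 2 <= dot (c - x) (c - x).
  by rewrite -sqr_enorm ler_pXn2r// nnegrE// enorm_ge0.
have sq (e : bool) (t : R) : t ^+ 2 = ((-1) ^+ e * t) ^+ 2.
  by rewrite exprMn sqrr_sign mul1r.
have mu (e : bool) (t u : R) : t * u = ((-1) ^+ e * t) * ((-1) ^+ e * u).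
  by rewrite mulrACA -expr2 sqrr_sign mul1r.
rewrite lt_enorm -subr_gt0.
have -> : dot (c - x) (c - x) - dot (p - c) (p - c) =
   2 * ((p.1 - x.1) * (c - x).1) + 2 * ((p.2 - x.2) * (c - x).2)
   - (p.1 - x.1) ^+ 2 - (p.2 - x.2) ^+ 2.
  by rewrite /dot /=; ring.
move: sc2; rewrite /dot -!expr2 (sq e1 (p.1 - x.1)) (sq e2 (p.2 - x.2)).
rewrite (sq e1 (c - x).1) (sq e2 (c - x).2).
rewrite (mu e1 (p.1 - x.1)) (mu e2 (p.2 - x.2)).
move: h1 h2 p1 p1' p2 p2'.
move: (_ * (c - x).1) (_ * (c - x).2) (_ * (p.1 - x.1)) (_ * (p.2 - x.2)).
move=> u1 u2 t1 t2 u10 u20 l1 r1 l2 r2 su.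
have u12 : s <= u1 + u2.
  rewrite -(ler_pXn2r (n := 2))// ?nnegrE ?addr_ge0//.
  by apply: (le_trans su); rewrite sqrrD; nra.
have a1 : s / 4 * u1 <= t1 * u1 by rewrite ler_wpM2r.
have a2 : s / 4 * u2 <= t2 * u2 by rewrite ler_wpM2r.
have a3 : s * s <= s * (u1 + u2) by rewrite ler_wpM2l.
have a4 : t1 ^+ 2 < s * s / 4 by nra.
have a5 : t2 ^+ 2 < s * s / 4 by nra.
nra.
Qed.

End voronoi.

(** * Pairs of nuclei with a void region *)

Section void_pairs_def.
Context {E : Type}.
Implicit Types (S : set (E * E)) (D : E * E -> set E) (y : nat -> E).

(** Generic because it serves twice: with circumdiscs for [D], void pairs are vertices of the cell;
    with the squares [quarter], they dominate the pairs of distinct edges. *)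
Definition void_pair n S D y (v : 'I_n * 'I_n) := [/\ v.1 != v.2,
  S (y v.1, y v.2) & forall k : 'I_n, k != v.1 -> k != v.2 ->
    ~ D (y v.1, y v.2) (y k)].

Definition nb_void_pairs n S D y : nat :=
  #|[set v : 'I_n * 'I_n | `[< void_pair S D y v >]]%SET|.

End void_pairs_def.

Section void_pairs.
Context {R : realType}.
Implicit Types (x : R * R) (y : nat -> R * R).

Definition ccw_pairs x (r : R) : set ((R * R) * (R * R)) :=
  [set v | 0 < cross (v.1 - x) (v.2 - x) /\ circumradius x v.1 v.2 < r].

(* The nuclei are on both sides of the horizontal line through [x]: their vertex
   is the leftmost or the rightmost one of the cell. *)
Definition split_pairs x : set ((R * R) * (R * R)) :=
  [set v | (v.1 - x).2 * (v.2 - x).2 < 0].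

(** Half the distance, since a point equidistant from [x] and [p] is at least [enorm (p - x) / 2]
    away from [x]. Capped at [s], since the mass of [quarter] is bounded below at small sizes
    only. *)
Definition farther x (s : R) (v : (R * R) * (R * R)) : R :=
  Num.min (Num.max (enorm (v.1 - x)) (enorm (v.2 - x)) / 2) s.

Definition void_quarter n x (r : R) y :=
  exists e, forall k : 'I_n, ~ quarter e x r (y k).

Definition general_position n x y :=
  [/\ forall i : 'I_n, (y i - x).2 != 0,
      forall i j : 'I_n, i != j -> cross (y i - x) (y j - x) != 0 &
      forall i j k : 'I_n, i != j -> k != i -> k != j ->
        enorm (y k - circumcenter x (y i) (y j)) !=
        circumradius x (y i) (y j)].

Definition nb_sides n x y : nat := #|[set i : 'I_n |
  `[< has_side (fun i => y i - x) (fun i => bisector_level x (y i)) i >]]%SET|.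

Section general_position.
Variables (n : nat) (x : R * R) (y : nat -> R * R).
Hypothesis gp : general_position n x y.

Let a (i : 'I_n) := y i - x.
Let b (i : 'I_n) := bisector_level x (y i).

Let x_int i : dot (a i) x < b i.
Proof.
have [h _ _] := gp; have := dot_gt0_neq0 (h i).
by rewrite /a /b /bisector_level /dot /=; lra.
Qed.

Let nonpar i j : i != j -> cross (a i) (a j) != 0.
Proof. by have [_ h _] := gp; exact: h. Qed.

Let simple i j k : i != j -> k != i -> k != j -> dot (a k) (vertex a b i j) != b k.
Proof.
have [_ _ h] := gp => ij ki kj; have := h i j k ij ki kj.
by rewrite -eq_bisector eq_sym enormB.
Qed.

Let a2_neq0 i : (a i).2 != 0.
Proof. by have [h _ _] := gp; exact: h. Qed.

Lemma number_of_edges_voronoi :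
  number_of_edges (voronoi_cell n y x) = (nb_sides n x y)%:R%:E.
Proof. by rewrite voronoi_cell_polygon (number_of_edges_polygon x_int nonpar). Qed.

Let circumdisc_polygon (i j k : 'I_n) : circumdisc x (y i, y j) (y k) <->
  ~ dot (a k) (vertex a b i j) <= b k.
Proof.
rewrite /circumdisc /eball /= -le_bisector (enormB (y k)) ltNge.
by split=> /negP.
Qed.

(** The meeting point of two bisectors is the circumcenter, and it violates the constraint [k]
    exactly when [y k] is in the open circumdisc. *)
Let is_vertex_void i j : is_vertex a b i j <->
  void_pair [set v | 0 < cross (v.1 - x) (v.2 - x)] (circumdisc x) y (i, j).
Proof.
split=> [v|[/= ij c h]].
  split; [exact: is_vertex_neq v|by case: v|move=> k _ _ /=].
  by rewrite circumdisc_polygon; apply; case: v => _; apply.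
have c0 : cross (a i) (a j) != 0 by rewrite gt_eqF.
split=> // k; have [->|ki] := eqVneq k i; first by rewrite dot_line_meetl.
have [->|kj] := eqVneq k j; first by rewrite dot_line_meetr.
by have := h _ ki kj; rewrite circumdisc_polygon => /contrapT.
Qed.

(** The disc around a point [q] of the cell through [x] contains no nucleus; if [q] is at distance
    at least [r], it covers one of the four squares of size [r]. *)
Let eq_vertices r : ~ void_quarter n x r y ->
  forall q, polygon a b q -> enorm (q - x) < r.
Proof.
move=> nq q Aq; rewrite ltNge; apply/negP => rq; apply: nq.
have [e he] := quarter_eball x q; exists e => k /(he _ _ rq).
by rewrite ltNge (enormB (y k)) le_bisector => /negP; apply; exact: Aq.
Qed.

Let sub_vertices r (v : 'I_n * 'I_n) :
  void_pair (ccw_pairs x r) (circumdisc x) y v -> is_vertex a b v.1 v.2.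
Proof.
by case: v => i j [ij [/= c _] h]; apply/is_vertex_void; split.
Qed.

Let vertices_sub r (v : 'I_n * 'I_n) : ~ void_quarter n x r y ->
  is_vertex a b v.1 v.2 -> void_pair (ccw_pairs x r) (circumdisc x) y v.
Proof.
case: v => i j nq /= v; have [ij /= c h] := (is_vertex_void i j).1 v.
split=> //; split=> //=.
by apply: (eq_vertices nq); case: v.
Qed.

Lemma void_pairs_le_sides r :
  (nb_void_pairs n (ccw_pairs x r) (circumdisc x) y <= nb_sides n x y)%N.
Proof.
apply: leq_trans (card_vertex_le nonpar simple).
apply/subset_leq_card/fintype.subsetP => v; rewrite !inE.
exact: sub_vertices.
Qed.

Lemma sides_le_void_pairs r : ~ void_quarter n x r y ->
  (nb_sides n x y <= nb_void_pairs n (ccw_pairs x r) (circumdisc x) y)%N.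
Proof.
move=> nq; rewrite /nb_sides -(card_vertex x_int nonpar simple).
  apply/subset_leq_card/fintype.subsetP => v; rewrite !inE.
  exact: vertices_sub.
exists r => q /(eq_vertices nq) qr; have [h1 h2] := norm_le_enorm (q - x).
by split; apply: le_trans (ltW qr).
Qed.

Let split_vertices (v : 'I_n * 'I_n) : v \in mixed_vertices a b <->
  is_vertex a b v.1 v.2 /\ (a v.1).2 * (a v.2).2 < 0.
Proof. by rewrite inE; split=> [/andP[/asboolP]//|[h1 h2]]; apply/andP; split=> //; apply/asboolP. Qed.

Lemma split_void_pairs_le2 r :
  (nb_void_pairs n (ccw_pairs x r `&` split_pairs x) (circumdisc x) y <= 2)%N.
Proof.
apply: leq_trans (card_mixed_le2 simple a2_neq0).
apply/subset_leq_card/fintype.subsetP => v; rewrite inE => /asboolP[ij [c s] h].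
by apply/split_vertices; split=> //; apply: (@sub_vertices r); split.
Qed.

Lemma split_void_pairs_eq2 r : ~ void_quarter n x r y ->
  nb_void_pairs n (ccw_pairs x r `&` split_pairs x) (circumdisc x) y = 2%N.
Proof.
move=> nq; apply/eqP; rewrite eqn_leq split_void_pairs_le2/=.
rewrite -(card_mixed_eq2 x_int simple a2_neq0); last first.
  exists r => q /(eq_vertices nq) qr; have [h1 h2] := norm_le_enorm (q - x).
  by apply: le_trans (ltW qr).
apply/subset_leq_card/fintype.subsetP => v /split_vertices[h s]; rewrite inE.
by have [ij c k] := vertices_sub nq h; apply/asboolP; split.
Qed.

(** A point [q] of the side is equidistant from [x] and [y i], hence at least [enorm (y i - x) / 2]
    away from [x], and the disc around [q] through [x] contains no nucleus. *)
Let side_quarter i : has_side a b i -> exists e, forall s,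
  s <= enorm (y i - x) / 2 -> forall k : 'I_n, ~ quarter e x s (y k).
Proof.
move=> [q [_ [_ [Aq /= /eqP qi] _]]].
have [e he] := quarter_eball x q; exists e => s hs k /he.
rewrite ltNge (enormB (y k)) le_bisector => h; have : s <= enorm (q - x).
  apply: (le_trans hs); rewrite ler_pdivrMr// mulrC.
  rewrite enorm_le ?mulr_ge0 ?enorm_ge0// exprMn sqr_enorm.
  move: qi; rewrite -eq_bisector eq_enorm => /eqP qi.
  have -> : dot (y i - x) (y i - x) = 2 * dot (q - x) (q - x) + 2 * dot (q - y i) (q - y i)
    - dot (q - x + (q - y i)) (q - x + (q - y i)) by rewrite /dot /=; ring.
  have := dotvv_ge0 (q - x + (q - y i)); lra.
by move=> /h /negP; apply; exact: Aq.
Qed.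

(** The first term is the diagonal; a pair of distinct sides is charged to the farther of its two
    nuclei. *)
Lemma sqr_sides_le s : (nb_sides n x y * nb_sides n x y <= nb_sides n x y +
  \sum_(e : bool * bool)
    nb_void_pairs n setT (fun v => quarter e x (farther x s v)) y)%N.
Proof.
pose E := [set i | `[< has_side a b i >]]%SET.
pose Q e := [set v : 'I_n * 'I_n |
  `[< void_pair setT (fun v => quarter e x (farther x s v)) y v >]]%SET.
have -> : (nb_sides n x y * nb_sides n x y = #|finset.setX E E|)%N by rewrite cardsX.
have sub : (finset.setX E E \subset (fun i => (i, i)) @: E :|: \bigcup_e Q e)%SET.
  apply/fintype.subsetP => -[i j]; rewrite finset.in_setX => /andP[].
  rewrite !inE => hi hj; apply/orP.
  have [<-|ij] := eqVneq i j.
    by left; apply/imsetP; exists i => //; rewrite !inE.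
  right; apply/finset.bigcupP.
  have [ei hei] := side_quarter hi; have [ej hej] := side_quarter hj.
  have [ji|ji] := leP (enorm (y j - x)) (enorm (y i - x)).
    exists ei => //; rewrite inE; apply/asboolP; split=> //= k _ _; apply: hei.
    by rewrite /farther /= max_l// ge_min lexx.
  exists ej => //; rewrite inE; apply/asboolP; split=> //= k _ _; apply: hej.
  by rewrite /farther /= max_r ?(ltW ji)// ge_min lexx.
apply: leq_trans (subset_leq_card sub) _.
apply: leq_trans (leq_card_setU _ _) _; rewrite leq_add ?leq_imset_card//.
elim/big_ind2: _ => //; first by rewrite cards0.
move=> A a1 B b1 h1 h2; apply: leq_trans (leq_card_setU _ _) _.
exact: leq_add.
Qed.

End general_position.
End void_pairs.

(** * Counting pairs of sample points *)

Section density.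
Local Open Scope ereal_scope.
Context d (T : measurableType d) (R : realType).
Variables (m nu : {measure set T -> \bar R}) (g : T -> R).
Hypothesis mg : measurable_fun setT g.
Hypothesis g0 : forall x, (0 <= g x)%R.
Hypothesis nuE : forall A, measurable A -> nu A = \int[m]_(x in A) (g x)%:E.

Import HBNNSimple.

(** Used for the density [f] of the sample, and also for laws restricted to an event, whose
    densities are constants or powers of a miss probability. *)
Lemma ge0_integral_density (h : T -> \bar R) :
  measurable_fun setT h -> (forall x, 0 <= h x) ->
  \int[nu]_x h x = \int[m]_x (h x * (g x)%:E).
Proof.
move=> mh h0; pose h_ := nnsfun_approx measurableT mh.
have mgE : measurable_fun setT (EFin \o g) by exact/measurable_EFinP.
have cvgh x : (h_ n x)%:E @[n --> \oo] --> h x.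
  by apply: cvg_nnsfun_approx.
transitivity (limn (fun n => \int[nu]_x (h_ n x)%:E)).
  rewrite -monotone_convergence//.
  - by apply: eq_integral => y _; apply/esym/cvg_lim.
  - by move=> n; exact/measurable_EFinP/measurable_funP.
  - by move=> n y _; rewrite lee_fin.
  - by move=> y _ a b ab; rewrite lee_fin; exact/lefP/nd_nnsfun_approx.
have -> : (fun n => \int[nu]_x (h_ n x)%:E) =
    (fun n => \int[m]_x ((h_ n x)%:E * (g x)%:E)).
  apply/funext => n.
  have mr r : measurable_fun setT (fun x => (r * \1_(h_ n @^-1` [set r]) x)%:E).
    by apply/measurable_EFinP; exact: measurable_funM.
  transitivity (\int[nu]_x
     (\sum_(y \in range (h_ n)) (y * \1_(h_ n @^-1` [set y]) x)%:E)).
    by apply: eq_integral => t _; rewrite fimfunE -fsumEFin.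
  rewrite ge0_integral_fsum//; last by move=> k y _; exact: nnfun_muleindic_ge0.
  transitivity (\int[m]_x (\sum_(y \in range (h_ n))
      (y * \1_(h_ n @^-1` [set y]) x)%:E * (g x)%:E)); last first.
    apply: eq_integral => x _; rewrite -ge0_mule_fsuml => [|y].
      by rewrite fsumEFin// -(fimfunE _ x).
    exact: nnfun_muleindic_ge0.
  rewrite ge0_integral_fsum//; last 2 first.
  - by move=> y; exact: emeasurable_funM.
  - move=> k y _; apply: mule_ge0; last by rewrite lee_fin.
    exact: nnfun_muleindic_ge0.
  apply: eq_fsbigr => r; rewrite inE => -[t _ rE].
  have r0 : (0 <= r)%R by rewrite -rE.
  rewrite integralZl_indic_nnsfun// integral_indic// setIT nuE//.
  under [RHS]eq_integral do rewrite EFinM -muleA.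
  rewrite ge0_integralZl//.
  - congr (_ * _); rewrite integral_mkcond; apply: eq_integral => x _.
    by rewrite /patch /indic; case: ifPn => _; rewrite ?mul1e ?mul0e.
  - by apply: emeasurable_funM => //; exact/measurable_EFinP.
  - by move=> x _; rewrite mule_ge0// lee_fin.
rewrite -monotone_convergence//.
- apply: eq_integral => x _; apply/cvg_lim => //.
  exact: cvgeZr (cvgh x).
- move=> n; apply: emeasurable_funM => //.
  exact/measurable_EFinP/measurable_funP.
- by move=> n x _; rewrite mule_ge0// lee_fin.
- move=> x _ a b ab; rewrite lee_pmul ?lee_fin//.
  by exact/lefP/nd_nnsfun_approx.
Qed.

End density.

(** * Laws restricted to an event, and independence *)

Section restricted_law.
Local Open Scope ereal_scope.
Context d d1 (T : measurableType d) (T1 : measurableType d1) (R : realType).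
Variables (P : probability T R) (F : set T) (mF : measurable F) (U : {mfun T >-> T1}).

(** Not normalized: a finite measure of mass [P F]. This replaces conditioning and needs no case
    distinction for [P F = 0]. *)
Definition restricted_law : set T1 -> \bar R := pushforward (mrestr P mF) U.

Let law0 : restricted_law set0 = 0.
Proof. by rewrite /restricted_law /pushforward /mrestr preimage_set0 set0I measure0. Qed.

Let law_ge0 A : 0 <= restricted_law A.
Proof. exact: measure_ge0. Qed.

Let law_sigma_additive : semi_sigma_additive restricted_law.
Proof.
move=> G mG tG mUG; rewrite /restricted_law /pushforward preimage_bigcup.
apply: measure_semi_sigma_additive.
- by move=> n; exact: measurable_funPTI.
- apply/trivIsetP => /= i j _ _ ij; rewrite -preimage_setI.
  by move/trivIsetP : tG => /(_ _ _ _ _ ij) ->//; rewrite preimage_set0.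
- by rewrite -preimage_bigcup; exact: measurable_funPTI.
Qed.

HB.instance Definition _ := isMeasure.Build _ _ _ restricted_law
  law0 law_ge0 law_sigma_additive.

Let law_fin : fin_num_fun restricted_law.
Proof.
move=> A mA; apply: fin_num_measure; exact: measurable_funPTI.
Qed.

HB.instance Definition _ := @Measure_isFinite.Build _ _ _ restricted_law law_fin.

End restricted_law.

Section joint_law.
Local Open Scope ereal_scope.
Context d d1 d2 (T : measurableType d) (T1 : measurableType d1)
  (T2 : measurableType d2) (R : realType).
Variables (P : probability T R) (F : set T) (mF : measurable F).
Variables (U : {mfun T >-> T1}) (V : {mfun T >-> T2}) (mu : probability T2 R).
Hypothesis VI : forall A B, measurable A -> measurable B ->
  P (U @^-1` A `&` V @^-1` B `&` F) = P (U @^-1` A `&` F) * mu B.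

(** By [VI] both sides agree on rectangles, and a product measure is determined by its values
    there. *)
Lemma joint_law C : measurable C ->
  P ((fun w => (U w, V w)) @^-1` C `&` F) =
  \int[restricted_law P mF U]_u mu (xsection C u).
Proof.
move=> mC.
have mUV : measurable_fun setT (fun w => (U w, V w)) by exact: measurable_fun_pair.
pose W : {mfun T >-> (T1 * T2)%type} := HB.pack (fun w => (U w, V w))
  (isMeasurableFun.Build _ _ _ _ _ mUV).
rewrite -[LHS]/(restricted_law P mF W C).
rewrite -(@product_measure_unique _ _ _ _ _ (restricted_law P mF U) mu)//.
Qed.

End joint_law.

Section iid_void.
Local Open Scope ereal_scope.
Context d d' (T : measurableType d) (T' : measurableType d') (R : realType).
Variables (P : probability T R) (X : nat -> {mfun T >-> T'}) (mu : probability T' R).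
Hypothesis X_indep : mutually_independent (X : nat -> {RV P >-> T'}).
Hypothesis X_law : forall i B, measurable B -> P (X i @^-1` B) = mu B.

Local Notation cyl J B := (\bigcap_(i in [set` (J : {fset nat})]) (X i @^-1` B i)).

Let mcyl J B : (forall i, measurable (B i)) -> measurable (cyl J B).
Proof.
move=> mB; apply: fin_bigcap_measurable => // i _; exact: measurable_funPTI.
Qed.

Let cylU1 (J : {fset nat}) B k A : k \notin J ->
  cyl (k |` J)%fset (fun i => if i == k then A else B i) = X k @^-1` A `&` cyl J B.
Proof.
move=> kJ; apply/seteqP; split=> w /=.
  move=> h; split.
    by have := h k; rewrite /= !inE eqxx; apply.
  move=> i iJ; have := h i; rewrite /= !inE iJ orbT.
  by rewrite (_ : i == k = false); [exact|apply: contraNF kJ => /eqP <-].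
move=> [hk h] i /=; rewrite !inE.
by have [->|ik] //= := eqVneq i k; exact: h.
Qed.

Let P_cylU1 (J : {fset nat}) B k A : (forall i, measurable (B i)) -> measurable A ->
  k \notin J -> P (X k @^-1` A `&` cyl J B) = mu A * P (cyl J B).
Proof.
move=> mB mA kJ; rewrite -cylU1// X_indep; last first.
  by move=> i _; case: ifPn.
rewrite X_indep// big_fsetU1//= eqxx X_law//; congr (_ * _).
apply: eq_big_seq => i iJ; rewrite (_ : i == k = false)//.
by apply: contraNF kJ => /eqP <-.
Qed.

Variables (i0 j0 : nat).
Hypothesis ij : i0 != j0.

Local Definition pairXij w := (X i0 w, X j0 w).

Let mpair : measurable_fun setT pairXij.
Proof. exact: measurable_fun_pair. Qed.

HB.instance Definition _ := isMeasurableFun.Build _ _ _ _ pairXij mpair.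

Let P_pair (J : {fset nat}) B S : (forall i, measurable (B i)) -> measurable S ->
  i0 \notin J -> j0 \notin J ->
  P (pairXij @^-1` S `&` cyl J B) = (mu \x mu) S * P (cyl J B).
Proof.
move=> mB mS iJ jJ; have mF := mcyl J mB.
rewrite (@joint_law _ _ _ _ _ _ _ P _ mF (X i0) (X j0) mu)//; last first.
  move=> A A' mA mA'; rewrite -setIA -(cylU1 _ _ jJ).
  rewrite P_cylU1//; last 2 first.
  - by move=> i; case: ifPn.
  - by rewrite !inE negb_or ij.
  by rewrite cylU1// !P_cylU1// -!muleA; congr (_ * _); rewrite muleC.
transitivity (\int[mu]_u (mu (xsection S u) * (fine (P (cyl J B)))%:E)).
  apply: ge0_integral_density => //.
  - by move=> _; rewrite fine_ge0.
  - move=> A mA /=; rewrite integral_cst// /restricted_law /pushforward /mrestr.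
    by rewrite P_cylU1// muleC fineK// fin_num_measure.
  - exact: measurable_fun_xsection.
rewrite fineK ?fin_num_measure// ge0_integralZr//.
exact: measurable_fun_xsection.
Qed.

Variable D : set ((T' * T') * T').
Hypothesis mD : measurable D.

Definition avoid (ks : seq nat) : set T :=
  [set w | forall k, k \in ks -> ~ D ((X i0 w, X j0 w), X k w)].

Let avoid_cons k ks :
  avoid (k :: ks) = (fun w => (pairXij w, X k w)) @^-1` (~` D) `&` avoid ks.
Proof.
apply/seteqP; split=> w /=.
  by move=> h; split=> [|l lks]; apply: h; rewrite inE ?eqxx ?lks ?orbT.
by move=> [h1 h2] l; rewrite inE => /orP[/eqP ->|/h2].
Qed.

Lemma measurable_avoid ks : measurable (avoid ks).
Proof.
elim: ks => [|k ks ih]; first by rewrite (_ : avoid _ = setT)//; apply/seteqP; split.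
rewrite avoid_cons; apply: measurableI => //.
rewrite -[X in measurable X]setTI.
by apply: measurable_fun_pair => //; exact: measurableC.
Qed.

Definition miss_proba p : R := fine (1 - mu (xsection D p)).

Local Notation g := miss_proba.

Lemma miss_probaE p : (g p)%:E = 1 - mu (xsection D p).
Proof.
have h : mu (xsection D p) \is a fin_num.
  by apply: fin_num_measure; exact: measurable_xsection.
by rewrite fineK// fin_numB h.
Qed.

Lemma miss_proba_ge0 p : (0 <= g p)%R.
Proof.
rewrite -lee_fin miss_probaE sube_ge0; last by rewrite orbT.
by apply: probability_le1; exact: measurable_xsection.
Qed.

Lemma measurable_miss_proba : measurable_fun setT g.
Proof.
apply: measurableT_comp => //; apply: emeasurable_funB => //.
exact: measurable_fun_xsection.
Qed.

(** Given the pair, the other samples avoid [D] independently, each with probability [g p]. The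
    cylinder over [J] strengthens the induction on [ks]: with [k] moved into [J], the induction
    hypothesis says that [X k] is independent of the pair together with the event that the samples
    in [ks] avoid [D], an event that itself depends on the pair. *)
Lemma P_pair_avoid (J : {fset nat}) B S ks : (forall i, measurable (B i)) ->
  measurable S -> i0 \notin J -> j0 \notin J -> i0 \notin ks -> j0 \notin ks ->
  uniq ks -> (forall k, k \in ks -> k \notin J) ->
  P (pairXij @^-1` S `&` avoid ks `&` cyl J B) =
  (\int[mu \x mu]_(p in S) (g p ^+ size ks)%:E) * P (cyl J B).
Proof.
elim: ks J B S => [|k ks ih] J B S mB mS iJ jJ.
  move=> _ _ _ _; rewrite (_ : avoid _ = setT) ?setIT; last by apply/seteqP; split.
  rewrite P_pair// (eq_integral (cst 1)); first by rewrite integral_cst// mul1e.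
  by move=> p _; rewrite expr0.
rewrite !inE !negb_or => /andP[ik iks] /andP[jk jks] /andP[kks uks] kJ.
have kJ' l : l \in ks -> l \notin J by move=> lks; apply: kJ; rewrite inE lks orbT.
have kJk : k \notin J by apply: kJ; rewrite inE eqxx.
have mF : measurable (avoid ks `&` cyl J B) by apply: measurableI; [exact: measurable_avoid|exact: mcyl].
have ih1 A : measurable A -> P (pairXij @^-1` A `&` (avoid ks `&` cyl J B)) =
    (\int[mu \x mu]_(p in A) (g p ^+ size ks)%:E) * P (cyl J B).
  by move=> mA; rewrite setIA ih.
pose C := (S `*` setT) `&` ~` D.
have mC : measurable C by apply: measurableI; [exact: measurableX|exact: measurableC].
rewrite (_ : _ `&` _ = (fun w => (pairXij w, X k w)) @^-1` C `&` (avoid ks `&` cyl J B)); last first.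
  rewrite avoid_cons; apply/seteqP; split=> w.
    by move=> [[h1 [h2 h3]] h4].
  by move=> [[[h1 _] h2] [h3 h4]].
rewrite (@joint_law _ _ _ _ _ _ _ P _ mF pairXij (X k) mu)//; last first.
  move=> A A' mA mA'; rewrite ih1//.
  rewrite (_ : _ `&` _ = pairXij @^-1` A `&` avoid ks `&` (X k @^-1` A' `&` cyl J B)).
    rewrite -cylU1// ih//.
    - by rewrite cylU1// P_cylU1// -muleA; congr (_ * _); rewrite muleC.
    - by move=> i; case: ifPn.
    - by rewrite !inE negb_or ik.
    - by rewrite !inE negb_or jk.
    - move=> l lks; rewrite !inE negb_or kJ'// andbT.
      by apply: contraNneq kks => <-.
  by apply/seteqP; split=> w [[h1 h2] [h3 h4]].
have PE : P (cyl J B) = (fine (P (cyl J B)))%:E.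
  by rewrite fineK// fin_num_measure//; exact: mcyl.
have mg := measurable_miss_proba.
have mgn n : measurable_fun setT (fun p => (g p ^+ n)%:E).
  by apply/measurable_EFinP; exact: measurable_funX.
pose c := fine (P (cyl J B)).
have c0 : (0 <= c)%R by rewrite fine_ge0.
(* By the induction hypothesis the law of the pair on this event has density [g u ^+ size ks * c];
   the section of [C] then contributes the missing factor [g u] on [S]. *)
transitivity (\int[mu \x mu]_u (mu (xsection C u) * (g u ^+ size ks * c)%:E)).
  apply: ge0_integral_density => //.
  - by apply: measurable_funM => //; exact: measurable_funX.
  - by move=> u; rewrite mulr_ge0// exprn_ge0// miss_proba_ge0.
  - move=> A mA /=; rewrite /restricted_law /pushforward /mrestr ih1//.
    rewrite PE; under [RHS]eq_integral do rewrite EFinM.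
    rewrite ge0_integralZr//; first exact: measurable_funTS.
    by move=> u _; rewrite lee_fin exprn_ge0// miss_proba_ge0.
  - exact: measurable_fun_xsection.
have CE u : mu (xsection C u) = (\1_S u)%:E * (g u)%:E.
  have [uS|uS] := boolP (u \in S).
    rewrite indicE uS mul1e miss_probaE -probability_setC; last exact: measurable_xsection.
    congr (mu _); apply/seteqP; split=> z; rewrite /xsection /= /C !inE.
      by move=> [].
    by move=> ?; split=> //; split=> //=; rewrite -inE.
  rewrite indicE (negbTE uS) mul0e (_ : xsection _ _ = set0) ?measure0//.
  by apply/seteqP; split=> z //; rewrite /xsection /= /C inE /= => -[[+ _] _]; rewrite -inE (negbTE uS).
under eq_integral do rewrite CE.
rewrite PE -/c [in RHS]integral_mkcond -ge0_integralZr//; last 2 first.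
- by apply/(measurable_restrictT _ _).1 => //; exact: measurable_funTS.
- by move=> u _; rewrite erestrict_ge0// => v _; rewrite lee_fin exprn_ge0// miss_proba_ge0.
apply: eq_integral => u _; rewrite /patch indicE.
case: ifPn => _; rewrite ?mul1e ?mul0e//= exprS.
by rewrite -!EFinM mulrA.
Qed.

End iid_void.

Lemma card_off_diagonal n : #|[pred v : 'I_n * 'I_n | v.1 != v.2]| = (n * (n - 1))%N.
Proof.
have := cardC [pred v : 'I_n * 'I_n | v.1 == v.2]; rewrite card_prod !card_ord.
have -> : #|[pred v : 'I_n * 'I_n | v.1 == v.2]| = n.
  rewrite -[RHS]card_ord -(card_codom (f := fun i : 'I_n => (i, i))); last by move=> i j [].
  apply: eq_card => -[i j]; rewrite !inE /=; apply/eqP/codomP => [->|[k [-> ->]]//].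
  by exists j.
move=> h; rewrite mulnBr muln1 -h addKn.
exact: eq_card.
Qed.

(** * Expected number of void pairs *)

Section expected_void_pairs.
Local Open Scope ereal_scope.
Context d d' (T : measurableType d) (E : measurableType d') (R : realType).
Variables (P : probability T R) (X : nat -> {mfun T >-> E}) (mu : probability E R).
Hypothesis X_indep : mutually_independent (X : nat -> {RV P >-> E}).
Hypothesis X_law : forall i B, measurable B -> P (X i @^-1` B) = mu B.
Variables (S : set (E * E)) (D : set ((E * E) * E)).
Hypotheses (mS : measurable S) (mD : measurable D).

(** The exponent is the number of other samples. For [n < 2] the truncated subtraction is harmless:
    the factor [n * (n - 1)] in [expected_void_pairs] is zero. *)
Definition void_integral (n : nat) : \bar R :=
  \int[mu \x mu]_(p in S) (miss_proba mu D p ^+ (n - 2))%:E.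

Lemma void_integral_le1 n : void_integral n <= 1.
Proof.
have miss1 p : (miss_proba mu D p <= 1)%R.
  rewrite -lee_fin miss_probaE// -[leRHS]sube0; apply: leeB => //.
apply: (@le_trans _ _ (\int[mu \x mu]_(p in S) cst 1 p)).
  apply: ge0_le_integral => //.
  - by move=> p _; rewrite lee_fin exprn_ge0// miss_proba_ge0.
  - apply: measurable_funTS; apply/measurable_EFinP; apply: measurable_funX.
    exact: measurable_miss_proba.
  - by move=> p _; rewrite lee_fin exprn_ile1// miss_proba_ge0.
rewrite integral_cst// mul1e.
apply: (@le_trans _ _ ((mu \x mu) (setT `*` setT))).
  by apply: le_measure; rewrite ?inE//; exact: measurableX.
by rewrite product_measure1E// [X in X * _](probability_setT mu) mul1e probability_le1.
Qed.

Lemma void_integral_ge0 n : 0 <= void_integral n.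
Proof.
by apply: integral_ge0 => p _; rewrite lee_fin exprn_ge0// miss_proba_ge0.
Qed.

Let ev (n : nat) (v : 'I_n * 'I_n) : set T :=
  [set w | void_pair S (xsection D) (fun i => X i w) v].

Let others (n : nat) (v : 'I_n * 'I_n) :=
  [seq k <- iota 0 n | (k != v.1 :> nat) && (k != v.2 :> nat)].

Let ev_avoid n (v : 'I_n * 'I_n) : v.1 != v.2 ->
  ev v = (fun w => (X v.1 w, X v.2 w)) @^-1` S `&` avoid X v.1 v.2 D (others v).
Proof.
move=> v12; apply/seteqP; split=> w.
  move=> [_ h1 h2]; split=> // k; rewrite mem_filter mem_iota add0n.
  move=> /andP[/andP[k1 k2] kn]; have := h2 (Ordinal kn) k1 k2.
  by rewrite /xsection /= inE.
move=> [h1 h2]; split=> // k k1 k2; rewrite /xsection /= inE.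
by apply: h2; rewrite mem_filter mem_iota k1 k2 add0n /=.
Qed.

Let size_others n (v : 'I_n * 'I_n) : v.1 != v.2 -> size (others v) = (n - 2)%N.
Proof.
move=> v12; rewrite size_filter.
have -> : iota 0 n = map val (enum 'I_n) by rewrite val_enum_ord.
rewrite count_map -size_filter.
rewrite (eq_filter (a2 := mem (~: [set v.1; v.2])%SET)); last first.
  by move=> k; rewrite /= !inE negb_or.
transitivity #|(~: [set v.1; v.2])%SET|; first by rewrite enumT cardE.
by rewrite cardsCs finset.setCK cards2 v12 card_ord.
Qed.

Lemma measurable_void_pair n (v : 'I_n * 'I_n) : measurable (ev v).
Proof.
have [v12|v12] := eqVneq v.1 v.2.
  by rewrite (_ : ev v = set0)//; apply/seteqP; split=> // w []; rewrite v12 eqxx.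
rewrite ev_avoid//; apply: measurableI; last exact: measurable_avoid.
by rewrite -[X in measurable X]setTI; apply: measurable_fun_pair.
Qed.

Lemma void_pair_proba n (v : 'I_n * 'I_n) :
  P (ev v) = if v.1 != v.2 then void_integral n else 0.
Proof.
case: ifPn => v12; last first.
  rewrite (_ : ev v = set0) ?measure0//; apply/seteqP; split=> // w [].
  by rewrite (negbTE v12).
have := @P_pair_avoid _ _ _ _ _ P X mu X_indep X_law v.1 v.2 v12 D mD fset0
  (fun=> setT) S (others v) _ mS.
rewrite set_fset0 bigcap_set0 setIT probability_setT mule1 -ev_avoid// => ->//.
- by rewrite /void_integral; under eq_integral do rewrite size_others//.
- by rewrite mem_filter eqxx.
- by rewrite mem_filter eqxx andbF.
- by rewrite filter_uniq// iota_uniq.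
Qed.

Lemma nb_void_pairsE n w : (nb_void_pairs n S (xsection D) (fun i => X i w))%:R%:E =
  \sum_(v : 'I_n * 'I_n) (\1_(ev v) w)%:E :> \bar R.
Proof.
rewrite sumEFin /nb_void_pairs -sum1_card natr_sum big_mkcond/=; congr _%:E.
by apply: eq_bigr => v _; rewrite finset.in_set indicE; case: asboolP => h;
  [rewrite mem_set|rewrite memNset].
Qed.

Lemma measurable_nb_void_pairs n : measurable_fun setT
  (fun w => (nb_void_pairs n S (xsection D) (fun i => X i w))%:R%:E : \bar R).
Proof.
under eq_fun do rewrite nb_void_pairsE.
apply: emeasurable_sum => v; apply/measurable_EFinP.
by apply: measurable_indic; exact: measurable_void_pair.
Qed.

Lemma expected_void_pairs n :
  \int[P]_w (nb_void_pairs n S (xsection D) (fun i => X i w))%:R%:E =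
  (n * (n - 1))%:R%:E * void_integral n.
Proof.
under eq_integral do rewrite nb_void_pairsE.
rewrite ge0_integral_sum//; last first.
  by move=> v; apply/measurable_EFinP/measurable_indic; exact: measurable_void_pair.
rewrite (eq_bigr (fun v : 'I_n * 'I_n => if v.1 != v.2 then void_integral n else 0)).
  by rewrite -big_mkcond/= big_const card_off_diagonal iter_addr_0 mule_natl.
move=> v _; have mv := measurable_void_pair v.
by rewrite integral_indic// setIT; exact: void_pair_proba.
Qed.

End expected_void_pairs.

(** * Lebesgue measure on the plane *)

Section product_measure_map.
Local Open Scope ereal_scope.
Context d1 d2 (T1 : measurableType d1) (T2 : measurableType d2) (R : realType).
Variables (m1 : {sigma_finite_measure set T1 -> \bar R})
  (m2 : {sigma_finite_measure set T2 -> \bar R}) (g : T1 -> T1) (h : T2 -> T2).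
Hypotheses (mg : measurable_fun setT g) (mh : measurable_fun setT h).
Hypothesis gP : forall A, measurable A -> m1 (g @^-1` A) = m1 A.
Hypothesis hP : forall A, measurable A -> m2 (h @^-1` A) = m2 A.

Let mgh : measurable_fun setT (fun p : T1 * T2 => (g p.1, h p.2)).
Proof. by apply: measurable_fun_pair; apply: measurableT_comp. Qed.

(** By uniqueness of the product measure, rectangles suffice. *)
Lemma product_measure_map A : measurable A ->
  (m1 \x m2) ((fun p => (g p.1, h p.2)) @^-1` A) = (m1 \x m2) A.
Proof.
move=> mA; apply/esym.
apply: (@product_measure_unique _ _ _ _ _ m1 m2
  (measure_function_pushforward__canonical__measure_function_Measure (m1 \x m2) mgh)) => // B C mB mC.
rewrite -gP// -hP// -product_measure1E//.
- by rewrite -[X in measurable X]setTI; exact: mg.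
- by rewrite -[X in measurable X]setTI; exact: mh.
Qed.

End product_measure_map.

Section plane_lebesgue.
Context {R : realType}.
Local Open Scope ereal_scope.
Local Notation leb := (@lebesgue_measure R).

(* [lebesgue2] on the canonical measurable structure of [R * R], and with the
   sigma-finiteness required by Tonelli's theorem. *)
Definition plane_leb : set (R * R)%type -> \bar R := lebesgue2.

Let plane_leb0 : plane_leb set0 = 0. Proof. exact: measure0. Qed.

Let plane_leb_ge0 A : 0 <= plane_leb A. Proof. exact: measure_ge0. Qed.

Let plane_leb_sigma_additive : semi_sigma_additive plane_leb.
Proof. exact: (@measure_semi_sigma_additive _ _ _ lebesgue2). Qed.

HB.instance Definition _ := isMeasure.Build _ _ _ plane_leb
  plane_leb0 plane_leb_ge0 plane_leb_sigma_additive.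

Lemma plane_lebX (A B : set R) : measurable A -> measurable B ->
  plane_leb (A `*` B) = leb A * leb B.
Proof.
exact: (@product_measure1E _ _ (measurableTypeR R) (measurableTypeR R) R leb leb A B).
Qed.

Let plane_leb_sigma_finite : sigma_finite setT plane_leb.
Proof.
have /sigma_finiteP[F [TF ndF Foo]] := sigma_finiteT leb.
exists (fun n => F n `*` F n) => [|k].
  rewrite -setXTT TF predeqE => -[p q]; split=> [[/= [n _ Fn] [k _ Fk]]|].
    exists (maxn n k) => //; split.
      by move: p Fn; exact/subsetPset/ndF/leq_maxl.
    by move: q Fk; exact/subsetPset/ndF/leq_maxr.
  by move=> [n _ [/= ? ?]]; split; exists n.
have [mF Fk] := Foo k; split; first exact: measurableX.
by rewrite plane_lebX// lte_mul_pinfty// ge0_fin_numE.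
Qed.

HB.instance Definition _ := @Measure_isSigmaFinite.Build _ _ _ plane_leb
  plane_leb_sigma_finite.

(* The displays of [R] and [measurableTypeR R] differ, so that this is not a
   conversion. *)
Lemma integral_lebesgue2 (D : set (R * R)%type) (F : R * R -> \bar R) :
  measurable D -> measurable_fun D F -> (forall p, 0 <= F p) ->
  \int[lebesgue2]_(p in D) F p = \int[plane_leb]_(p in D) F p.
Proof.
move=> mD mF F0.
pose phi : measurableTypeR R * measurableTypeR R -> R * R := id.
have mphi : measurable_fun setT phi by move=> _ B mB; rewrite setTI.
transitivity (\int[pushforward lebesgue2 phi]_(p in D) F p).
  by rewrite (@ge0_integral_pushforward _ _ _ _ _ phi mphi lebesgue2 D F).
exact: eq_measure_integral.
Qed.

Lemma lebesgue_shift (a : R) (A : set R) : measurable A ->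
  leb ((fun t => t + a)%R @^-1` A) = leb A.
Proof.
move=> mA.
have mf : measurable_fun setT ((fun t => t + a)%R : measurableTypeR R -> measurableTypeR R).
  by apply: measurable_funD.
rewrite -[LHS]/(pushforward leb ((fun t => t + a)%R : measurableTypeR R -> measurableTypeR R) A).
apply/esym/lebesgue_measure_unique => //= _ [[b c]] _ <-.
rewrite /pushforward.
rewrite (_ : _ @^-1` _ = `](b - a)%R, (c - a)%R]%classic).
  rewrite !lebesgue_measure_itv/= !lte_fin ltrD2r; case: ifP => // _.
  by rewrite -!EFinB; congr _%:E; ring.
by apply/seteqP; split=> t /=; rewrite !in_itv /= ltrBlDr lerBrDr.
Qed.

Lemma plane_leb_map (g h : R -> R) : measurable_fun setT g -> measurable_fun setT h ->
  (forall A, measurable A -> leb (g @^-1` A) = leb A) ->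
  (forall A, measurable A -> leb (h @^-1` A) = leb A) ->
  forall A, measurable A -> plane_leb ((fun p => (g p.1, h p.2)) @^-1` A) = plane_leb A.
Proof.
move=> mg mh gP hP A mA.
exact: (@product_measure_map _ _ (measurableTypeR R) (measurableTypeR R) R leb leb g h mg mh gP hP).
Qed.

End plane_lebesgue.

(** * Measurability of the planar constructions *)

Section measurable_geometry.
Context d (T : measurableType d) (R : realType).
Implicit Types (g h : T -> R) (p q : T -> R * R) (x : R * R).

(** Inversion is continuous off 0 only; at 0 it takes the default value 0, which is split off. *)
Lemma measurable_inv : measurable_fun setT (@GRing.inv R).
Proof.
have -> : (@GRing.inv R) = fun t => if t == 0 then 0 else t^-1.
  by apply/funext => t; case: eqP => // ->; rewrite invr0.
have m0 : measurable [set t : R | t != 0].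
  rewrite (_ : [set _ | _] = ~` [set 0]); first exact: measurableC.
  by apply/seteqP; split=> t /= /eqP.
apply: measurable_fun_if => //.
- apply: (measurable_fun_bool true); rewrite setTI.
  by rewrite (_ : _ @^-1` _ = [set 0])//; apply/seteqP; split=> t /= /eqP.
- rewrite setTI (_ : _ @^-1` _ = [set t : R | t != 0]).
    apply: open_continuous_measurable_fun; first exact: open_neq.
    by apply/in_setP => t /= t0; exact: inv_continuous.
  by apply/seteqP; split=> t /=; [move/negbT|move/negbTE].
Qed.

Lemma measurable_sqrt : measurable_fun setT (@Num.sqrt R).
Proof. by apply: continuous_measurable_fun; exact: sqrt_continuous. Qed.

Lemma measurable_plane p : measurable_fun setT p <->
  measurable_fun setT (fun t => (p t).1) /\ measurable_fun setT (fun t => (p t).2).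
Proof.
split=> [mp|[m1 m2]]; last exact/measurable_fun_pairP.
by split; apply: measurableT_comp.
Qed.

Lemma measurable_plane_sub p q : measurable_fun setT p -> measurable_fun setT q ->
  measurable_fun setT (fun t => p t - q t).
Proof.
move=> /measurable_plane[p1 p2] /measurable_plane[q1 q2].
by apply/measurable_plane; split; apply: measurable_funB.
Qed.

Lemma measurable_dot p q : measurable_fun setT p -> measurable_fun setT q ->
  measurable_fun setT (fun t => dot (p t) (q t)).
Proof.
move=> /measurable_plane[p1 p2] /measurable_plane[q1 q2].
by apply: measurable_funD; apply: measurable_funM.
Qed.

Lemma measurable_cross p q : measurable_fun setT p -> measurable_fun setT q ->
  measurable_fun setT (fun t => cross (p t) (q t)).
Proof.
move=> /measurable_plane[p1 p2] /measurable_plane[q1 q2].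
by apply: measurable_funB; apply: measurable_funM.
Qed.

Lemma measurable_enorm p : measurable_fun setT p ->
  measurable_fun setT (fun t => enorm (p t)).
Proof.
move=> mp; under eq_fun do rewrite enormE.
apply: measurableT_comp; first exact: measurable_sqrt.
exact: measurable_dot.
Qed.

Lemma measurable_line_meet p g q h : measurable_fun setT p -> measurable_fun setT g ->
  measurable_fun setT q -> measurable_fun setT h ->
  measurable_fun setT (fun t => line_meet (p t) (g t) (q t) (h t)).
Proof.
move=> mp mg mq mh; have mc := measurable_cross mp mq.
move: mp mq => /measurable_plane[p1 p2] /measurable_plane[q1 q2].
have mi : measurable_fun setT (fun t => (cross (p t) (q t))^-1).
  by apply: measurableT_comp mc; exact: measurable_inv.
apply/measurable_plane; split; apply: measurable_funM => //.
  by apply: measurable_funB; apply: measurable_funM.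
by apply: measurable_funB; apply: measurable_funM.
Qed.

Lemma measurable_bisector_level x p : measurable_fun setT p ->
  measurable_fun setT (fun t => bisector_level x (p t)).
Proof.
move=> mp; apply: measurable_funM => //; apply: measurable_funB => //.
exact: measurable_dot.
Qed.

Lemma measurable_circumcenter x p q : measurable_fun setT p -> measurable_fun setT q ->
  measurable_fun setT (fun t => circumcenter x (p t) (q t)).
Proof.
move=> mp mq; apply: measurable_line_meet; try exact: measurable_bisector_level.
- by apply: measurable_plane_sub.
- by apply: measurable_plane_sub.
Qed.

Lemma measurable_circumradius x p q : measurable_fun setT p -> measurable_fun setT q ->
  measurable_fun setT (fun t => circumradius x (p t) (q t)).
Proof.
move=> mp mq; apply: measurable_enorm; apply: measurable_plane_sub => //.
exact: measurable_circumcenter.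
Qed.

Lemma measurable_lt_set g h : measurable_fun setT g -> measurable_fun setT h ->
  measurable [set t | g t < h t].
Proof.
move=> mg mh; rewrite -[X in measurable X]setTI.
by apply: (measurable_fun_ltr mg mh) => //.
Qed.

Lemma measurable_le_set g h : measurable_fun setT g -> measurable_fun setT h ->
  measurable [set t | g t <= h t].
Proof.
move=> mg mh; rewrite -[X in measurable X]setTI.
by apply: (measurable_fun_ler mg mh) => //.
Qed.

Lemma measurable_eq_set g h : measurable_fun setT g -> measurable_fun setT h ->
  measurable [set t | g t = h t].
Proof.
move=> mg mh; rewrite (_ : [set t | g t = h t] = [set t | g t <= h t] `&` [set t | h t <= g t]).
  by apply: measurableI; exact: measurable_le_set.
apply/seteqP; split=> t /= => [->//|[gh hg]].
by apply/eqP; rewrite eq_le gh hg.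
Qed.

End measurable_geometry.

Section measurable_regions.
Context (R : realType).
Implicit Types (x : R * R).
Local Notation plane := (R * R)%type.

Lemma measurable_eball x (r : R) : measurable (eball x r).
Proof. by apply: measurable_lt_set => //; apply: measurable_enorm; exact: measurable_plane_sub. Qed.

Lemma measurable_ccw_pairs x (r : R) : measurable (ccw_pairs x r).
Proof.
apply: measurableI.
  apply: measurable_lt_set => //; apply: measurable_cross; apply: measurable_plane_sub => //.
apply: measurable_lt_set => //; exact: measurable_circumradius.
Qed.

Lemma measurable_split_pairs x : measurable (split_pairs x).
Proof.
apply: measurable_lt_set => //; apply: measurable_funM.
  have [] := (@measurable_plane _ (plane * plane)%type _ (fun v => v.1 - x)).1 => //.
  exact: measurable_plane_sub.
have [] := (@measurable_plane _ (plane * plane)%type _ (fun v => v.2 - x)).1 => //.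
exact: measurable_plane_sub.
Qed.

Definition circumdisc_graph x : set ((plane * plane) * plane) :=
  [set v | circumdisc x v.1 v.2].

Lemma measurable_circumdisc_graph x : measurable (circumdisc_graph x).
Proof.
have m1 : measurable_fun setT (fun v : (plane * plane) * plane => v.1.1) by exact: measurableT_comp.
have m2 : measurable_fun setT (fun v : (plane * plane) * plane => v.1.2) by exact: measurableT_comp.
apply: measurable_lt_set; last exact: measurable_circumradius.
apply: measurable_enorm; apply: measurable_plane_sub => //.
exact: measurable_circumcenter.
Qed.

Lemma xsection_circumdisc x v : xsection (circumdisc_graph x) v = circumdisc x v.
Proof. by apply/seteqP; split=> p; rewrite /xsection /= inE. Qed.

Definition quarter_graph (e : bool * bool) x (s : R) : set ((plane * plane) * plane) :=
  [set v | quarter e x (farther x s v.1) v.2].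

Lemma xsection_quarter e x s v :
  xsection (quarter_graph e x s) v = quarter e x (farther x s v).
Proof. by apply/seteqP; split=> p; rewrite /xsection /= inE. Qed.

Lemma measurable_farther x s : measurable_fun setT (farther x s).
Proof.
apply: measurable_minr => //; apply: measurable_funM => //.
by apply: measurable_maxr; apply: measurable_enorm; apply: measurable_plane_sub.
Qed.

Lemma measurable_quarter_graph e x s : measurable (quarter_graph e x s).
Proof.
have mf : measurable_fun setT (fun v : (plane * plane) * plane => farther x s v.1).
  by apply: measurableT_comp => //; exact: measurable_farther.
have [m1 m2] := (@measurable_plane _ ((plane * plane) * plane)%type _ (fun v => v.2)).1 (@measurable_snd _ _ _ _).
have slab (b : bool) (g : (plane * plane) * plane -> R) (y : R) : measurable_fun setT g ->
    measurable [set v | farther x s v.1 / 4 <= (-1) ^+ b * (g v - y) < farther x s v.1 / 2].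
  move=> mg; rewrite (_ : [set _ | _] =
    [set v | farther x s v.1 / 4 <= (-1) ^+ b * (g v - y)] `&`
    [set v | (-1) ^+ b * (g v - y) < farther x s v.1 / 2]); last first.
    by apply/seteqP; split=> v /andP.
  apply: measurableI; [apply: measurable_le_set|apply: measurable_lt_set].
  - by apply: measurable_funM.
  - by apply: measurable_funM => //; apply: measurable_funB.
  - by apply: measurable_funM => //; apply: measurable_funB.
  - by apply: measurable_funM.
by apply: measurableI; exact: slab.
Qed.

Lemma measurable_quarter e x (s : R) : measurable (quarter e x s).
Proof.
have [m1 m2] := (@measurable_plane _ (plane)%type _ id).1 (@measurable_id _ _ _).
have slab (b : bool) (g : plane -> R) (y : R) : measurable_fun setT g ->
    measurable [set v | s / 4 <= (-1) ^+ b * (g v - y) < s / 2].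
  move=> mg; rewrite (_ : [set _ | _] =
    [set v | s / 4 <= (-1) ^+ b * (g v - y)] `&`
    [set v | (-1) ^+ b * (g v - y) < s / 2]); last first.
    by apply/seteqP; split=> v /andP.
  apply: measurableI; [apply: measurable_le_set|apply: measurable_lt_set] => //.
  - by apply: measurable_funM => //; apply: measurable_funB.
  - by apply: measurable_funM => //; apply: measurable_funB.
by apply: measurableI; exact: slab.
Qed.

End measurable_regions.

(** * Areas and null sets *)

Section plane_lebesgue_facts.
Context {R : realType}.
Local Notation leb := (@lebesgue_measure R).
Implicit Types (x a c : R * R) (A : set (R * R)).

Let shift_measurable (a : R) : measurable_fun setT ((fun t => t + a) : R -> R).
Proof. exact: measurable_funD. Qed.

Let reflect_measurable (a : R) : measurable_fun setT ((fun t => a - t) : R -> R).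
Proof. exact: measurable_funB. Qed.

Lemma lebesgue_reflect (a : R) (A : set R) : measurable A ->
  leb ((fun t => a - t) @^-1` A) = leb A.
Proof.
move=> mA; rewrite -(lebesgue_shift a mA) -[in RHS]lebesgue_measureN.
  by congr (leb _); apply/seteqP; split=> t /=; rewrite addrC.
by rewrite -[X in measurable X]setTI; exact: shift_measurable.
Qed.

Lemma plane_leb_shift a A : measurable A ->
  plane_leb ((fun p => p + a) @^-1` A) = plane_leb A.
Proof.
move=> mA; apply: (@plane_leb_map _ (fun t => t + a.1) (fun t => t + a.2)) => //.
- by move=> B mB; exact: lebesgue_shift.
- by move=> B mB; exact: lebesgue_shift.
Qed.

Lemma plane_leb_reflect a A : measurable A ->
  plane_leb ((fun p => a - p) @^-1` A) = plane_leb A.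
Proof.
move=> mA; apply: (@plane_leb_map _ (fun t => a.1 - t) (fun t => a.2 - t)) => //.
- by move=> B mB; exact: lebesgue_reflect.
- by move=> B mB; exact: lebesgue_reflect.
Qed.

Lemma plane_leb_eball c x (r : R) : plane_leb (eball c r) = plane_leb (eball x r).
Proof.
rewrite -(plane_leb_shift (c - x) (measurable_eball c r)); congr (plane_leb _).
by apply/seteqP; split=> q; rewrite /eball /= addrAC addrA subrK.
Qed.

Lemma plane_leb_eball_le x (r : R) : 0 <= r ->
  (plane_leb (eball x r) <= (4 * r ^+ 2)%:E)%E.
Proof.
move=> r0; pose I (t : R) := `]t - r, t + r[%classic.
have -> : (4 * r ^+ 2)%:E = plane_leb (I x.1 `*` I x.2).
  rewrite plane_lebX /I ?measurable_itv// !lebesgue_measure_itv/= !lte_fin.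
  have sE t : t + r - (t - r) = 2 * r by ring.
  have [r1|r1] := ltP (0 : R) r.
    rewrite !ltrD2l gtrN// -!EFinB !sE -EFinM; congr _%:E; ring.
  have -> : r = 0 by apply/eqP; rewrite eq_le r0 r1.
  by rewrite !subr0 !addr0 !ltxx mule0 expr0n mulr0.
apply: le_measure; rewrite ?inE; first exact: measurable_eball.
  by apply: measurableX; exact: measurable_itv.
move=> q; rewrite /eball /= => qr; have [h1 h2] := norm_le_enorm (q - x).
move: (le_lt_trans h1 qr) (le_lt_trans h2 qr); rewrite /= !ltr_norml.
move=> /andP[? ?] /andP[? ?]; rewrite /I /= !in_itv /=.
by split; apply/andP; split; lra.
Qed.

Lemma plane_leb_quarter e x (s : R) : 0 <= s ->
  plane_leb (quarter e x s) = (s ^+ 2 / 16)%:E.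
Proof.
move=> s0.
pose I (b : bool) (t : R) : set R := if b then `]t - s / 2, t - s / 4]%classic
  else `[t + s / 4, t + s / 2[%classic.
have mI b t : measurable (I b t) by case: b; exact: measurable_itv.
have lI b t : leb (I b t) = (s / 4)%:E.
  have [s1|s1] := ltP (0 : R) s.
    case: b; rewrite lebesgue_measure_itv/= lte_fin.
      by rewrite ifT; [rewrite -EFinB; congr _%:E; field|lra].
    by rewrite ifT; [rewrite -EFinB; congr _%:E; field|lra].
  have sE : s = 0 by apply/eqP; rewrite eq_le s0 s1.
  by case: b; rewrite lebesgue_measure_itv/= lte_fin sE !mul0r ?subr0 ?addr0 ltxx.
rewrite (_ : quarter e x s = I e.1 x.1 `*` I e.2 x.2).
  by rewrite plane_lebX// !lI -EFinM; congr _%:E; field.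
have IE (b : bool) (t u : R) : (s / 4 <= (-1) ^+ b * (u - t) < s / 2) <-> I b t u.
  rewrite /I; case: b; rewrite /= in_itv/= ?expr1 ?expr0 ?mulN1r ?mul1r.
    by split=> /andP[? ?]; apply/andP; split; lra.
  by split=> /andP[? ?]; apply/andP; split; lra.
by apply/seteqP; split=> p [h1 h2]; split; apply/IE.
Qed.

Lemma plane_leb_null_xsection A : measurable A ->
  (forall t, leb (xsection A t) = 0%E) -> plane_leb A = 0%E.
Proof.
move=> mA h; rewrite -[LHS]/(\int[leb]_t leb (xsection A t))%E.
by apply: integral0_eq => y _; exact: h.
Qed.

Lemma plane_leb_null_ysection A : measurable A ->
  (forall t, leb (ysection A t) = 0%E) -> plane_leb A = 0%E.
Proof.
move=> mA h.
have := @indic_fubini_tonelli _ _ (measurableTypeR R) (measurableTypeR R) R leb leb A mA.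
rewrite indic_fubini_tonelli_FE// indic_fubini_tonelli_GE//.
move=> e; rewrite -[LHS]/(\int[leb]_t (leb \o xsection A) t)%E e.
by apply: integral0_eq => y _; exact: h.
Qed.

(** A vertical line meets the circle in at most two points. *)
Lemma plane_leb_circle c (r : R) : plane_leb [set p | enorm (p - c) = r] = 0%E.
Proof.
apply: plane_leb_null_xsection.
  apply: measurable_eq_set => //; apply: measurable_enorm.
  exact: measurable_plane_sub.
move=> t; pose u := Num.sqrt (r ^+ 2 - (t - c.1) ^+ 2).
pose B : set R := [set c.2 + u; c.2 - u].
have fB : finite_set B by rewrite finite_setU.
apply: (@subset_measure0 _ (measurableTypeR R) R leb _ B).
- by apply: measurable_xsection; apply: measurable_eq_set => //; apply: measurable_enorm;
    exact: measurable_plane_sub.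
- by apply: measurableU; exact: measurable_set1.
- move=> s; rewrite /xsection /= inE /= => cr.
  have : (s - c.2) ^+ 2 = r ^+ 2 - (t - c.1) ^+ 2.
    by rewrite -cr sqr_enorm /dot /=; ring.
  move=> h; have : `|s - c.2| = u by rewrite /u -h sqrtr_sqr.
  have [s0|s0] := leP 0 (s - c.2).
    by rewrite ger0_norm// => su; left; rewrite /= -su; ring.
  by rewrite ltr0_norm// => su; right; rewrite /= -su; ring.
- by apply: countable_lebesgue_measure0; exact: finite_set_countable.
Qed.

Lemma plane_leb_horizontal (s : R) : plane_leb [set p | p.2 = s] = 0%E.
Proof.
have m2 : measurable_fun setT (fun p : R * R => p.2) by exact: measurable_snd.
apply: plane_leb_null_xsection; first exact: measurable_eq_set.
move=> t; rewrite (_ : xsection _ t = [set s]) ?lebesgue_measure_set1//.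
by apply/seteqP; split=> u; rewrite /xsection /= inE.
Qed.

(** The line through [x] and [p] is not horizontal, so each horizontal line meets it in a single
    point. *)
Lemma plane_leb_collinear x p : (p - x).2 != 0 ->
  plane_leb [set q | cross (p - x) (q - x) = 0] = 0%E.
Proof.
move=> p0.
have mc : measurable [set q : R * R | cross (p - x) (q - x) = 0].
  by apply: measurable_eq_set => //; apply: measurable_cross => //; exact: measurable_plane_sub.
apply: plane_leb_null_ysection => // t.
pose s := x.1 + (p - x).1 * (t - x.2) / (p - x).2.
apply: (@subset_measure0 _ (measurableTypeR R) R leb _ [set s]).
- exact: measurable_ysection.
- exact: measurable_set1.
- move=> u; rewrite /ysection /= inE /= /cross /= => /eqP; rewrite subr_eq0 => /eqP h.
  by rewrite /s /= h mulrAC mulfV// mul1r; ring.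
- exact: lebesgue_measure_set1.
Qed.

End plane_lebesgue_facts.

(** * Symmetry of triangles *)

Section integral_invariance.
Local Open Scope ereal_scope.
Context d (T : measurableType d) (R : realType).
Variables (m : {measure set T -> \bar R}) (g : T -> T).
Hypotheses (mg : measurable_fun setT g)
  (gP : forall A, measurable A -> m (g @^-1` A) = m A).

Lemma ge0_integral_invariant (F : T -> \bar R) : measurable_fun setT F ->
  (forall t, 0 <= F t) -> \int[m]_t F (g t) = \int[m]_t F t.
Proof.
move=> mF F0.
transitivity (\int[pushforward m g]_t F t).
  by rewrite ge0_integral_pushforward.
by apply: eq_measure_integral => A mA _; exact: gP.
Qed.

End integral_invariance.

Section triangle_symmetry.
Local Open Scope ereal_scope.
Context {R : realType} (x : R * R).
Local Notation leb := (@plane_leb R).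
Local Notation plane := (R * R)%type.
Implicit Types v : plane * plane.

Let measurable_shift (a : plane) : measurable_fun setT (fun p : plane => p + a)%R.
Proof.
by apply/measurable_plane; split; apply: measurable_funD.
Qed.

Let measurable_refl (a : plane) : measurable_fun setT (fun p : plane => a - p)%R.
Proof. exact: measurable_plane_sub. Qed.

(* Up to the translation by [x - v.1], the triangle [v.1, v.2, x] in place of
   [x, v.1, v.2]. *)
Definition rotate v : plane * plane := (v.2 + (x - v.1), x + x - v.1)%R.

Lemma measurable_rotate : measurable_fun setT rotate.
Proof.
apply: measurable_fun_pair; last exact: measurable_plane_sub.
rewrite (_ : (fun _ => _) = fun v : plane * plane => (v.2 - (v.1 - x))%R).
  by apply: measurable_plane_sub => //; exact: measurable_plane_sub.
by apply/funext => v; rewrite opprB.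
Qed.

(** For fixed [y] the first component [z + (x - y)] is a translate of [z], and after this change of
    variable only the reflection [x + x - y] of [y] is left. Both preserve area, so that Tonelli's
    theorem concludes. *)
Lemma integral_rotate (G : plane * plane -> \bar R) : measurable_fun setT G ->
  (forall v, 0 <= G v) ->
  \int[leb \x leb]_v G (rotate v) = \int[leb \x leb]_v G v.
Proof.
move=> mG G0.
have mR := measurable_rotate.
rewrite fubini_tonelli1//; last exact: measurableT_comp.
rewrite /fubini_F.
transitivity (\int[leb]_y \int[leb]_z G (z, (x + x - y)%R)).
  apply: eq_integral => y _.
  rewrite -[RHS](@ge0_integral_invariant _ _ _ leb (fun z => z + (x - y))%R)//.
  - by move=> A mA; exact: plane_leb_shift.
  - by apply: measurableT_comp => //; exact: measurable_fun_pair.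
have mG' : measurable_fun setT (fun v : plane * plane => G (v.2, (x + x - v.1)%R)).
  by apply: measurableT_comp => //; apply: measurable_fun_pair => //; exact: measurable_plane_sub.
rewrite (@fubini_tonelli _ _ plane plane R leb leb (fun v => G (v.2, (x + x - v.1)%R)))//.
rewrite [RHS](@fubini_tonelli1 _ _ plane plane R leb leb G mG G0) /fubini_F.
apply: eq_integral => z _ /=.
rewrite (@ge0_integral_invariant _ _ _ leb (fun y => x + x - y)%R _ _ (fun y => G (z, y)))//.
- by move=> A mA; exact: plane_leb_reflect.
- by apply: measurableT_comp => //; exact: measurable_fun_pair.
Qed.

Let degenerate : set (plane * plane) :=
  [set v | v.1.2 = x.2] `|` [set v | v.2.2 = x.2] `|` [set v | v.2.2 = v.1.2].

Let m12 : measurable_fun setT (fun v : plane * plane => v.1.2).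
Proof. exact: measurableT_comp. Qed.

Let m22 : measurable_fun setT (fun v : plane * plane => v.2.2).
Proof. exact: measurableT_comp. Qed.

Let measurable_degenerate : measurable degenerate.
Proof.
by apply: measurableU; [apply: measurableU|]; exact: measurable_eq_set.
Qed.

Let degenerate_null : (leb \x leb) degenerate = 0.
Proof.
have mH (s : R) : measurable [set p : plane | p.2 = s] by apply: measurable_eq_set.
have n3 : (leb \x leb) [set v : plane * plane | v.2.2 = v.1.2] = 0.
  apply: integral0_eq => y _ /=.
  rewrite (_ : xsection _ _ = [set p | p.2 = y.2]) ?plane_leb_horizontal//.
  by apply/seteqP; split=> v; rewrite /xsection /= inE.
have n2 : (leb \x leb) [set v : plane * plane | v.2.2 = x.2] = 0.
  rewrite (_ : [set _ | _] = setT `*` [set p | p.2 = x.2]); last first.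
    by apply/seteqP; split=> v //= [].
  by rewrite product_measure1E// [X in _ * X](plane_leb_horizontal x.2) mule0.
have n1 : (leb \x leb) [set v : plane * plane | v.1.2 = x.2] = 0.
  rewrite (_ : [set _ | _] = [set p | p.2 = x.2] `*` setT); last first.
    by apply/seteqP; split=> v //= [].
  by rewrite product_measure1E// [X in X * _](plane_leb_horizontal x.2) mul0e.
have mv1 : measurable [set v : plane * plane | v.1.2 = x.2] by exact: measurable_eq_set.
have mv2 : measurable [set v : plane * plane | v.2.2 = x.2] by exact: measurable_eq_set.
have mv3 : measurable [set v : plane * plane | v.2.2 = v.1.2] by exact: measurable_eq_set.
rewrite /degenerate (measureU0 (measurableU _ _ mv1 mv2) mv3 n3).
by rewrite (measureU0 mv1 mv2 n2).
Qed.

(* Among the three vertices of a nondegenerate triangle exactly one is in the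
   middle with respect to the second coordinate, and [split_pairs x] says that
   it is [x]. *)
Let one_middle v : ~ degenerate v ->
  ((\1_(split_pairs x) v)%:E + (\1_(split_pairs x) (rotate v))%:E
   + (\1_(split_pairs x) (rotate (rotate v)))%:E = 1 :> \bar R).
Proof.
move=> nd; have [v1 v2 v12] : [/\ (v.1 - x)%R.2 != 0%R, (v.2 - x)%R.2 != 0%R &
    (v.1 - x)%R.2 != (v.2 - x)%R.2].
  by split; apply/eqP => h; apply: nd; rewrite /degenerate /=;
    [left; left|left; right|right]; move: h => /=; lra.
rewrite !indicE.
have inS p : (p \in split_pairs x) = ((p.1 - x).2 * (p.2 - x).2 < 0)%R.
  by apply/idP/idP; rewrite inE.
rewrite !inS -!EFinD; congr _%:E.
set Y := (v.1 - x)%R.2 in v1 v12 *; set Z := (v.2 - x)%R.2 in v2 v12 *.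
have -> : (((rotate v).1 - x).2 * ((rotate v).2 - x).2 = (Z - Y) * - Y)%R.
  by rewrite /Y /Z /rotate /=; ring.
have -> : (((rotate (rotate v)).1 - x).2 * ((rotate (rotate v)).2 - x).2
    = - Z * (Y - Z))%R.
  by rewrite /Y /Z /rotate /=; ring.
clearbody Y Z.
have e1 : (Z - Y < 0)%R = (Z < Y)%R by rewrite subr_lt0.
have e2 : (Y - Z < 0)%R = (Y < Z)%R by rewrite subr_lt0.
have sgn (a b : R) : a != 0%R -> b != 0%R -> (a * b < 0)%R = (a < 0)%R (+) (b < 0)%R.
  rewrite !neq_lt => /orP[a0|a0] /orP[b0|b0].
  - by rewrite nmulr_rlt0// a0 b0 ltNge ltW.
  - by rewrite nmulr_rlt0// a0 b0 ltNge ltW.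
  - by rewrite pmulr_rlt0// b0 ltNge ltW.
  - by rewrite pmulr_rlt0// !ltNge !ltW.
rewrite !sgn ?oppr_eq0 ?subr_eq0// 1?eq_sym// e1 e2 !oppr_lt0.
by case: (ltgtP Y 0%R) v1; case: (ltgtP Z 0%R) v2; case: (ltgtP Y Z) v12 => //= *; rewrite ?addr0 ?add0r//; exfalso; lra.
Qed.

(** Almost everywhere the three indicators of [one_middle] sum to 1, and the three integrals
    obtained by inserting them agree by rotation. *)
Lemma integral_split (h : plane * plane -> \bar R) : measurable_fun setT h ->
  (forall v, 0 <= h v) -> (forall v, h (rotate v) = h v) ->
  \int[leb \x leb]_v h v =
  3%:E * \int[leb \x leb]_v (h v * (\1_(split_pairs x) v)%:E).
Proof.
move=> mh h0 hR; set s := (fun v => (\1_(split_pairs x) v)%:E : \bar R).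
have mR := measurable_rotate.
have ms : measurable_fun setT s.
  by apply/measurable_EFinP/measurable_indic; exact: measurable_split_pairs.
have s0 v : 0 <= s v by rewrite lee_fin.
have mhs : measurable_fun setT (fun v => h v * s v) by exact: emeasurable_funM.
have hs0 v : 0 <= h v * s v by exact: mule_ge0.
have hs1 v : h v * s (rotate v) = h (rotate v) * s (rotate v) by rewrite hR.
have hs2 v : h v * s (rotate (rotate v)) =
  h (rotate (rotate v)) * s (rotate (rotate v)) by rewrite !hR.
have I1 : \int[leb \x leb]_v (h v * s (rotate v)) = \int[leb \x leb]_v (h v * s v).
  under eq_integral do rewrite hs1.
  by rewrite (integral_rotate mhs).
have m1 : measurable_fun setT (fun v => h v * s (rotate v)).
  by apply: emeasurable_funM => //; exact: measurableT_comp.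
have m2 : measurable_fun setT (fun v => h v * s (rotate (rotate v))).
  apply: emeasurable_funM => //; apply: measurableT_comp => //.
  exact: measurableT_comp.
have I2 : \int[leb \x leb]_v (h v * s (rotate (rotate v))) = \int[leb \x leb]_v (h v * s v).
  rewrite -I1 -(integral_rotate m1); last by move=> v; exact: mule_ge0.
  by apply: eq_integral => v _; rewrite hR.
transitivity (\int[leb \x leb]_v (h v * s v + h v * s (rotate v) + h v * s (rotate (rotate v)))).
  apply: ge0_ae_eq_integral => //.
  - by apply: emeasurable_funD => //; exact: emeasurable_funD.
  - by move=> v _; rewrite !adde_ge0// mule_ge0.
  exists degenerate; split=> //.
  move=> v; apply: contraPP => /one_middle e /= nh; apply: nh => _.
  by rewrite -!ge0_muleDr ?adde_ge0// e mule1.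
rewrite ge0_integralD//; last 3 first.
- by move=> v _; rewrite adde_ge0// mule_ge0.
- exact: emeasurable_funD.
- by move=> v _; exact: mule_ge0.
rewrite ge0_integralD//; last by move=> v _; exact: mule_ge0.
rewrite I1 I2 (_ : 3%:E = 1 + 1 + 1 :> \bar R); last by rewrite -!EFinD; congr _%:E; ring.
by rewrite !ge0_muleDl ?mul1e// adde_ge0.
Qed.

End triangle_symmetry.

(** * Localization at a Lebesgue point *)

(** The [k]-th power is [k]-Lipschitz on [[0, 1]]: this carries an error on the probability to miss
    a disc over to all samples at once. *)
Lemma le_exprn_dist (R : realFieldType) (p q e : R) k :
  0 <= p <= 1 -> 0 <= q <= 1 -> 0 <= e -> p <= q + e -> p ^+ k <= q ^+ k + k%:R * e.
Proof.
move=> /andP[p0 p1] /andP[q0 q1] e0 pq; elim: k => [|k ih].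
  by rewrite !expr0 mul0r addr0.
rewrite !exprS -natr1 mulrDl mul1r.
have qk0 : 0 <= q ^+ k by exact: exprn_ge0.
have qk1 : q ^+ k <= 1 by exact: exprn_ile1.
have ke : 0 <= k%:R * e by rewrite mulr_ge0.
have h1 : p * p ^+ k <= p * (q ^+ k + k%:R * e) by rewrite ler_wpM2l.
have h2 : p * (k%:R * e) <= k%:R * e by rewrite ler_piMl.
have h3 : p * q ^+ k <= (q + e) * q ^+ k by rewrite ler_wpM2r.
have h4 : e * q ^+ k <= e by rewrite ler_piMr.
lra.
Qed.

(** * Replacing the density by its value at the point *)

Section density_comparison.
Local Open Scope ereal_scope.
Context d (E : measurableType d) (R : realType).
Variables (leb : {sigma_finite_measure set E -> \bar R}) (mu : probability E R).
Variables (f : E -> R) (a : R) (B : set E) (eps : R).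
Hypotheses (mf : measurable_fun setT f) (f0 : forall u, (0 <= f u)%R).
Hypothesis muE : forall A, measurable A -> mu A = \int[leb]_(u in A) (f u)%:E.
Hypotheses (a0 : (0 <= a)%R) (mB : measurable B).
Hypothesis epsP : \int[leb]_(u in B) `|f u - a|%:E <= eps%:E.

Let mfa : measurable_fun setT (fun u => `|f u - a|%R).
Proof. by apply: measurableT_comp => //; exact: measurable_funB. Qed.

Let eps_indic : \int[leb]_u (`|f u - a| * \1_B u)%:E <= eps%:E.
Proof.
rewrite (_ : \int[leb]_u _ = \int[leb]_(u in B) `|f u - a|%:E)//.
rewrite [RHS]integral_mkcond; apply: eq_integral => u _.
by rewrite /patch indicE; case: ifPn; rewrite ?mulr1 ?mulr0.
Qed.

Lemma eps_ge0 : (0 <= eps)%R.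
Proof. by rewrite -lee_fin; apply: le_trans epsP; apply: integral_ge0. Qed.

Section one_variable.
Variables (G : E -> \bar R) (M : R).
Hypotheses (mG : measurable_fun setT G) (G0 : forall u, 0 <= G u)
  (GM : forall u, G u <= (M * \1_B u)%:E) (M0 : (0 <= M)%R).

Let mGM : measurable_fun setT (fun u => (M * (`|f u - a| * \1_B u))%:E).
Proof. by apply/measurable_EFinP; do 2 apply: measurable_funM => //. Qed.

Let int_M : \int[leb]_u (M * (`|f u - a| * \1_B u))%:E <= (M * eps)%:E.
Proof.
under eq_integral do rewrite EFinM.
rewrite ge0_integralZl_EFin//; last first.
  by apply/measurable_EFinP; exact: measurable_funM.
by rewrite EFinM lee_wpmul2l ?lee_fin.
Qed.

Let maG : measurable_fun setT (fun u => a%:E * G u).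
Proof. exact: emeasurable_funM. Qed.

Let aG0 u : 0 <= a%:E * G u. Proof. by rewrite mule_ge0. Qed.

Let mGf : measurable_fun setT (fun u => G u * (f u)%:E).
Proof. by apply: emeasurable_funM => //; exact/measurable_EFinP. Qed.

Let Gf0 u : 0 <= G u * (f u)%:E. Proof. by rewrite mule_ge0// lee_fin. Qed.

Let GM0 u : 0 <= (M * (`|f u - a| * \1_B u))%:E.
Proof. by rewrite lee_fin !mulr_ge0. Qed.

(** The difference of the two measures has density [f - a], of integral at most [eps] over [B] in
    absolute value, while [G] is at most [M] and vanishes off [B]. *)
Lemma le_integral_density :
  \int[mu]_u G u <= a%:E * \int[leb]_u G u + (M * eps)%:E.
Proof.
rewrite (ge0_integral_density mf f0 muE mG G0) -ge0_integralZl_EFin//.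
apply: le_trans (leeD2l _ int_M).
rewrite -ge0_integralD//; apply: ge0_le_integral => //.
  exact: emeasurable_funD.
move=> u _; have := GM u; have := G0 u; case: (G u) => [g| |]//.
rewrite lee_fin => g0; rewrite lee_fin => gM; rewrite lee_fin.
have h : (g * (f u - a) <= g * `|f u - a|)%R by rewrite ler_wpM2l// ler_norm.
have h' : (g * `|f u - a| <= M * \1_B u * `|f u - a|)%R by rewrite ler_wpM2r.
lra.
Qed.

Lemma ge_integral_density :
  a%:E * \int[leb]_u G u <= \int[mu]_u G u + (M * eps)%:E.
Proof.
rewrite (ge0_integral_density mf f0 muE mG G0) -ge0_integralZl_EFin//.
apply: le_trans (leeD2l _ int_M).
rewrite -ge0_integralD//; apply: ge0_le_integral => //.
  exact: emeasurable_funD.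
move=> u _; have := GM u; have := G0 u; case: (G u) => [g| |]//.
rewrite lee_fin => g0; rewrite lee_fin => gM; rewrite lee_fin.
have h : (g * (a - f u) <= g * `|f u - a|)%R by rewrite ler_wpM2l// distrC ler_norm.
have h' : (g * `|f u - a| <= M * \1_B u * `|f u - a|)%R by rewrite ler_wpM2r.
lra.
Qed.

End one_variable.

Lemma measure_density_close A : measurable A -> A `<=` B ->
  mu A <= a%:E * leb A + eps%:E /\ a%:E * leb A <= mu A + eps%:E.
Proof.
move=> mA AB.
have mG : measurable_fun setT (fun u => (\1_A u)%:E : \bar R).
  exact/measurable_EFinP/measurable_indic.
have G0 u : 0 <= (\1_A u)%:E :> \bar R by rewrite lee_fin.
have GM u : (\1_A u)%:E <= (1 * \1_B u)%:E :> \bar R.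
  rewrite mul1r lee_fin !indicE.
  by have [/set_mem/AB/mem_set ->|_] := boolP (u \in A).
have := le_integral_density mG G0 GM ler01.
have := ge_integral_density mG G0 GM ler01.
by rewrite !integral_indic// !setIT mul1r.
Qed.

Variables (beta m : R).
Hypotheses (lebB : leb B <= beta%:E) (muB : mu B <= m%:E).

Let beta0 : (0 <= beta)%R.
Proof. by rewrite -lee_fin; apply: le_trans lebB. Qed.

Let m0 : (0 <= m)%R.
Proof. by rewrite -lee_fin; apply: le_trans muB. Qed.

Let e0 := eps_ge0.

Section two_variables.
Variable F : E * E -> \bar R.
Hypotheses (mF : measurable_fun setT F) (F0 : forall v, 0 <= F v)
  (FB : forall v, F v <= (\1_B v.1 * \1_B v.2)%:E).

Let mFy y : measurable_fun setT (fun z => F (y, z)).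
Proof. by apply: measurableT_comp => //; exact: measurable_fun_pair. Qed.

Let K y := \int[leb]_z F (y, z).
Let K' y := \int[mu]_z F (y, z).

Let mK : measurable_fun setT K.
Proof. exact: (measurable_fun_fubini_tonelli_F (m2 := leb) F). Qed.

Let mK' : measurable_fun setT K'.
Proof. exact: (measurable_fun_fubini_tonelli_F (m2 := mu) F). Qed.

Let K0 y : 0 <= K y. Proof. exact: integral_ge0. Qed.
Let K'0 y : 0 <= K' y. Proof. exact: integral_ge0. Qed.

Let KB (nu : {measure set E -> \bar R}) (b : R) : nu B <= b%:E ->
  forall y, \int[nu]_z F (y, z) <= (b * \1_B y)%:E.
Proof.
move=> nB y.
apply: (@le_trans _ _ (\int[nu]_z ((\1_B y)%:E * (\1_B z)%:E))).
  apply: ge0_le_integral => //.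
  by apply/measurable_EFinP; exact: measurable_funM.
rewrite ge0_integralZl_EFin//; last exact/measurable_EFinP.
rewrite integral_indic// setIT (mulrC b) EFinM.
by rewrite lee_wpmul2l// lee_fin.
Qed.

Let int_indic (nu : {measure set E -> \bar R}) (b : R) : nu B <= b%:E ->
  \int[nu]_y (\1_B y * eps)%:E <= (b * eps)%:E.
Proof.
move=> nB; under eq_integral do rewrite EFinM.
rewrite ge0_integralZr//; last exact/measurable_EFinP.
by rewrite integral_indic// setIT EFinM lee_wpmul2r// lee_fin.
Qed.

Let mi : measurable_fun setT (fun y => (\1_B y * eps)%:E : \bar R).
Proof. by apply/measurable_EFinP; exact: measurable_funM. Qed.

Let i0 y : 0 <= (\1_B y * eps)%:E. Proof. by rewrite lee_fin mulr_ge0. Qed.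

Let maK : measurable_fun setT (fun y => a%:E * K y).
Proof. exact: emeasurable_funM. Qed.

Let aK0 y : 0 <= a%:E * K y. Proof. by rewrite mule_ge0. Qed.

(** One variable at a time. In the second variable the cost is [eps] for each [y] in [B], in total
    [m * eps]; in the first one it is [beta * eps], because the inner integral is at most [beta],
    and this is multiplied by [a]. *)
Lemma le_integral2_density : \int[mu \x mu]_v F v <=
  (a ^+ 2)%:E * \int[leb \x leb]_v F v + (a * beta * eps + m * eps)%:E.
Proof.
rewrite !fubini_tonelli1// /fubini_F -/K -/K'.
apply: (@le_trans _ _ (\int[mu]_y (a%:E * K y + (\1_B y * eps)%:E))).
  apply: ge0_le_integral => //; [by move=> y _; exact: K'0|exact: emeasurable_funD|].
  by move=> y _; apply: le_integral_density => // z; exact: FB.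
rewrite ge0_integralD// ge0_integralZl_EFin//.
rewrite (EFinD (a * beta * eps)) [leRHS]addeA; apply: leeD; last exact: (@int_indic mu m muB).
apply: (@le_trans _ _ (a%:E * (a%:E * \int[leb]_y K y + (beta * eps)%:E))).
  by rewrite lee_wpmul2l//; apply: le_integral_density => //; exact: (@KB leb beta lebB).
rewrite ge0_muleDr//; last 2 first.
- by rewrite mule_ge0// integral_ge0.
- by rewrite lee_fin mulr_ge0.
by rewrite muleA -EFinM -expr2 -EFinM mulrA.
Qed.

Lemma ge_integral2_density : (a ^+ 2)%:E * \int[leb \x leb]_v F v <=
  \int[mu \x mu]_v F v + (a * beta * eps + m * eps)%:E.
Proof.
rewrite !fubini_tonelli1// /fubini_F -/K -/K'.
rewrite expr2 EFinM -muleA -ge0_integralZl_EFin//; last by move=> y _; exact: K0.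
apply: (@le_trans _ _ (a%:E * \int[leb]_y (K' y + (\1_B y * eps)%:E))).
  rewrite lee_wpmul2l//; apply: ge0_le_integral => //; [by move=> y _; exact: aK0|exact: emeasurable_funD|].
  by move=> y _; apply: ge_integral_density => // z; exact: FB.
rewrite ge0_integralD//.
rewrite ge0_muleDr ?integral_ge0//.
rewrite (EFinD (a * beta * eps)) [leRHS]addeCA [leRHS]addeC; apply: leeD.
  by apply: ge_integral_density => //; exact: (@KB mu m muB).
by rewrite -mulrA EFinM lee_wpmul2l//; exact: (@int_indic leb beta lebB).
Qed.

End two_variables.

Section void_comparison.
Variables (S : set (E * E)) (D : set ((E * E) * E)).
Hypotheses (mS : measurable S) (mD : measurable D).
Hypothesis SB : forall v, S v -> [/\ B v.1, B v.2 & xsection D v `<=` B].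

(** Truncated so as to stay in [[0, 1]], where powers are Lipschitz. The truncation does not spoil
    the comparison with [miss_proba], because [mu] is at most 1. *)
Definition local_miss v : R := (1 - Num.min 1 (a * fine (leb (xsection D v))))%R.

Definition local_void k v : \bar R := (local_miss v ^+ k * \1_S v)%:E.

Let lambda v := fine (leb (xsection D v)).

Let lambda0 v : (0 <= lambda v)%R. Proof. by rewrite fine_ge0. Qed.

Let local_miss01 v : (0 <= local_miss v <= 1)%R.
Proof.
have h0 : (0 <= Num.min 1 (a * lambda v))%R by rewrite le_min ler01 mulr_ge0.
have h1 : (Num.min 1 (a * lambda v) <= 1)%R by rewrite ge_min lexx.
by rewrite /local_miss -/(lambda v); apply/andP; split; lra.
Qed.

Let miss01 v : (0 <= miss_proba mu D v <= 1)%R.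
Proof.
rewrite miss_proba_ge0//= -lee_fin miss_probaE//.
by rewrite -[leRHS]sube0; apply: leeB.
Qed.

Let mlocal : measurable_fun setT local_miss.
Proof.
apply: measurable_funB => //; apply: measurable_minr => //; apply: measurable_funM => //.
by apply: measurableT_comp => //; exact: measurable_fun_xsection.
Qed.

Let close v : S v -> (miss_proba mu D v <= local_miss v + eps)%R /\
  (local_miss v <= miss_proba mu D v + eps)%R.
Proof.
move=> Sv; have [_ _ DB] := SB Sv; set A := xsection D v in DB.
have mA : measurable A by exact: measurable_xsection.
have lA : leb A = (lambda v)%:E.
  rewrite /lambda -/A fineK// ge0_fin_numE//.
  by rewrite (@le_lt_trans _ _ (leb B)) ?le_measure ?inE// (le_lt_trans lebB) ?ltry.
have mE : mu A = (1 - miss_proba mu D v)%:E.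
  have fA : mu A \is a fin_num by exact: fin_num_measure.
  have [->] : (miss_proba mu D v)%:E = (1 - fine (mu A))%:E.
    by rewrite miss_probaE// EFinB fineK.
  by rewrite subKr fineK.
have [] := measure_density_close mA DB.
rewrite lA mE -EFinM -!EFinD !lee_fin.
rewrite /local_miss -/(lambda v) => h1 h2.
have /andP[m1 m2] := miss01 v.
by have [h|h] := leP 1%R (a * lambda v)%R; split; lra.
Qed.

Let mlv k : measurable_fun setT (local_void k).
Proof. by apply/measurable_EFinP; apply: measurable_funM => //; exact: measurable_funX. Qed.

Let lv0 k v : 0 <= local_void k v.
Proof. by rewrite lee_fin mulr_ge0// exprn_ge0//; case/andP: (local_miss01 v). Qed.

Let lvB k v : local_void k v <= (\1_B v.1 * \1_B v.2)%:E.
Proof.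
rewrite lee_fin indicE; have [/set_mem Sv|_] := boolP (v \in S); last by rewrite mulr0 mulr_ge0.
have [B1 B2 _] := SB Sv; rewrite !indicE !mem_set// !mulr1.
by apply: exprn_ile1; case/andP: (local_miss01 v).
Qed.

Let mvv k : measurable_fun setT (fun v => (miss_proba mu D v ^+ k * \1_S v)%:E : \bar R).
Proof.
apply/measurable_EFinP; apply: measurable_funM => //; apply: measurable_funX.
exact: measurable_miss_proba.
Qed.

Let vv0 k v : 0 <= (miss_proba mu D v ^+ k * \1_S v)%:E.
Proof. by rewrite lee_fin mulr_ge0// exprn_ge0// miss_proba_ge0. Qed.

Let void_indic n : void_integral mu S D n =
  \int[mu \x mu]_v (miss_proba mu D v ^+ (n - 2) * \1_S v)%:E.
Proof.
rewrite /void_integral integral_mkcond; apply: eq_integral => v _.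
by rewrite /patch indicE; case: ifPn; rewrite ?mulr1 ?mulr0.
Qed.

Let mu2S c : (0 <= c)%R -> \int[mu \x mu]_v (c * \1_S v)%:E <= (c * m ^+ 2)%:E.
Proof.
move=> c0; under eq_integral do rewrite EFinM.
rewrite ge0_integralZl_EFin//; last exact/measurable_EFinP/measurable_indic.
rewrite integral_indic// setIT EFinM lee_wpmul2l//.
apply: (@le_trans _ _ ((mu \x mu) (B `*` B))).
  rewrite le_measure ?inE//; first exact: measurableX.
  by move=> v /SB[].
by rewrite product_measure1E// expr2 EFinM lee_pmul.
Qed.

Let mc c : measurable_fun setT (fun v => (c * \1_S v)%:E : \bar R).
Proof. by apply/measurable_EFinP; apply: measurable_funM => //; exact: measurable_indic. Qed.

(** The first term is the cost of the [k]-th power over the pairs in [B], the second that of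
    replacing [mu] in both variables of integration. *)
Definition void_error k : R := (k%:R * eps * m ^+ 2 + (a * beta * eps + m * eps))%R.

Lemma le_void_integral n : void_integral mu S D n <=
  (a ^+ 2)%:E * \int[leb \x leb]_v local_void (n - 2) v + (void_error (n - 2))%:E.
Proof.
set k := (n - 2)%N; have ke : (0 <= k%:R * eps)%R by rewrite mulr_ge0.
rewrite /void_error EFinD [in leRHS]addeCA [leRHS]addeC.
apply: (@le_trans _ _ (\int[mu \x mu]_v (local_void k v + (k%:R * eps * \1_S v)%:E))).
  rewrite void_indic; apply: ge0_le_integral => //.
    exact: emeasurable_funD.
  move=> v _; rewrite -EFinD lee_fin indicE.
  have [/set_mem Sv|_] := boolP (v \in S); last by rewrite !mulr0 addr0.
  by rewrite !mulr1; apply: le_exprn_dist => //; case: (close Sv).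
rewrite ge0_integralD//; last by move=> v _; rewrite lee_fin mulr_ge0.
by apply: leeD; [exact: le_integral2_density|exact: mu2S].
Qed.

Lemma ge_void_integral n : (a ^+ 2)%:E * \int[leb \x leb]_v local_void (n - 2) v <=
  void_integral mu S D n + (void_error (n - 2))%:E.
Proof.
set k := (n - 2)%N; have ke : (0 <= k%:R * eps)%R by rewrite mulr_ge0.
apply: (le_trans (ge_integral2_density (mlv k) (lv0 k) (lvB k))).
rewrite /void_error (EFinD (k%:R * eps * m ^+ 2)) [leRHS]addeA.
apply: leeD => //.
apply: (@le_trans _ _ (\int[mu \x mu]_v ((miss_proba mu D v ^+ k * \1_S v)%:E + (k%:R * eps * \1_S v)%:E))).
  apply: ge0_le_integral => //.
    exact: emeasurable_funD.
  move=> v _; rewrite -EFinD lee_fin indicE.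
  have [/set_mem Sv|_] := boolP (v \in S); last by rewrite !mulr0 addr0.
  by rewrite !mulr1; apply: le_exprn_dist => //; case: (close Sv).
rewrite ge0_integralD//; last by move=> v _; rewrite lee_fin mulr_ge0.
by rewrite -void_indic; apply: leeD => //; exact: mu2S.
Qed.

End void_comparison.
End density_comparison.

(** * Circumcircles under rotation of the triangle *)

Section circumcircle_symmetry.
Context {R : realType}.
Implicit Types (x p q c : R * R).

Lemma circumcenter_equidistant x p q : cross (p - x) (q - x) != 0 ->
  enorm (circumcenter x p q - x) = enorm (circumcenter x p q - p) /\
  enorm (circumcenter x p q - x) = enorm (circumcenter x p q - q).
Proof.
by move=> c0; split; apply/eqP; rewrite eq_bisector /circumcenter
  ?dot_line_meetl ?dot_line_meetr.
Qed.

Lemma circumcenter_uniq x p q c : cross (p - x) (q - x) != 0 ->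
  enorm (c - x) = enorm (c - p) -> enorm (c - x) = enorm (c - q) ->
  c = circumcenter x p q.
Proof.
move=> c0 /eqP + /eqP; rewrite !eq_bisector => /eqP h1 /eqP h2.
exact: line_meet_uniq.
Qed.

Variable x : R * R.
Implicit Type v : (R * R) * (R * R).

Lemma cross_rotate v : cross ((rotate x v).1 - x) ((rotate x v).2 - x) =
  cross (v.1 - x) (v.2 - x).
Proof. by rewrite /cross /rotate /=; ring. Qed.

(** The circumcenter follows the translation by [x - v.1]: the shifted center is equidistant from
    the shifted vertices, hence it is the new circumcenter. *)
Lemma circumradius_rotate v : cross (v.1 - x) (v.2 - x) != 0 ->
  circumradius x (rotate x v).1 (rotate x v).2 = circumradius x v.1 v.2.
Proof.
move=> c0; have [e1 e2] := circumcenter_equidistant c0.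
set c := circumcenter x v.1 v.2 in e1 e2.
have s1 : c + (x - v.1) - x = c - v.1.
  by apply: injective_projections => /=; ring.
have s2 : c + (x - v.1) - (rotate x v).1 = c - v.2.
  by apply: injective_projections; rewrite /rotate /=; ring.
have s3 : c + (x - v.1) - (rotate x v).2 = c - x.
  by apply: injective_projections; rewrite /rotate /=; ring.
rewrite /circumradius -(@circumcenter_uniq x _ _ (c + (x - v.1))).
- by rewrite s1 -e1.
- by rewrite cross_rotate.
- by rewrite s1 s2 -e1 -e2.
- by rewrite s1 s3 -e1.
Qed.

Lemma ccw_pairs_rotate (r : R) v : ccw_pairs x r (rotate x v) <-> ccw_pairs x r v.
Proof.
rewrite /ccw_pairs /= cross_rotate; split=> -[c h]; split=> //; move: h;
  by rewrite circumradius_rotate// gt_eqF.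
Qed.

Local Open Scope ereal_scope.

(** The integrand depends only on the orientation and the circumradius, which [rotate] preserves.
    With [mu] in place of Lebesgue measure this would fail, since the mass of a disc depends on its
    position. *)
Lemma integral_local_void (a r : R) k :
  \int[plane_leb \x plane_leb]_v
    local_void plane_leb a (ccw_pairs x r) (circumdisc_graph x) k v =
  3%:E * \int[plane_leb \x plane_leb]_v
    local_void plane_leb a (ccw_pairs x r `&` split_pairs x) (circumdisc_graph x) k v.
Proof.
set h := local_void _ _ (ccw_pairs x r) _ k.
have mh : measurable_fun setT h.
  apply/measurable_EFinP; apply: measurable_funM.
    apply: measurable_funX; apply: measurable_funB => //; apply: measurable_minr => //.
    apply: measurable_funM => //; apply: measurableT_comp => //.
    apply: measurable_fun_xsection; exact: measurable_circumdisc_graph.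
  by apply: measurable_indic; exact: measurable_ccw_pairs.
have h0 v : 0 <= h v.
  rewrite lee_fin mulr_ge0// exprn_ge0// /local_miss subr_ge0.
  by rewrite ge_min lexx.
rewrite (@integral_split R x h)//; last first.
  move=> v; congr _%:E.
  have -> : \1_(ccw_pairs x r) (rotate x v) = \1_(ccw_pairs x r) v :> R.
    rewrite !indicE; congr (_ : bool)%:R.
    by apply/idP/idP => /set_mem h1; apply/mem_set; exact/ccw_pairs_rotate.
  have [[c _]|nS] := pselect (ccw_pairs x r v); last first.
    have -> : \1_(ccw_pairs x r) v = 0%R :> R by rewrite indicE memNset.
    by transitivity (0%R : R); [exact: mulr0|exact/esym/mulr0].
  have E : plane_leb (xsection (circumdisc_graph x) (rotate x v)) =
      plane_leb (xsection (circumdisc_graph x) v).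
    have c0 : cross (v.1 - x)%R (v.2 - x)%R != 0%R by rewrite gt_eqF.
    rewrite (xsection_circumdisc x (rotate x v)) (xsection_circumdisc x v).
    rewrite /circumdisc (circumradius_rotate c0).
    exact: plane_leb_eball.
  exact: (congr1 (fun t => (1 - Num.min 1 (a * fine t)) ^+ k * \1_(ccw_pairs x r) v)%R E).
congr (_ * _); apply: eq_integral => v _.
rewrite /h /local_void -EFinM; congr _%:E; rewrite -mulrA; congr (_ * _)%R.
by rewrite -[RHS]/(\1_(ccw_pairs x r `&` split_pairs x) v) indicI.
Qed.

End circumcircle_symmetry.

(** * Mass of balls and squares at a Lebesgue point *)

Section lebesgue_point.
Context {R : realType}.
Variables (f : R * R -> R) (x : R * R).
Hypotheses (f_pdf : is_pdf f) (x_leb : lebesgue_pt2 f x).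
Local Notation plane := (R * R)%type.

Lemma pdf_measurable : measurable_fun setT f.
Proof. by case: f_pdf. Qed.

Lemma pdf_ge0 p : 0 <= f p.
Proof. by case: f_pdf. Qed.

Lemma quarter_sub_eball e (s : R) : quarter e x s `<=` eball x s.
Proof.
move=> p [h1 h2]; rewrite /eball /=.
have s0 : 0 < s by move: h1 => /andP[? ?]; lra.
rewrite enorm_lt ?(ltW s0)//.
have sq (b : bool) (t : R) : t ^+ 2 = ((-1) ^+ b * t) ^+ 2.
  by rewrite exprMn sqrr_sign mul1r.
rewrite /dot -!expr2 /= (sq e.1 (p.1 - x.1)) (sq e.2 (p.2 - x.2)).
move: h1 h2; set t1 := (_ ^+ e.1 * _); set t2 := (_ ^+ e.2 * _).
move=> /andP[? ?] /andP[? ?].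
have a4 : t1 ^+ 2 < s * s / 4 by nra.
have a5 : t2 ^+ 2 < s * s / 4 by nra.
nra.
Qed.

(** Removes the normalization by the area of the ball. The circumscribed square bounds this area by
    [4 * r ^+ 2], whence [eta / 4]; a square inside makes it positive, so that the inverse is not a
    default value. *)
Lemma lebesgue_pt2_eps (eta : R) : 0 < eta -> exists2 r0, 0 < r0 &
  forall r, 0 < r < r0 ->
    (\int[plane_leb]_(u in eball x r) `|f u - f x|%:E <= (eta * r ^+ 2)%:E)%E.
Proof.
move=> eta0; have e4 : 0 < eta / 4 by rewrite divr_gt0.
have : \forall r \near (0 : R)^'+, ((fine (lebesgue2 (eball x r)))^-1%:E *
    \int[lebesgue2]_(u in eball x r) `|f u - f x|%:E < (eta / 4)%:E)%E.
  have : nbhs (0 : \bar R)%E [set y | (y < (eta / 4)%:E)%E].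
    by apply: open_nbhs_nbhs; split; [exact: open_ereal_lt_ereal|rewrite /= lte_fin].
  by move/x_leb.
move=> [/= r0 r00 h]; exists r0 => // r /andP[rpos rlt].
have := h r; rewrite /ball_/= sub0r normrN gtr0_norm// => /(_ rlt rpos).
rewrite -/(plane_leb (eball x r)).
have mn : measurable_fun (eball x r) (fun u => `|f u - f x|%:E).
  apply: measurable_funTS; apply/measurable_EFinP; apply: measurableT_comp => //.
  by apply: measurable_funB => //; exact: pdf_measurable.
rewrite integral_lebesgue2//; last exact: measurable_eball.
set I := (\int[_]_(_ in _) _)%E => hI.
have I0 : (0 <= I)%E by apply: integral_ge0 => u _; rewrite lee_fin.
have q0 : (plane_leb (quarter (true, true) x r) <= plane_leb (eball x r))%E.
  apply: le_measure; rewrite ?inE; [exact: measurable_quarter|exact: measurable_eball|].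
  exact: quarter_sub_eball.
have l4 := plane_leb_eball_le x (ltW rpos).
have [l lE] : exists l, plane_leb (eball x r) = l%:E.
  by exists (fine (plane_leb (eball x r))); rewrite fineK// ge0_fin_numE// (le_lt_trans l4) ?ltry.
move: q0 l4 hI; rewrite -/(plane_leb (eball x r)) (plane_leb_quarter _ _ (ltW rpos)) lE.
rewrite lee_fin => q0; rewrite lee_fin => l4 /= hI.
have l0 : 0 < l by apply: lt_le_trans q0; rewrite divr_gt0// exprn_gt0.
have [i iE] : exists i, I = i%:E.
  move: I0 hI; case: I => [i| |]//; first by exists i.
  by rewrite mulry gtr0_sg ?invr_gt0// mul1e.
move: hI; rewrite iE -EFinM lte_fin lee_fin mulrC ltr_pdivrMr// => hI.
apply: (le_trans (ltW hI)); have : eta / 4 * l <= eta / 4 * (4 * r ^+ 2) by rewrite ler_wpM2l// ltW.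
lra.
Qed.

Variable mu : probability plane R.
Hypothesis muE : forall A, measurable A ->
  mu A = (\int[plane_leb]_(u in A) (f u)%:E)%E.

Lemma pdf_null A : measurable A -> plane_leb A = 0%E -> mu A = 0%E.
Proof.
move=> mA A0; rewrite muE//.
rewrite (@ge0_negligible_integral _ _ _ plane_leb A A)//.
- by rewrite setDv integral_set0.
- by apply: measurable_funTS; apply/measurable_EFinP; exact: pdf_measurable.
- by move=> u _; rewrite lee_fin pdf_ge0.
Qed.

Lemma mu_eball_le : exists2 C, 0 <= C & forall r, 0 <= r ->
  (mu (eball x r) <= (C * r ^+ 2)%:E)%E.
Proof.
have [r0 r00 h] := lebesgue_pt2_eps ltr01.
have fx0 := pdf_ge0 x.
(* The part [4 * f x + 1] serves for [r < r0]; for [r >= r0] a probability is at most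
   [1 <= r0 ^- 2 * r ^+ 2]. *)
have C0 : 0 <= 4 * f x + 1 + r0 ^- 2.
  by rewrite !addr_ge0 ?mulr_ge0// invr_ge0 sqr_ge0.
exists (4 * f x + 1 + r0 ^- 2) => // r; rewrite le_eqVlt => /predU1P[<-|rpos].
  rewrite expr0n mulr0 (_ : eball x 0 = set0) ?measure0//.
  by apply/seteqP; split=> q //=; rewrite /eball /= ltNge enorm_ge0.
have [rr|rr] := ltP r r0.
  have hr : 0 < r < r0 by rewrite rpos.
  have [+ _] := measure_density_close pdf_measurable pdf_ge0 muE fx0
    (measurable_eball x r) (h r hr) (measurable_eball x r) (fun _ => id).
  move=> /le_trans; apply.
  apply: (@le_trans _ _ ((f x)%:E * (4 * r ^+ 2)%:E + (1 * r ^+ 2)%:E)%E).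
    by apply: leeD => //; rewrite lee_wpmul2l ?lee_fin// plane_leb_eball_le// ltW.
  rewrite -EFinM -EFinD lee_fin; have : 0 <= r0 ^- 2 * r ^+ 2.
    by rewrite mulr_ge0 ?invr_ge0 ?sqr_ge0.
  lra.
apply: (@le_trans _ _ 1%E); first by apply: probability_le1; exact: measurable_eball.
rewrite lee_fin; have : 1 <= r0 ^- 2 * r ^+ 2.
  by rewrite mulrC ler_pdivlMr ?exprn_gt0// mul1r ler_pXn2r// nnegrE ltW.
have : 0 <= (4 * f x + 1) * r ^+ 2 by rewrite mulr_ge0 ?sqr_ge0// addr_ge0// mulr_ge0.
lra.
Qed.

Lemma mu_quarter_ge : 0 < f x -> exists c s0, [/\ 0 < c, 0 < s0 &
  forall e s, 0 <= s <= s0 -> ((c * s ^+ 2)%:E <= mu (quarter e x s))%E].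
Proof.
move=> fx_gt0; have fx0 := pdf_ge0 x.
(* The square has area [s ^+ 2 / 16], so half of [f x * s ^+ 2 / 16] may be lost to the error. *)
have eta0 : 0 < f x / 32 by rewrite divr_gt0.
have [r0 r00 h] := lebesgue_pt2_eps eta0.
exists (f x / 32), (r0 / 2); split=> //; first by rewrite divr_gt0.
move=> e s /andP[]; rewrite le_eqVlt => /predU1P[<-|s0 sr].
  by rewrite expr0n mulr0.
have hs : 0 < s < r0 by rewrite s0; lra.
have [_] := measure_density_close pdf_measurable pdf_ge0 muE fx0
  (measurable_eball x s) (h s hs) (measurable_quarter e x s) (@quarter_sub_eball e s).
rewrite [X in ((f x)%:E * X)%E](plane_leb_quarter e x (ltW s0)) -EFinM.
have : mu (quarter e x s) \is a fin_num.
  by apply: fin_num_measure; exact: measurable_quarter.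
move=> /fineK <-; rewrite -EFinD !lee_fin; lra.
Qed.

End lebesgue_point.

(** * Second moment *)

Section polynomial_decay.
Context {R : realType}.

Lemma exprn_decay (t : R) n : 0 <= t <= 1 -> (1 - t) ^+ n * (1 + n%:R * t) <= 1.
Proof.
move=> /andP[t0 t1]; elim: n => [|k ih]; first by rewrite expr0 mul0r addr0 mulr1.
rewrite exprS -natr1; apply: le_trans ih.
have -> : (1 - t) * (1 - t) ^+ k * (1 + (k%:R + 1) * t) =
  (1 - t) ^+ k * ((1 - t) * (1 + (k%:R + 1) * t)) by ring.
rewrite ler_wpM2l ?exprn_ge0 ?subr_ge0//.
have : 0 <= k%:R * t by rewrite mulr_ge0.
have : 0 <= (k%:R * t) * t by rewrite !mulr_ge0.
nra.
Qed.

(** Fourth power of [exprn_decay], applied with a quarter of the exponent; [625] is [5 ^ 4], from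
    [1 + (m + 1) * t <= 5 * (1 + j * t)]. The annuli dictate the order 4: the pairs up to scale [k]
    have probability at most of order [k ^ 2], and [k ^ 2 / k ^ 4] is summable. *)
Lemma exprn_poly_decay (t : R) m : 0 <= t <= 1 ->
  (1 - t) ^+ m <= 625 / (1 + m.+1%:R * t) ^+ 4.
Proof.
move=> /andP[t0 t1]; pose j := (m %/ 4)%N.
have u0 : 0 <= 1 - t by rewrite subr_ge0.
have u1 : 1 - t <= 1 by rewrite gerBl.
have h0 : 0 <= j%:R * t by rewrite mulr_ge0.
have d0 : 0 <= m.+1%:R * t by rewrite mulr_ge0.
have hj : (1 - t) ^+ j * (1 + j%:R * t) <= 1 by apply: exprn_decay; rewrite t0.
have hm : (1 - t) ^+ m <= ((1 - t) ^+ j) ^+ 4.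
  rewrite -exprM; apply: ler_wiXn2l => //; exact: leq_trunc_div.
have hd : 1 + m.+1%:R * t <= 5 * (1 + j%:R * t).
  have : (m.+1 <= j * 4 + 4)%N.
    by rewrite {1}(divn_eq m 4) -addnS leq_add2l ltn_mod.
  rewrite -(ler_nat R) natrD natrM => hmj.
  have : m.+1%:R * t <= (j%:R * 4 + 4) * t by rewrite ler_wpM2r.
  lra.
rewrite ler_pdivlMr; last by rewrite exprn_gt0// ltr_pwDl.
apply: (@le_trans _ _ (((1 - t) ^+ j) ^+ 4 * (5 * (1 + j%:R * t)) ^+ 4)).
  apply: ler_pM => //; rewrite ?exprn_ge0// ?addr_ge0//.
  by rewrite ler_pXn2r// nnegrE ?mulr_ge0// addr_ge0.
rewrite -exprMn mulrCA exprMn.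
have -> : 625 = 5 ^+ 4 * 1 :> R by rewrite mulr1 -natrX.
rewrite ler_wpM2l// exprn_ile1// mulr_ge0 ?exprn_ge0// addr_ge0//.
Qed.

(** The stronger bound [2 - 1 / n] passes through the induction. *)
Lemma sum_inv_sqr_le n : \sum_(k < n) (k.+1%:R ^+ 2)^-1 <= 2 :> R.
Proof.
case: n => [|n]; first by rewrite big_ord0.
suff h : \sum_(k < n.+1) (k.+1%:R ^+ 2)^-1 <= 2 - n.+1%:R^-1 :> R.
  by apply: (le_trans h); rewrite gerBl.
elim: n => [|n ih].
  by rewrite big_ord_recr big_ord0 /= expr1n invr1; lra.
rewrite big_ord_recr /=; apply: (le_trans (lerD ih (lexx _))).
have n0 : 0 < n.+1%:R :> R by [].
have -> : n.+2%:R = n.+1%:R + 1 :> R by rewrite natr1.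
move: (n.+1%:R : R) n0 => u u0; rewrite -subr_ge0.
have -> : 2 - (u + 1)^-1 - (2 - u^-1 + ((u + 1) ^+ 2)^-1) = (u * (u + 1) ^+ 2)^-1.
  by field; rewrite !gt_eqF// ltr_wpDl// ltW.
by rewrite invr_ge0 mulr_ge0 ?sqr_ge0// ltW.
Qed.

End polynomial_decay.

(** * Pairs of samples with a void square *)

Section second_moment.
Context {R : realType}.
Local Notation plane := (R * R)%type.
Variables (mu : probability plane R) (x : plane) (C c s0 : R).
(* [625] in place of [A] would make [//] compute with unary numbers. *)
Variable A : R.
Hypotheses (A0 : 0 <= A) (decayP : forall t m, 0 <= t <= 1 ->
  (1 - t) ^+ m <= A / (1 + m.+1%:R * t) ^+ 4).
Hypotheses (C0 : 0 <= C) (c0 : 0 < c) (s00 : 0 < s0).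
Hypothesis ballP : forall r, 0 <= r -> (mu (eball x r) <= (C * r ^+ 2)%:E)%E.
Hypothesis quarterP : forall e s, 0 <= s <= s0 ->
  ((c * s ^+ 2)%:E <= mu (quarter e x s))%E.

Lemma farther_ge0 v : 0 <= farther x s0 v.
Proof.
by rewrite le_min (ltW s00) andbT divr_ge0// le_max enorm_ge0.
Qed.

Lemma farther_le v : farther x s0 v <= s0.
Proof. by rewrite ge_min lexx orbT. Qed.

(** The part [4 * C] is for two points in the ball of radius [2 * r]; the part [s0 ^- 2] makes the
    bound exceed 1 for [r > s0], where the cap makes every pair count. *)
Let C' := 4 * C + s0 ^- 2.

Let C'0 : 0 <= C'.
Proof. by rewrite addr_ge0 ?mulr_ge0// invr_ge0 sqr_ge0. Qed.

Let near r : set (plane * plane) := [set v | farther x s0 v < r].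

Let measurable_near r : measurable (near r).
Proof. by apply: measurable_lt_set => //; exact: measurable_farther. Qed.

Lemma mu2_farther r : 0 <= r ->
  ((mu \x mu) [set v | (farther x s0 v < r)%R] <= ((C' * r ^+ 2) ^+ 2)%:E)%E.
Proof.
move=> r0; have [rs|rs] := leP r s0.
  apply: (@le_trans _ _ ((mu \x mu) (eball x (2 * r)%R `*` eball x (2 * r)%R))%E).
    apply: le_measure; rewrite ?inE.
    - exact: measurable_near.
    - by apply: measurableX; exact: measurable_eball.
    move=> v; rewrite /= /farther gt_min [(s0 < r)%R]ltNge rs orbF.
    rewrite ltr_pdivrMr// gt_max => /andP[h1 h2].
    by split; rewrite /eball /= mulrC.
  rewrite product_measure1E ?expr2 ?EFinM; try exact: measurable_eball.
  have h : (mu (eball x (2 * r)) <= (C' * r ^+ 2)%:E)%E.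
    apply: (le_trans (ballP _)); first by rewrite mulr_ge0.
    rewrite lee_fin /C' exprMn (mulrDl (4 * C)).
    have : 0 <= s0 ^- 2 * r ^+ 2 by rewrite mulr_ge0 ?sqr_ge0// invr_ge0 sqr_ge0.
    lra.
  by rewrite expr2 -EFinM in h *; apply: lee_pmul.
apply: (@le_trans _ _ 1%E).
  apply: (@le_trans _ _ ((mu \x mu) (setT `*` setT))%E).
    by apply: le_measure; rewrite ?inE//; [exact: measurable_near|exact: measurableX].
  rewrite product_measure1E// [X in (X * _)%E](probability_setT mu).
  by rewrite [X in (_ * X)%E](probability_setT mu) mule1.
rewrite lee_fin exprn_ege1//.
have : 1 <= s0 ^- 2 * r ^+ 2.
  by rewrite mulrC ler_pdivlMr ?exprn_gt0// mul1r ler_pXn2r// ?nnegrE ?(ltW s00)// ltW.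
have : 0 <= C * r ^+ 2 by rewrite mulr_ge0 ?sqr_ge0.
rewrite /C'; lra.
Qed.

Let cs0 : c * s0 ^+ 2 <= 1.
Proof.
rewrite -lee_fin; apply: le_trans (quarterP (true, true) _) _; first by rewrite (ltW s00) lexx.
by apply: probability_le1; exact: measurable_quarter.
Qed.

Let t v := c * farther x s0 v ^+ 2.

Let t01 v : 0 <= t v <= 1.
Proof.
rewrite mulr_ge0 ?sqr_ge0 ?(ltW c0)//=; apply: le_trans cs0.
by rewrite ler_pM2l// ler_pXn2r ?nnegrE ?farther_ge0 ?farther_le ?(ltW s00).
Qed.

(** [farther] is below this radius exactly when [m.+1 * t v] is below [k.+1]. *)
Let radius (m k : nat) := Num.sqrt (k.+1%:R / (c * m.+1%:R)).

Let radius2 m k : radius m k ^+ 2 = k.+1%:R / (c * m.+1%:R).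
Proof. by rewrite sqr_sqrtr// divr_ge0// mulr_ge0// ltW. Qed.

Lemma miss_quarter_le e m v : miss_proba mu (quarter_graph e x s0) v ^+ m <=
  \sum_(k < m.+2) A / k.+1%:R ^+ 4 * \1_(near (radius m k)) v.
Proof.
have miss_le : miss_proba mu (quarter_graph e x s0) v <= 1 - t v.
  rewrite -lee_fin miss_probaE ?xsection_quarter; last exact: measurable_quarter_graph.
  by rewrite EFinB leeB// quarterP// farther_ge0 farther_le.
have miss0 : 0 <= miss_proba mu (quarter_graph e x s0) v.
  by apply: miss_proba_ge0; exact: measurable_quarter_graph.
have /andP[t0 t1] := t01 v.
(* The term [k = j] of the sum is at least the left-hand side. *)
pose j := Num.truncn (m.+1%:R * t v).
have d0 : 0 <= m.+1%:R * t v by rewrite mulr_ge0.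
have /andP[j1 j2] : j%:R <= m.+1%:R * t v < j.+1%:R by exact: truncn_itv.
have jm : (j < m.+2)%N.
  rewrite ltnS -(ler_nat R); apply: (le_trans j1).
  by rewrite ler_piMr.
apply: (@le_trans _ _ (A / (1 + m.+1%:R * t v) ^+ 4)).
  apply: le_trans (decayP m (t01 v)).
  by apply: lerXn2r; rewrite ?nnegrE// subr_ge0.
rewrite (bigD1 (Ordinal jm))//= -[leLHS]addr0; apply: lerD.
  rewrite indicE mem_set ?mulr1; last first.
    rewrite /near /= -(ltr_pXn2r (n := 2))// ?nnegrE ?farther_ge0 ?sqrtr_ge0//.
    rewrite radius2 ltr_pdivlMr ?mulr_gt0//.
    by rewrite mulrC -mulrA mulrCA.
  apply: ler_wpM2l; first by [].
  have jp : 0 < 1 + j%:R :> R by rewrite ltr_pwDl ?ler0n.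
  have tp : 0 < 1 + m.+1%:R * t v by rewrite ltr_pwDl.
  have -> : (nat_of_ord (Ordinal jm)).+1%:R = 1 + j%:R :> R by rewrite addrC natr1.
  rewrite lef_pV2; [|by rewrite posrE exprn_gt0|by rewrite posrE exprn_gt0].
  by apply: lerXn2r; rewrite ?nnegrE ?(ltW jp) ?(ltW tp)// lerD2l.
by apply: sumr_ge0 => k _; rewrite mulr_ge0// divr_ge0// exprn_ge0.
Qed.

Lemma void_quarter_moment : exists K, forall n e,
  ((n * (n - 1))%:R%:E * void_integral mu setT (quarter_graph e x s0) n <= K%:E)%E.
Proof.
(* The factor 4 leaves room for the ratio [n / (n - 1)], the 2 bounds the sum of inverse squares,
   and [(C' / c) ^+ 2] is [mu2_farther] at the radii of the annuli. *)
exists (4 * ((2 * A) * (C' / c) ^+ 2)) => n e.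
have K0 : 0 <= 4 * (2 * A * (C' / c) ^+ 2) by rewrite !mulr_ge0 ?invr_ge0 ?(ltW c0).
case: n => [|[|m]]; [by rewrite mul0n mul0e lee_fin|
  by rewrite subnn muln0 mul0e lee_fin|].
have bound : (void_integral mu setT (quarter_graph e x s0) m.+2 <=
    ((2 * A) * (C' / c) ^+ 2 / m.+1%:R ^+ 2)%:E)%E.
  have mk k : measurable_fun setT
      (fun v => (A / k.+1%:R ^+ 4 * \1_(near (radius m k)) v)%:E : \bar R).
    by apply/measurable_EFinP; apply: measurable_funM => //; exact: measurable_indic.
  have pos k v : (0 <= (A / k.+1%:R ^+ 4 * \1_(near (radius m k)) v)%:E :> \bar R)%E.
    by rewrite lee_fin mulr_ge0// divr_ge0// exprn_ge0.
  apply: (@le_trans _ _ (\int[mu \x mu]_v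
      (\sum_(k < m.+2) (A / k.+1%:R ^+ 4 * \1_(near (radius m k)) v)%:E))%E).
    apply: ge0_le_integral => //.
    - by move=> v _; rewrite lee_fin exprn_ge0// miss_proba_ge0//; exact: measurable_quarter_graph.
    - apply/measurable_EFinP; apply: measurable_funX; apply: measurable_miss_proba.
      exact: measurable_quarter_graph.
    - by apply: emeasurable_sum => k; exact: mk.
    by move=> v _; rewrite sumEFin lee_fin subSS subn1 /=; exact: miss_quarter_le.
  rewrite ge0_integral_sum//.
  apply: (@le_trans _ _ (\sum_(k < m.+2)
      (A * ((C' / c) ^+ 2 / m.+1%:R ^+ 2) * (k.+1%:R ^+ 2)^-1)%:E)%E).
    apply: lee_sum => k _; under eq_integral do rewrite EFinM.
    rewrite ge0_integralZl_EFin//; last 2 first.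
    - exact/measurable_EFinP/measurable_indic.
    - by rewrite divr_ge0// exprn_ge0.
    rewrite integral_indic// setIT.
    apply: (@le_trans _ _ ((A / k.+1%:R ^+ 4)%:E * ((C' * radius m k ^+ 2) ^+ 2)%:E)%E).
      by rewrite lee_wpmul2l ?lee_fin ?divr_ge0 ?exprn_ge0//; apply: mu2_farther; exact: sqrtr_ge0.
    rewrite -EFinM lee_fin radius2.
    have k0 : k.+1%:R != 0 :> R by [].
    have m0 : m.+1%:R != 0 :> R by [].
    have c_neq0 : c != 0 by rewrite gt_eqF.
    rewrite le_eqVlt; apply/orP; left; apply/eqP.
    move: (m.+1%:R : R) (k.+1%:R : R) m0 k0 => N L m0 k0.
    by field; rewrite k0 m0 c_neq0.
  rewrite sumEFin -mulr_sumr lee_fin.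
  apply: (@le_trans _ _ (A * ((C' / c) ^+ 2 / m.+1%:R ^+ 2) * 2)).
    by rewrite ler_wpM2l ?sum_inv_sqr_le// !mulr_ge0 ?invr_ge0 ?exprn_ge0 ?(ltW c0).
  by rewrite le_eqVlt; apply/orP; left; apply/eqP; ring.
apply: (@le_trans _ _ (((m.+2 * (m.+2 - 1))%:R)%:E *
    ((2 * A) * (C' / c) ^+ 2 / m.+1%:R ^+ 2)%:E)%E).
  by rewrite lee_wpmul2l ?lee_fin.
rewrite -EFinM lee_fin mulrCA [leRHS]mulrC ler_wpM2l ?mulr_ge0 ?invr_ge0 ?(ltW c0)//.
rewrite ler_pdivrMr ?exprn_gt0// -natrX -natrM ler_nat subn1 /=.
rewrite expnS expn1 mulnA leq_mul2r mulSn -[m.+2]addn1 leq_add2l.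
by rewrite orbC muln_gt0.
Qed.

End second_moment.

(** * The sample is in general position *)

Section unmeasurable_integral.
Local Open Scope ereal_scope.
Context d (T : measurableType d) (R : realType) (m : {measure set T -> \bar R}).
Implicit Types f g : T -> \bar R.

(** A simple function below [f] is below [g], and the integral is the supremum over such
    functions. *)
Lemma ge0_le_integralT f g : (forall t, 0 <= f t) -> (forall t, f t <= g t) ->
  \int[m]_t f t <= \int[m]_t g t.
Proof.
move=> f0 fg.
have g0 t : 0 <= g t by exact: le_trans (fg t).
rewrite !ge0_integralTE//; apply: le_ereal_sup => _ [h hf <-].
by exists h => // t; exact: le_trans (hf t) (fg t).
Qed.

(** Raising [g] to [+oo] on the exceptional set makes the inequality hold everywhere; only the
    measurable function is modified on a null set. *)
Lemma ae_le_integral_measurabler f g : (forall t, 0 <= f t) -> (forall t, 0 <= g t) ->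
  measurable_fun setT g -> {ae m, forall t, f t <= g t} ->
  \int[m]_t f t <= \int[m]_t g t.
Proof.
move=> f0 g0 mg [N [mN N0 sub]].
pose g' t := if t \in N then +oo else g t.
have mg' : measurable_fun setT g'.
  apply: measurable_fun_if => //; last exact: measurable_funTS.
  apply: (measurable_fun_bool true); rewrite setTI (_ : _ @^-1` _ = N)//.
  by apply/seteqP; split=> t /=; [exact: set_mem|exact: mem_set].
have g'0 t : 0 <= g' t by rewrite /g'; case: ifP.
apply: (@le_trans _ _ (\int[m]_t g' t)).
  apply: ge0_le_integralT => // t; rewrite /g'; case: ifPn => [_|tN]; first exact: leey.
  apply: contrapT => ft; move/negP: tN; apply; rewrite inE; apply: sub.
  by move=> h; exact: ft.
rewrite le_eqVlt; apply/orP; left; apply/eqP; apply: ge0_ae_eq_integral => //.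
exists N; split=> // t /=; apply: contraPP => tN h; apply: h => _.
by rewrite /g' memNset.
Qed.

(** The same device on the other side: [f] is lowered to 0 on the exceptional set. *)
Lemma ae_le_integral_measurablel f g : (forall t, 0 <= f t) -> (forall t, 0 <= g t) ->
  measurable_fun setT f -> {ae m, forall t, f t <= g t} ->
  \int[m]_t f t <= \int[m]_t g t.
Proof.
move=> f0 g0 mf [N [mN N0 sub]].
pose f' t := if t \in N then 0 else f t.
have mf' : measurable_fun setT f'.
  apply: measurable_fun_if => //; last exact: measurable_funTS.
  apply: (measurable_fun_bool true); rewrite setTI (_ : _ @^-1` _ = N)//.
  by apply/seteqP; split=> t /=; [exact: set_mem|exact: mem_set].
have f'0 t : 0 <= f' t by rewrite /f'; case: ifP.
apply: (@le_trans _ _ (\int[m]_t f' t)).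
  rewrite le_eqVlt; apply/orP; left; apply/eqP; apply: ge0_ae_eq_integral => //.
  exists N; split=> // t /=; apply: contraPP => tN h; apply: h => _.
  by rewrite /f' memNset.
apply: ge0_le_integralT => // t; rewrite /f'; case: ifPn => [_|tN]; first exact: g0.
apply: contrapT => ft; move/negP: tN; apply; rewrite inE; apply: sub.
by move=> h; exact: ft.
Qed.

End unmeasurable_integral.

Section generic_sample.
Context d (T : measurableType d) (R : realType) (P : probability T R).
Local Notation plane := (R * R)%type.
Variables (x : plane) (X : nat -> {mfun T >-> plane}) (mu : probability plane R).
Hypothesis X_indep : mutually_independent (X : nat -> {RV P >-> plane}).
Hypothesis X_law : forall i B, measurable B -> P (X i @^-1` B) = mu B.
Hypothesis mu_null : forall A, measurable A -> plane_leb A = 0%E -> mu A = 0%E.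

Let ae_not i (A : set plane) : measurable A -> plane_leb A = 0%E ->
  {ae P, forall w, ~ A (X i w)}.
Proof.
move=> mA A0; exists (X i @^-1` A); split.
- exact: measurable_funPTI.
- by rewrite X_law// mu_null.
- by move=> w /= /contrapT.
Qed.

Let ae_first i : {ae P, forall w, (X i w - x).2 != 0}.
Proof.
have mH : measurable [set p : plane | p.2 = x.2].
  by apply: measurable_eq_set => //; exact: measurable_snd.
have := @ae_not i _ mH (plane_leb_horizontal x.2).
by apply: filterS => w /= h; rewrite subr_eq0; exact/eqP.
Qed.

Let ae_second i j : i != j -> {ae P, forall w, cross (X i w - x) (X j w - x) != 0}.
Proof.
move=> ij.
pose H : set plane := [set p | p.2 = x.2].
have mH : measurable H by apply: measurable_eq_set => //; exact: measurable_snd.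
(* First points at the height of [x] are removed, so that each section is empty or within a line
   that is not horizontal; the removed event is null by itself. *)
pose S : set (plane * plane) := [set v | cross (v.1 - x) (v.2 - x) = 0] `&` (~` H `*` setT).
have mS : measurable S.
  apply: measurableI; last by apply: measurableX => //; exact: measurableC.
  by apply: measurable_eq_set => //; apply: measurable_cross; exact: measurable_plane_sub.
have S0 : ((mu \x mu) S = 0)%E.
  apply: integral0_eq => y _ /=; have mSy : measurable (xsection S y) by exact: measurable_xsection.
  apply: mu_null => //.
  have [yH|yH] := pselect (H y).
    rewrite (_ : xsection S y = set0) ?measure0//; apply/seteqP; split=> z //.
    by rewrite /xsection /= inE => -[_ [/= + _]].
  apply: (@subset_measure0 _ _ _ _ _ [set q | cross (y - x) (q - x) = 0]) => //.
  - by apply: measurable_eq_set => //; apply: measurable_cross => //; exact: measurable_plane_sub.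
  - by move=> z; rewrite /xsection /= inE => -[].
  - apply: plane_leb_collinear; rewrite subr_eq0; exact/eqP.
have PS : (P ((fun w => (X i w, X j w)) @^-1` S) = 0)%E.
  have := @P_pair_avoid _ _ _ _ _ P X mu X_indep X_law i j ij set0 measurable0 fset0
    (fun=> setT) S [::] (fun=> measurableT) mS.
  rewrite set_fset0 bigcap_set0 setIT probability_setT mule1.
  rewrite (_ : avoid _ _ _ _ _ = setT) ?setIT; last by apply/seteqP; split.
  move=> ->//; rewrite (eq_integral (cst 1%E)); first by rewrite integral_cst// mul1e.
  by move=> p _; rewrite expr0.
have aeS : {ae P, forall w, ~ S (X i w, X j w)}.
  exists ((fun w => (X i w, X j w)) @^-1` S); split=> //; last by move=> w /= /contrapT.
  by rewrite -[X in measurable X]setTI; apply: measurable_fun_pair.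
have aeH := @ae_not i _ mH (plane_leb_horizontal x.2).
apply: filterS2 aeS aeH => w /= h1 h2; apply/eqP => c0; apply: h1.
by split.
Qed.

(** Given the first two samples, the third one avoids a fixed circle with probability 1. This
    includes collinear triples, where the default center still defines a circle. *)
Let ae_third i j k : i != j -> k != i -> k != j -> {ae P, forall w,
  enorm (X k w - circumcenter x (X i w) (X j w)) != circumradius x (X i w) (X j w)}.
Proof.
move=> ij ki kj.
pose D : set ((plane * plane) * plane) :=
  [set v | enorm (v.2 - circumcenter x v.1.1 v.1.2) = circumradius x v.1.1 v.1.2].
have m1 : measurable_fun setT (fun v : (plane * plane) * plane => v.1.1) by exact: measurableT_comp.
have m2 : measurable_fun setT (fun v : (plane * plane) * plane => v.1.2) by exact: measurableT_comp.
have mD : measurable D.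
  apply: measurable_eq_set; last exact: measurable_circumradius.
  apply: measurable_enorm; apply: measurable_plane_sub => //.
  exact: measurable_circumcenter.
have mA : measurable (avoid X i j D [:: k]) by exact: measurable_avoid.
have PA : P (avoid X i j D [:: k]) = 1%E.
  have := @P_pair_avoid _ _ _ _ _ P X mu X_indep X_law i j ij D mD fset0
    (fun=> setT) setT [:: k] (fun=> measurableT) measurableT.
  rewrite set_fset0 bigcap_set0 setIT probability_setT mule1 preimage_setT setTI.
  move=> ->//=; rewrite ?inE// 1?eq_sym//.
  rewrite (eq_integral (cst 1%E)).
    have e := @product_measure1E _ _ _ _ _ mu mu setT setT measurableT measurableT.
    rewrite integral_cst// mul1e -[LHS]/((mu \x mu) setT)%E -setXTT e.
    by rewrite [X in (X * _)%E](probability_setT mu) [X in (_ * X)%E](probability_setT mu) mule1.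
  move=> p _; rewrite expr1 miss_probaE// mu_null ?sube0//.
    exact: measurable_xsection.
  rewrite (_ : xsection D p = [set q | enorm (q - circumcenter x p.1 p.2) = circumradius x p.1 p.2]).
    exact: plane_leb_circle.
  by apply/seteqP; split=> q; rewrite /xsection /= inE.
exists (~` avoid X i j D [:: k]); split; first exact: measurableC.
  by rewrite probability_setC// PA subee.
move=> w /=; apply: contra_not => h; apply/eqP => e; apply: (h k) => //.
by rewrite inE.
Qed.

Lemma ae_general_position n :
  {ae P, forall w, general_position n x (fun i => X i w)}.
Proof.
have h1 : {ae P, forall w, forall i, (X i w - x).2 != 0} by apply: ae_foralln; exact: ae_first.
have h2 : {ae P, forall w, forall i j, i != j -> cross (X i w - x) (X j w - x) != 0}.
  apply: ae_foralln => i; apply: ae_foralln => j.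
  have [ij|ij] := boolP (i != j); last by apply: aeW => w.
  by have := ae_second ij; apply: filterS => w h _.
have h3 : {ae P, forall w, forall i j k, i != j -> k != i -> k != j ->
    enorm (X k w - circumcenter x (X i w) (X j w)) != circumradius x (X i w) (X j w)}.
  apply: ae_foralln => i; apply: ae_foralln => j; apply: ae_foralln => k.
  have [ij|ij] := boolP (i != j); last by apply: aeW => w.
  have [ki|ki] := boolP (k != i); last by apply: aeW => w.
  have [kj|kj] := boolP (k != j); last by apply: aeW => w.
  by have := ae_third ij ki kj; apply: filterS => w h _ _ _.
apply: filterS3 h1 h2 h3 => w a1 a2 a3; split.
- by move=> i; exact: a1.
- by move=> i j ij; exact: a2.
- by move=> i j k ij ki kj; exact: a3.
Qed.

End generic_sample.

(** * The number of edges *)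

Section empty_set_proba.
Local Open Scope ereal_scope.
Context d d' (T : measurableType d) (E : measurableType d') (R : realType).
Variables (P : probability T R) (X : nat -> {mfun T >-> E}) (mu : probability E R).
Hypothesis X_indep : mutually_independent (X : nat -> {RV P >-> E}).
Hypothesis X_law : forall i B, measurable B -> P (X i @^-1` B) = mu B.

Definition no_sample_in n (B : set E) : set T :=
  [set w | forall k : 'I_n, ~ B (X k w)].

Let indices n : {fset nat} := seq_fset tt (iota 0 n).

Let no_sample_inE n B :
  no_sample_in n B = \bigcap_(i in [set` indices n]) (X i @^-1` (~` B)).
Proof.
apply/seteqP; split=> w h.
  by move=> i /=; rewrite seq_fsetE mem_iota add0n => /= ilt; exact: (h (Ordinal ilt)).
by move=> k; apply: (h k) => /=; rewrite seq_fsetE mem_iota add0n ltn_ord.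
Qed.

Lemma measurable_no_sample_in n B : measurable B -> measurable (no_sample_in n B).
Proof.
move=> mB; rewrite no_sample_inE.
apply: fin_bigcap_measurable => // i _.
by rewrite -[X in measurable X]setTI; apply: measurable_funPT => //; exact: measurableC.
Qed.

Lemma no_sample_in_proba n B : measurable B ->
  P (no_sample_in n B) = ((1 - fine (mu B)) ^+ n)%:E.
Proof.
move=> mB; have mBC : measurable (~` B) by exact: measurableC.
rewrite no_sample_inE (@X_indep (indices n) (fun=> ~` B))//.
under eq_bigr do rewrite X_law// (probability_setC mu mB) -(fineK (fin_num_measure mu B mB)).
rewrite -EFinB prodEFin (perm_big (iota 0 n)); last first.
  by apply: uniq_perm; rewrite ?fset_uniq ?iota_uniq// => i; rewrite seq_fsetE.
by rewrite big_const_seq count_predT size_iota iter_mulr_1.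
Qed.

Lemma no_sample_in_le n B (t : R) : measurable B -> (0 <= t)%R -> t%:E <= mu B ->
  P (no_sample_in n B) <= ((1 + n%:R * t)^-1)%:E.
Proof.
move=> mB t0 tB; rewrite no_sample_in_proba// lee_fin.
have fB := fin_num_measure mu B mB.
have tB' : (t <= fine (mu B))%R by rewrite -lee_fin fineK.
have B1 : (fine (mu B) <= 1)%R by rewrite -lee_fin fineK// probability_le1.
have t1 := le_trans tB' B1.
apply: (@le_trans _ _ ((1 - t) ^+ n)%R).
  by rewrite lerXn2r ?nnegrE ?subr_ge0// lerD2l lerN2.
rewrite -[leRHS]mul1r ler_pdivlMr; last by rewrite ltr_pwDl// mulr_ge0.
by apply: exprn_decay; rewrite t0.
Qed.

End empty_set_proba.

(** * Expected numbers of local and of split vertices *)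

Section local_vertices.
Local Open Scope ereal_scope.
Context {R : realType}.
Local Notation plane := (R * R)%type.
Variables (f : plane -> R) (x : plane) (mu : probability plane R).
Hypotheses (f_pdf : is_pdf f) (x_leb : lebesgue_pt2 f x).
Hypothesis muE : forall A, measurable A ->
  mu A = (\int[plane_leb]_(u in A) (f u)%:E)%E.

Definition expected_pairs S n : \bar R :=
  (n * (n - 1))%:R%:E * void_integral mu S (circumdisc_graph x) n.

(** [u] and [v] are within [err] of 3 times and 1 time the same Lebesgue integral. Eliminating it
    costs [err] from [u] and [3 * err] from [v]. *)
Lemma void_integral_split r eps beta m n : (0 <= r)%R ->
  \int[plane_leb]_(u in eball x (2 * r)) `|f u - f x|%:E <= eps%:E ->
  plane_leb (eball x (2 * r)) <= beta%:E -> mu (eball x (2 * r)) <= m%:E ->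
  let u := void_integral mu (ccw_pairs x r) (circumdisc_graph x) n in
  let v := void_integral mu (ccw_pairs x r `&` split_pairs x) (circumdisc_graph x) n in
  let err := void_error (f x) eps beta m (n - 2) in
  u <= (3 * fine v + 4 * err)%:E /\ (3 * fine v)%:E <= u + (4 * err)%:E.
Proof.
move=> r0 epsP betaP mP u v err.
have mS := measurable_ccw_pairs x r.
have mSs : measurable (ccw_pairs x r `&` split_pairs x).
  by apply: measurableI => //; exact: measurable_split_pairs.
have mD := measurable_circumdisc_graph x.
have mB : measurable (eball x (2 * r)) by exact: measurable_eball.
have SB w : ccw_pairs x r w -> [/\ eball x (2 * r) w.1, eball x (2 * r) w.2 &
    xsection (circumdisc_graph x) w `<=` eball x (2 * r)].
  move=> [c cr]; have [e1 e2] := circumcenter_equidistant (lt0r_neq0 c).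
  rewrite /circumradius in cr.
  split.
  - by apply: eball_double cr _; rewrite e1 enormB.
  - by apply: eball_double cr _; rewrite e2 enormB.
  - by rewrite xsection_circumdisc => q /ltW; exact: eball_double.
have SsB w : (ccw_pairs x r `&` split_pairs x) w -> [/\ eball x (2 * r) w.1,
    eball x (2 * r) w.2 & xsection (circumdisc_graph x) w `<=` eball x (2 * r)].
  by move=> [/SB].
have a0 := pdf_ge0 f_pdf x.
have mf := pdf_measurable f_pdf.
have f0 := pdf_ge0 f_pdf.
have h1 := le_void_integral mf f0 muE a0 mB epsP betaP mP mS mD SB n.
have h2 := ge_void_integral mf f0 muE a0 mB epsP betaP mP mS mD SB n.
have h3 := le_void_integral mf f0 muE a0 mB epsP betaP mP mSs mD SsB n.
have h4 := ge_void_integral mf f0 muE a0 mB epsP betaP mP mSs mD SsB n.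
rewrite integral_local_void muleCA -/u -/err in h1 h2.
rewrite -/v -/err in h3 h4.
have u1 : u <= 1 := void_integral_le1 mu mS mD n.
have v1 : v <= 1 := void_integral_le1 mu mSs mD n.
have u0 : 0 <= u := void_integral_ge0 mu _ mD n.
have v0 : 0 <= v := void_integral_ge0 mu _ mD n.
move: h1 h2 h3 h4 => {mS mSs mD SB SsB epsP betaP mP}.
set J := (X in _ <= 3%:E * X + _); rewrite -/J => h1 h2 h3 h4.
move: u v J err u1 v1 u0 v0 h1 h2 h3 h4.
move=> [u| |] [v| |] [j| |] err //=; rewrite -?EFinM -?EFinD ?lee_fin.
  by move=> *; split; lra.
Qed.

Lemma expected_pairs_split L delta : (0 < L)%R -> (0 < delta)%R -> \forall n \near \oo,
  let r := Num.sqrt (L / n%:R) in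
  let U := expected_pairs (ccw_pairs x r) n in
  let V := expected_pairs (ccw_pairs x r `&` split_pairs x) n in
  U <= 3%:E * V + delta%:E /\ 3%:E * V <= U + delta%:E.
Proof.
move=> L0 delta0.
have [C C0 ballP] := mu_eball_le f_pdf x_leb muE.
have a0 := pdf_ge0 f_pdf x; set a := f x in a0.
pose z := (4 * L)%R; have z0 : (0 < z)%R by rewrite mulr_gt0.
(* With [(2 * r) ^+ 2 = z / n], the error bounds [eps], [beta] and [m] are all of order [1 / n], and
   [n ^ 2] times [void_error] is at most [eta * K]. As [K] does not involve [n], [eta] can be fixed
   before [n]. *)
pose K := (C ^+ 2 * z ^+ 3 + 4 * a * z ^+ 2 + C * z ^+ 2)%R.
have K0 : (0 <= K)%R.
  by rewrite !addr_ge0// ?mulr_ge0// ?exprn_ge0// ltW.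
pose eta := (delta / (4 * K + 1))%R.
have K1 : (0 < 4 * K + 1)%R by rewrite ltr_wpDl// mulr_ge0.
have eta0 : (0 < eta)%R by rewrite divr_gt0.
have etaK : (4 * (eta * K) <= delta)%R.
  rewrite (_ : 4 * (eta * K) = delta * (4 * K / (4 * K + 1)))%R; last first.
    by rewrite /eta; field; rewrite gt_eqF.
  by rewrite ger_pMr// ler_pdivrMr// mul1r lerDl.
have eta_ge0 := ltW eta0; clearbody eta.
have [r0 r00 epsP] := lebesgue_pt2_eps f_pdf x_leb eta0.
near=> n.
have n0 : (0 < n)%N by near: n; exists 1%N.
have p0 : (0 < n%:R :> R)%R by rewrite ltr0n.
pose w := (n%:R^-1 : R)%R; have w0 : (0 < w)%R by rewrite invr_gt0.
have pw : (n%:R * w = 1)%R by rewrite mulfV// gt_eqF.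
have z_ge0 := ltW z0; have w_ge0 := ltW w0.
set r := Num.sqrt (L / n%:R).
have r_gt0 : (0 < r)%R by rewrite sqrtr_gt0 divr_gt0.
have r2 : ((2 * r) ^+ 2 = z * w)%R.
  by rewrite exprMn sqr_sqrtr ?divr_ge0 ?ltW// -natrX mulrA.
clearbody z; have rr0 : (2 * r < r0)%R.
  rewrite -(@ltr_pXn2r _ 2)// ?nnegrE ?mulr_ge0 ?ltW// r2.
  rewrite ltr_pdivrMr// mulrC -ltr_pdivrMr ?exprn_gt0//.
  near: n; exact: nbhs_infty_gtr.
have h1 : \int[plane_leb]_(u in eball x (2 * r)) `|f u - f x|%:E <= (eta * (z * w))%:E.
  by rewrite -r2; apply: epsP; rewrite mulr_gt0.
have h2 : plane_leb (eball x (2 * r)) <= (4 * (z * w))%:E.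
  by rewrite -r2; apply: plane_leb_eball_le; rewrite mulr_ge0// ltW.
have h3 : mu (eball x (2 * r)) <= (C * (z * w))%:E.
  by rewrite -r2; apply: ballP; rewrite mulr_ge0// ltW.
have := void_integral_split n (ltW r_gt0) h1 h2 h3.
rewrite /expected_pairs.
set u := void_integral mu (ccw_pairs x r) _ n; set v := void_integral mu (ccw_pairs x r `&` split_pairs x) _ n.
set err := void_error _ _ _ _ _ => /= -[uv vu].
have mD := measurable_circumdisc_graph x.
have mS := measurable_ccw_pairs x r.
have mSs : measurable (ccw_pairs x r `&` split_pairs x).
  by apply: measurableI => //; exact: measurable_split_pairs.
have u1 : u <= 1 := void_integral_le1 mu mS mD n.
have v1 : v <= 1 := void_integral_le1 mu mSs mD n.
have u0 : 0 <= u := void_integral_ge0 mu _ mD n.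
have v0 : 0 <= v := void_integral_ge0 mu _ mD n.
have ufin : u \is a fin_num by rewrite fin_num_abs gee0_abs// (le_lt_trans u1)// ltry.
have vfin : v \is a fin_num by rewrite fin_num_abs gee0_abs// (le_lt_trans v1)// ltry.
rewrite -(fineK ufin) -(fineK vfin) in uv vu *.
move: uv vu; rewrite /= -?EFinM -?EFinD ?lee_fin.
move: (fine u) (fine v) => {}u {}v {h1 h2 h3 u1 v1 u0 v0 ufin vfin} uv vu.
set c := ((n * (n - 1))%:R : R).
have c0 : (0 <= c)%R by [].
have nn : (c <= n%:R ^+ 2)%R by rewrite -natrX ler_nat expnS expn1 leq_mul2l leq_subr orbT.
have err_ge0 : (0 <= err)%R.
  rewrite /err /void_error -/a; rewrite !(addr_ge0, mulr_ge0, exprn_ge0)//.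
have cerr : (c * (4 * err) <= delta)%R.
  apply: le_trans etaK; rewrite mulrCA ler_pM2l//.
  apply: (@le_trans _ _ (n%:R ^+ 2 * err)%R); first by rewrite ler_wpM2r//.
  have kn : ((n - 2)%:R <= n%:R :> R)%R by rewrite ler_nat leq_subr.
  rewrite (_ : eta * K = n%:R ^+ 2 * (n%:R * (eta * (z * w)) * (C * (z * w)) ^+ 2 +
     (a * (4 * (z * w)) * (eta * (z * w)) + C * (z * w) * (eta * (z * w)))))%R.
    rewrite ler_wpM2l ?exprn_ge0// /err /void_error -/a lerD2r.
    by rewrite !ler_wpM2r ?exprn_ge0 ?mulr_ge0// ltW.
  rewrite /K /w; field; rewrite gt_eqF//.
have h1 : (c * u <= c * (3 * v + 4 * err))%R by rewrite ler_wpM2l.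
have h2 : (c * (3 * v) <= c * (u + 4 * err))%R by rewrite ler_wpM2l.
by split; lra.
Unshelve. all: by end_near.
Qed.

End local_vertices.

(** * Moments of the number of edges *)

Section voronoi_edges.
Context d (T : measurableType d) (R : realType) (P : probability T R).
Local Notation plane := (R * R)%type.
Variables (f : plane -> R) (x : plane) (X : nat -> {mfun T >-> plane}) (mu : probability plane R).
Hypotheses (f_pdf : is_pdf f) (x_leb : lebesgue_pt2 f x).
Hypothesis X_indep : mutually_independent (X : nat -> {RV P >-> plane}).
Hypothesis X_law : forall i B, measurable B -> P (X i @^-1` B) = mu B.
Hypothesis muE : forall A, measurable A ->
  mu A = (\int[plane_leb]_(u in A) (f u)%:E)%E.

Let y (w : T) (i : nat) : plane := X i w.
Let N n (w : T) : \bar R := number_of_edges (voronoi_cell n (y w) x).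

Let nb_close n s0 w : nat :=
  (\sum_(e : bool * bool)
    nb_void_pairs n setT (fun v => quarter e x (farther x s0 v)) (y w))%N.

Let xsection_disc : xsection (circumdisc_graph x) = circumdisc x.
Proof. by apply/funext => v; exact: xsection_circumdisc. Qed.

Let xsection_qrt e s0 :
  xsection (quarter_graph e x s0) = fun v => quarter e x (farther x s0 v).
Proof. by apply/funext => v; exact: xsection_quarter. Qed.

Let N_ge0 n w : (0 <= N n w)%E.
Proof. by rewrite /N /number_of_edges /counting; case: ifP; rewrite ?lee_fin ?leey. Qed.

Let aeP := ae_general_position x X_indep X_law (pdf_null f_pdf muE).

Local Open Scope ereal_scope.

Section moment.
Variables (s0 K : R).
Hypothesis momentP : forall n e,
  (n * (n - 1))%:R%:E * void_integral mu setT (quarter_graph e x s0) n <= K%:E.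

Let measurable_nb_close n : measurable_fun setT (fun w => (nb_close n s0 w)%:R%:E : \bar R).
Proof.
have -> : (fun w => (nb_close n s0 w)%:R%:E : \bar R) = (fun w => \sum_(e : bool * bool)
    (nb_void_pairs n setT (fun v => quarter e x (farther x s0 v)) (y w))%:R%:E).
  by apply/funext => w; rewrite sumEFin natr_sum.
apply: emeasurable_sum => e; rewrite -xsection_qrt.
exact: (measurable_nb_void_pairs X measurableT (measurable_quarter_graph e x s0)).
Qed.

Let expected_nb_close n : \int[P]_w (nb_close n s0 w)%:R%:E <= (4 * K)%:E.
Proof.
have -> : \int[P]_w (nb_close n s0 w)%:R%:E = \int[P]_w (\sum_(e : bool * bool)
    (nb_void_pairs n setT (fun v => quarter e x (farther x s0 v)) (y w))%:R%:E).
  by apply: eq_integral => w _; rewrite sumEFin natr_sum.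
rewrite ge0_integral_sum//; last first.
  move=> e; rewrite -xsection_qrt.
  exact: (measurable_nb_void_pairs X measurableT (measurable_quarter_graph e x s0)).
apply: (@le_trans _ _ (\sum_(e : bool * bool) K%:E)).
  apply: lee_sum => e _; rewrite -xsection_qrt.
  by rewrite (expected_void_pairs X_indep X_law measurableT (measurable_quarter_graph e x s0)).
by rewrite sumEFin lee_fin sumr_const card_prod card_bool [leRHS]mulr_natl.
Qed.

Let close_bound n w : \bar R := (2 * (nb_close n s0 w)%:R + 1)%:E.

Let measurable_close_bound n : measurable_fun setT (close_bound n).
Proof.
apply/measurable_EFinP; apply: measurable_funD => //; apply: measurable_funM => //.
by apply/measurable_EFinP; exact: measurable_nb_close.
Qed.

Let expected_close_bound n : \int[P]_w close_bound n w <= (8 * K + 1)%:E.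
Proof.
have mq := measurable_nb_close n.
under eq_integral do rewrite /close_bound EFinD EFinM.
rewrite ge0_integralD//; last exact: emeasurable_funM.
rewrite ge0_integralZl_EFin// integral_cst// [X in 1 * X](probability_setT P) mule1.
rewrite (_ : 8 * K + 1 = 2 * (4 * K) + 1)%R; last by ring.
by rewrite (EFinD (2 * (4 * K))) (EFinM 2); apply: leeD => //; rewrite lee_wpmul2l.
Qed.

(** From [s ^ 2 <= s + q]: if [s >= 2] then [s <= s ^ 2 / 2] is absorbed on the left, and if
    [s <= 1] the summand 1 is enough. *)
Let sqr_sides_bound n w : general_position n x (y w) ->
  ((nb_sides n x (y w))%:R ^+ 2 <= 2 * (nb_close n s0 w)%:R + 1 :> R)%R.
Proof.
move=> gp; have := sqr_sides_le n x (y w) s0; rewrite -/(nb_close n s0 w).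
move: (nb_sides n x (y w)) (nb_close n s0 w) => s q h.
rewrite -(ler_nat R) natrM natrD in h.
case: s h => [|[|s]] h.
- by rewrite expr0n addr_ge0// mulr_ge0.
- by rewrite expr1n lerDr mulr_ge0.
have s2 : (2 <= s.+2%:R :> R)%R by rewrite (ler_nat R 2).
rewrite expr2; have : (2 * s.+2%:R <= s.+2%:R * s.+2%:R :> R)%R by rewrite ler_wpM2r.
lra.
Qed.

Lemma second_moment_edges n : \int[P]_w (N n w ^+ 2) <= (8 * K + 1)%:E.
Proof.
apply: le_trans (expected_close_bound n).
apply: ae_le_integral_measurabler => //.
- by move=> w; rewrite expe_ge0.
- by move=> w; rewrite lee_fin addr_ge0// mulr_ge0.
apply: filterS (aeP n) => w gp.
by rewrite /N (number_of_edges_voronoi gp) -EFin_expe lee_fin sqr_sides_bound.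
Qed.

Section limit.
Variable c : R.
Hypotheses (c0 : (0 < c)%R) (s00 : (0 < s0)%R).
Hypothesis quarterP : forall e s, (0 <= s <= s0)%R -> (c * s ^+ 2)%:E <= mu (quarter e x s).

(** A count of void squares instead of the indicator of [void_quarter], which it dominates: its mean
    follows by linearity. *)
Let bad n r w : R := \sum_(e : bool * bool) \1_(no_sample_in X n (quarter e x r)) w.

Let measurable_bad n r : measurable_fun setT (fun w => (bad n r w)%:E : \bar R).
Proof.
apply/measurable_EFinP; apply: measurable_sum => e; apply: measurable_indic.
by apply: measurable_no_sample_in; exact: measurable_quarter.
Qed.

Let bad_ge0 n r w : (0 <= bad n r w)%R.
Proof. exact: sumr_ge0. Qed.

Let expected_bad n r : (0 <= r <= s0)%R ->
  \int[P]_w (bad n r w)%:E <= (4 / (1 + n%:R * (c * r ^+ 2)))%:E.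
Proof.
move=> r0; have mq e : measurable (no_sample_in X n (quarter e x r)).
  by apply: measurable_no_sample_in; exact: measurable_quarter.
under eq_integral do rewrite /bad -sumEFin.
rewrite ge0_integral_sum//; last first.
  by move=> e; apply/measurable_EFinP; exact: measurable_indic.
apply: (@le_trans _ _ (\sum_(e : bool * bool) ((1 + n%:R * (c * r ^+ 2))^-1)%:E)).
  apply: lee_sum => e _; rewrite integral_indic// setIT.
  apply: (no_sample_in_le X_indep X_law); [exact: measurable_quarter| |exact: quarterP].
  by rewrite mulr_ge0 ?exprn_ge0 ?(ltW c0)//; case/andP: r0.
by rewrite sumEFin lee_fin sumr_const card_prod card_bool [leRHS]mulr_natl.
Qed.

Let bad_ge1 n r w : void_quarter n x r (y w) -> (1 <= bad n r w)%R.
Proof.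
move=> [e he]; rewrite /bad (bigD1 e)//= indicE mem_set//= lerDl; exact: sumr_ge0.
Qed.

Let V n r w : R := (nb_void_pairs n (ccw_pairs x r) (circumdisc x) (y w))%:R.
Let Vs n r w : R :=
  (nb_void_pairs n (ccw_pairs x r `&` split_pairs x) (circumdisc x) (y w))%:R.

Let sides_le n r eta w : (0 < eta)%R -> general_position n x (y w) ->
  ((nb_sides n x (y w))%:R <= V n r w + (eta * (2 * (nb_close n s0 w)%:R + 1) +
     (4 * eta)^-1 * bad n r w))%R.
Proof.
move=> eta0 gp; have e4 : (0 < (4 * eta)^-1)%R by rewrite invr_gt0 mulr_gt0.
have [vq|nvq] := pselect (void_quarter n x r (y w)); last first.
  apply: ler_wpDr; last by rewrite ler_nat (sides_le_void_pairs gp nvq).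
  apply: addr_ge0; apply: mulr_ge0 => //; exact: ltW.
apply: ler_wpDl; first exact: ler0n.
(* AM-GM: [s <= eta * s ^+ 2 + 1 / (4 * eta)]. *)
apply: (@le_trans _ _ (eta * (nb_sides n x (y w))%:R ^+ 2 + (4 * eta)^-1))%R.
  set s := (_%:R : R)%R; rewrite -subr_ge0.
  rewrite (_ : _ - s = (4 * eta)^-1 * (2 * eta * s - 1) ^+ 2)%R; last first.
    by field; rewrite gt_eqF.
  by rewrite mulr_ge0 ?sqr_ge0 ?(ltW e4).
apply: lerD; first by apply: ler_wpM2l; [exact: ltW|exact: sqr_sides_bound].
by rewrite ler_peMr ?bad_ge1// ltW.
Qed.

Let split_ge2 n r w : general_position n x (y w) -> (2 <= Vs n r w + 2 * bad n r w)%R.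
Proof.
move=> gp; have [vq|nvq] := pselect (void_quarter n x r (y w)).
  have := bad_ge1 vq; have : (0 <= Vs n r w)%R by exact: ler0n.
  lra.
rewrite /Vs (split_void_pairs_eq2 gp nvq).
by have := bad_ge0 n r w; lra.
Qed.

Let mD := measurable_circumdisc_graph x.
Let mS r := measurable_ccw_pairs x r.
Let mSs r : measurable (ccw_pairs x r `&` split_pairs x).
Proof. by apply: measurableI => //; exact: measurable_split_pairs. Qed.

Let measurable_V n r : measurable_fun setT (fun w => (V n r w)%:E : \bar R).
Proof. by rewrite /V -xsection_disc; exact: (measurable_nb_void_pairs X (mS r) mD). Qed.

Let measurable_Vs n r : measurable_fun setT (fun w => (Vs n r w)%:E : \bar R).
Proof. by rewrite /Vs -xsection_disc; exact: (measurable_nb_void_pairs X (mSs r) mD). Qed.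

Let V_ge0 n r w : 0 <= (V n r w)%:E. Proof. by rewrite lee_fin ler0n. Qed.

Let Vs_ge0 n r w : 0 <= (Vs n r w)%:E. Proof. by rewrite lee_fin ler0n. Qed.

Let EVE n r : \int[P]_w (V n r w)%:E = expected_pairs x mu (ccw_pairs x r) n.
Proof. by rewrite /V -xsection_disc; exact: (expected_void_pairs X_indep X_law (mS r) mD). Qed.

Let EVsE n r :
  \int[P]_w (Vs n r w)%:E = expected_pairs x mu (ccw_pairs x r `&` split_pairs x) n.
Proof. by rewrite /Vs -xsection_disc; exact: (expected_void_pairs X_indep X_law (mSs r) mD). Qed.

Let expected_sides_ge n r : \int[P]_w (V n r w)%:E <= \int[P]_w N n w.
Proof.
apply: ae_le_integral_measurablel => //.
apply: filterS (aeP n) => w gp.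
by rewrite /N (number_of_edges_voronoi gp) lee_fin ler_nat void_pairs_le_sides.
Qed.

Let expected_sides_le n r eta b : (0 < eta)%R -> \int[P]_w (bad n r w)%:E <= b%:E ->
  \int[P]_w N n w <= \int[P]_w (V n r w)%:E + (eta * (8 * K + 1) + (4 * eta)^-1 * b)%:E.
Proof.
move=> eta0 hb; have eta_ge0 := ltW eta0.
have e4 : (0 <= (4 * eta)^-1)%R by rewrite invr_ge0 mulr_ge0.
have mV := measurable_V n r; have mb := measurable_bad n r.
have mc := measurable_close_bound n; have b0 := bad_ge0 n r.
have cb0 w : 0 <= close_bound n w by rewrite lee_fin addr_ge0// mulr_ge0.
have V0 := V_ge0 n r.
have x0 w : 0 <= eta%:E * close_bound n w by rewrite mule_ge0// lee_fin.
have y0 w : 0 <= ((4 * eta)^-1)%:E * (bad n r w)%:E by rewrite mule_ge0// lee_fin.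
have mx : measurable_fun setT (fun w => eta%:E * close_bound n w) by exact: measurable_funeM.
have my : measurable_fun setT (fun w => ((4 * eta)^-1)%:E * (bad n r w)%:E).
  exact: measurable_funeM.
have mxy : measurable_fun setT
    (fun w => eta%:E * close_bound n w + ((4 * eta)^-1)%:E * (bad n r w)%:E).
  exact: emeasurable_funD.
have xy0 w : 0 <= eta%:E * close_bound n w + ((4 * eta)^-1)%:E * (bad n r w)%:E.
  exact: adde_ge0.
apply: (@le_trans _ _ (\int[P]_w ((V n r w)%:E +
    (eta%:E * close_bound n w + ((4 * eta)^-1)%:E * (bad n r w)%:E)))).
  apply: ae_le_integral_measurabler => //.
  - by move=> w; exact: adde_ge0.
  - exact: emeasurable_funD.
  apply: filterS (aeP n) => w gp.
  rewrite /N (number_of_edges_voronoi gp) /close_bound -!EFinM -!EFinD lee_fin.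
  exact: sides_le.
rewrite ge0_integralD//.
apply: leeD => //.
rewrite ge0_integralD// !ge0_integralZl_EFin//; last by move=> w _; rewrite lee_fin.
rewrite (EFinD (eta * (8 * K + 1))) (EFinM eta) (EFinM (4 * eta)^-1).
by apply: leeD; apply: lee_wpmul2l; rewrite ?lee_fin.
Qed.

Let expected_split_le n r : \int[P]_w (Vs n r w)%:E <= 2%:E.
Proof.
have v0 := Vs_ge0 n r.
apply: (@le_trans _ _ (\int[P]_w (cst 2%:E w))).
  apply: ae_le_integral_measurabler => //; first by move=> w; rewrite lee_fin.
  apply: filterS (aeP n) => w gp.
  by rewrite lee_fin (ler_nat R _ 2) split_void_pairs_le2.
by rewrite integral_cst// [X in _ * X](probability_setT P) mule1.
Qed.

Let expected_split_ge n r b : \int[P]_w (bad n r w)%:E <= b%:E ->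
  2%:E <= \int[P]_w (Vs n r w)%:E + (2 * b)%:E.
Proof.
move=> hb; have mb := measurable_bad n r; have mv := measurable_Vs n r.
have b0 := bad_ge0 n r.
apply: (@le_trans _ _ (\int[P]_w (cst 2%:E w))).
  by rewrite integral_cst// [X in _ * X](probability_setT P) mule1.
have v0 := Vs_ge0 n r.
have y0 w : 0 <= 2%:E * (bad n r w)%:E by rewrite mule_ge0// lee_fin.
have my : measurable_fun setT (fun w => 2%:E * (bad n r w)%:E) by exact: measurable_funeM.
apply: (@le_trans _ _ (\int[P]_w ((Vs n r w)%:E + 2%:E * (bad n r w)%:E))).
  apply: ae_le_integral_measurablel => //.
  - by move=> w; rewrite lee_fin.
  - by move=> w; exact: adde_ge0.
  by apply: filterS (aeP n) => w gp; rewrite -EFinM -EFinD lee_fin split_ge2.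
rewrite ge0_integralD//.
apply: leeD => //; rewrite ge0_integralZl_EFin//; last by move=> w _; rewrite lee_fin.
by rewrite (EFinM 2); apply: lee_wpmul2l; rewrite ?lee_fin.
Qed.

Lemma expected_edges_near e : (0 < e)%R -> \forall n \near \oo,
  (6 - e)%:E <= \int[P]_w N n w <= (6 + e)%:E.
Proof.
move=> e0.
have K0 : (0 <= K)%R by have := momentP 0 (true, true); rewrite mul0e lee_fin.
have K1 : (0 < 8 * K + 1)%R by rewrite ltr_wpDl// mulr_ge0.
(* [eta], [b] and [L] are chosen in this order, before [n]. The upper estimate loses [e / 4] three
   times: to the second moment, to the bad event and to the comparison with split vertices. The
   lower one loses [6 * b] and [e / 4]. *)
pose eta := (e / (4 * (8 * K + 1)))%R.
have eta0 : (0 < eta)%R by rewrite divr_gt0// mulr_gt0.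
have etaK : (eta * (8 * K + 1) = e / 4)%R by rewrite /eta; field; rewrite gt_eqF.
clearbody eta; pose b := Num.min (e / 24)%R (e * eta)%R.
have b0 : (0 < b)%R by rewrite lt_min divr_gt0//= mulr_gt0.
have b1 : (6 * b <= e / 4)%R.
  have : (b <= e / 24)%R by rewrite ge_min lexx.
  lra.
have b2 : ((4 * eta)^-1 * b <= e / 4)%R.
  rewrite mulrC ler_pdivrMr ?mulr_gt0//.
  rewrite (_ : e / 4 * (4 * eta) = e * eta)%R; last by field.
  by rewrite ge_min lexx orbT.
(* Then [n * (c * r ^+ 2) = 4 / b], and the mean of [bad] is at most [4 / (1 + 4 / b) <= b]. *)
pose L := (4 / (b * c))%R.
have L0 : (0 < L)%R by rewrite divr_gt0// mulr_gt0.
have e40 : (0 < e / 4)%R by rewrite divr_gt0.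
have split_near := expected_pairs_split f_pdf x_leb muE L0 e40.
(* [n >= L / s0 ^+ 2] means [r <= s0], the range in which [quarterP] bounds the squares from
   below. *)
apply: filterS (filterI split_near (filterI (nbhs_infty_ger (L / s0 ^+ 2)) (nbhs_infty_gt 0))).
move=> n /= [+ [nL n0]]; set r := Num.sqrt (L / n%:R) => -[h1 h2].
have p0 : (0 < n%:R :> R)%R by rewrite ltr0n.
have r2 : (r ^+ 2 = L / n%:R)%R by rewrite sqr_sqrtr// divr_ge0// ltW.
have r_le : (r <= s0)%R.
  rewrite -(@ler_pXn2r _ 2)// ?nnegrE ?sqrtr_ge0 ?(ltW s00)// r2.
  rewrite ler_pdivrMr// mulrC -ler_pdivrMr ?exprn_gt0//.
have hb : \int[P]_w (bad n r w)%:E <= b%:E.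
  apply: (le_trans (expected_bad n _)); first by rewrite sqrtr_ge0.
  rewrite r2 lee_fin.
  rewrite (_ : n%:R * (c * (L / n%:R)) = 4 / b)%R; last first.
    by rewrite /L; field; rewrite !gt_eqF.
  rewrite ler_pdivrMr; last by rewrite ltr_pwDl// divr_ge0// ltW.
  by rewrite mulrDr mulr1 mulrCA divff ?gt_eqF// mulr1 lerDr ltW.
have h3 := expected_sides_ge n r.
have h4 := expected_sides_le eta0 hb.
have h5 := expected_split_le n r.
have h6 := expected_split_ge hb.
rewrite -EVE -EVsE in h1 h2.
move: h1 h2 h3 h4 h5 h6.
move: (\int[P]_w (V n r w)%:E) (\int[P]_w (Vs n r w)%:E) (\int[P]_w N n w).
move=> [u| |] [v| |] [z| |] //=; rewrite -?EFinM -?EFinD ?lee_fin.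
by rewrite etaK; move=> *; apply/andP; split; lra.
Qed.

Lemma expected_edges_cvg : (\int[P]_w N n w) @[n --> \oo] --> 6%:E.
Proof.
apply/fine_cvgP; split.
  apply: filterS (expected_edges_near ltr01) => n /andP[h1 h2].
  by rewrite fin_real// (lt_le_trans _ h1) ?ltNyr// (le_lt_trans h2) ?ltry.
apply/cvgrPdist_le => e e0; apply: filterS (expected_edges_near e0) => n /=.
case: (\int[P]_w N n w) => [z| |] /=; rewrite ?lee_fin ?leNgt ?ltry ?ltNyr ?andbF//.
by rewrite -!leNgt distrC ler_distl.
Qed.

End limit.
End moment.
End voronoi_edges.

Theorem proposition2p1 (R : realType) (d : measure_display)
    (T : measurableType d) (P : probability T R)
    (f : R * R -> R) (x : R * R) (X : nat -> {RV P >-> (R * R)%type})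
    (f_pdf : is_pdf f) (x_lebesgue : lebesgue_pt2 f x) (fx_gt0 : 0 < f x)
    (X_iid : iid_with_density f X) :
  (ereal_sup [set \int[P]_w
       (number_of_edges (voronoi_cell n (fun i => X i w) x) ^+ 2)
     | n in [set n | (1 <= n)%N]] < +oo)%E /\
  ((\int[P]_w (number_of_edges (voronoi_cell n (fun i => X i w) x)))%E
     @[n --> \oo] --> 6%:E).
Proof.
have [X_indep law] := X_iid.
(* The law of a sample is a probability by construction; the hypothesis on the sample identifies it
   with the measure of density [f]. *)
pose mu := distribution P (X 0).
have muE A : measurable A -> mu A = (\int[plane_leb]_(u in A) (f u)%:E)%E.
  move=> mA; rewrite /mu law// integral_lebesgue2//.
    by apply: measurable_funTS; apply/measurable_EFinP; exact: (pdf_measurable f_pdf).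
  by move=> u; rewrite lee_fin (pdf_ge0 f_pdf).
have X_law i B : measurable B -> P (X i @^-1` B) = mu B.
  by move=> mB; have := law i B mB; rewrite -(law 0 B mB).
have [C C0 ballP] := mu_eball_le f_pdf x_lebesgue muE.
have [c [s0 [c0 s00 quarterP]]] := mu_quarter_ge f_pdf x_lebesgue muE fx_gt0.
have [K momentP] : exists K, forall n e,
    ((n * (n - 1))%:R%:E * void_integral mu setT (quarter_graph e x s0) n <= K%:E)%E.
  apply: (void_quarter_moment _ (@exprn_poly_decay R) C0 c0 s00 ballP quarterP).
  exact: ler0n.
split; last first.
  exact: (expected_edges_cvg f_pdf x_lebesgue X_indep X_law muE momentP c0 s00 quarterP).
apply: (@le_lt_trans _ _ (8 * K + 1)%:E); last exact: ltry.
apply: ge_ereal_sup => _ [n _ <-].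
exact: (second_moment_edges f_pdf X_indep X_law muE momentP).
Qed.
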